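(* Let $1<p<\infty$ and $m\in\mathbb{N}$, and let $T=[a_{i-j}]_{i,j=0}^\infty$ be a semi-infinite block Toeplitz matrix, where each $a_j$ ($j\in\mathbb{Z}$) is a complex $m\times m$ matrix. Then $T$ is the block Toeplitz representation of an operator $T_\Omega$ for a rational $m\times m$ matrix function $\Omega(z)$, possibly with poles on $\mathbb{T}$, if and only if all of the following conditions hold: (i) $\|a_0\|,\|a_1\|,\ldots$ are the Taylor coefficients of a function in $H^p$; (ii) $\|a_{-j}\|\le K\binom{j}{M-1}$, $j\ge 1$, for some $M\in\mathbb{N}$ and $K>0$; (iii) $\max_{k\ge1}\operatorname{rank} H_k^+=:n_+<\infty$ and $\max_{k\ge 1}\operatorname{rank} H_k^-=:n_-<\infty$, where $H_k^+=[a_{i+j-1}]_{i,j=1}^k$ and $H_k^-=[a_{-(i+j-1)}]_{i,j=1}^k$ are the $k\times k$ block Hankel matrices with $m\times m$ blocks.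
   Context: $\mathbb{T}$ is the unit circle and $\mathbb{D}$ the open unit disc in $\mathbb{C}$. $L^p_m(\mathbb{T})$ and $H^p_m$ are the spaces of vector-valued functions of length $m$ with entries in $L^p(\mathbb{T})$ and in the Hardy space $H^p$ over $\mathbb{D}$, respectively; $\mathbb{P}$ is the Riesz projection of $L^p_m(\mathbb{T})$ onto $H^p_m$. $\mathrm{Rat}_0^m(\mathbb{T})$ is the set of strictly proper rational vector-valued functions of length $m$ with poles only on $\mathbb{T}$ (including the zero function). For a rational $m\times m$ matrix function $\Omega(z)$, the (generally unbounded) Toeplitz-like operator $T_\Omega$ from $H^p_m$ to $H^p_m$ is defined by $$\operatorname{Dom}(T_\Omega)=\{f\in H^p_m:\ \Omega f=h+r \text{ with } h\in L^p_m(\mathbb{T}),\ r\in \mathrm{Rat}_0^m(\mathbb{T})\},\qquad T_\Omega f=\mathbb{P}h.$$ The domain of $T_\Omega$ contains all vector polynomials of size $m$. The block Toeplitz representation of $T_\Omega$ is its block matrix $[t_{i,j}]_{i,j=0}^\infty$, $t_{i,j}\in\mathbb{C}^{m\times m}$, with respect to the standard block basis of $H^p_m$, i.e., for each $w\in\mathbb{C}^m$ and $j\ge0$ the vector $t_{i,j}w$ is the $i$-th Taylor coefficient of $T_\Omega(z^jw)$; it has the form $t_{i,j}=a_{i-j}$. The norm $\|\cdot\|$ on matrices is the operator norm, and $\binom{j}{M-1}$ is the binomial coefficient.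
   Formalization: Condition (ii) is required only for j ≥ max(1, M−1), where the binomial coefficient is nonzero; required for every j ≥ 1, it would force a_{-j}=0 for 1 ≤ j < M−1 and the ''only if'' part fails, e.g. for Ω = z²/(z−1)³ with m = 1. *)

(* Defs.v *)
From HB Require Import structures.
From mathcomp Require Import all_boot all_order all_algebra.
From mathcomp Require Import all_classical all_reals all_analysis.
From mathcomp Require Import complex.

Set Implicit Arguments.
Unset Strict Implicit.
Unset Printing Implicit Defensive.

Import Order.TTheory GRing.Theory Num.Theory numFieldNormedType.Exports.

Local Open Scope classical_set_scope.
Local Open Scope ring_scope.
Local Open Scope complex_scope.

(* Functions on the unit circle are functions of the angle t in [0, 2 pi];
   the modulus of z : R[i] as an element of R is [normc z].  The topology of
   the complex plane is the one of the numFieldType alias R[i]^o. *)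

Notation normc := Normc.normc.

Definition cis (R : realType) (t : R) : R[i] := cos t +i* sin t.

Definition circle (R : realType) : set R := [set` `[0, 2 * pi]].

Definition circle_ae (R : realType) (P : R -> Prop) : Prop :=
  {ae lebesgue_measure, forall t : R, circle t -> P t}.

Definition in_Lp (R : realType) (p : R) (h : R -> R[i]) : Prop :=
  [/\ measurable_fun (@circle R) (fun t => complex.Re (h t)),
      measurable_fun (@circle R) (fun t => complex.Im (h t)) &
      (\int[lebesgue_measure]_(t in @circle R)
          (powR (normc (h t)) p)%:E < +oo)%E].

Definition circle_integral (R : realType) (h : R -> R[i]) : R[i] :=
  Rintegral lebesgue_measure (@circle R) (fun t => complex.Re (h t))
  +i* Rintegral lebesgue_measure (@circle R) (fun t => complex.Im (h t)).

Definition fourier_coef (R : realType) (h : R -> R[i]) (n : int) : R[i] :=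
  ((2 * pi)^-1)%:C * circle_integral (fun t => h t * cis (- (n%:~R * t))).

(* c is the sequence of Taylor coefficients at 0 of F, analytic on the open
   unit disc; the values of F outside the disc are irrelevant. *)
Definition taylor_coefs (R : realType) (F : R[i] -> R[i]) (c : nat -> R[i]) :
    Prop :=
  forall z : R[i], normc z < 1 ->
    series (fun n => c n * z ^+ n) @ \oo --> (F z : R[i]^o).

Definition in_Hp (R : realType) (p : R) (F : R[i] -> R[i]) : Prop :=
  (exists c, taylor_coefs F c) /\
  exists K : R, forall r : R, 0 <= r < 1 ->
    (\int[lebesgue_measure]_(t in @circle R)
        (powR (normc (F (r%:C * cis t))) p)%:E <= K%:E)%E.

Definition boundary_values (R : realType) (F : R[i] -> R[i]) (phi : R -> R[i]) :
    Prop :=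
  circle_ae (fun t => F (r%:C * cis t) @[r --> 1^'-] --> (phi t : R[i]^o)).

Definition in_Lp_vec (R : realType) (p : R) (m : nat) (h : R -> 'cV[R[i]]_m) :
    Prop :=
  forall k, in_Lp p (fun t => h t k 0).

Definition in_Hp_vec (R : realType) (p : R) (m : nat)
    (f : R[i] -> 'cV[R[i]]_m) : Prop :=
  forall k, in_Hp p (fun z => f z k 0).

Definition taylor_coefs_vec (R : realType) (m : nat) (f : R[i] -> 'cV[R[i]]_m)
    (c : nat -> 'cV[R[i]]_m) : Prop :=
  forall k, taylor_coefs (fun z => f z k 0) (fun n => c n k 0).

Definition boundary_values_vec (R : realType) (m : nat)
    (f : R[i] -> 'cV[R[i]]_m) (phi : R -> 'cV[R[i]]_m) : Prop :=
  forall k, boundary_values (fun z => f z k 0) (fun t => phi t k 0).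

(* g = P h, where the Riesz projection P of L^p_m onto H^p_m drops the
   Fourier coefficients of negative index. *)
Definition riesz_projection (R : realType) (p : R) (m : nat)
    (h : R -> 'cV[R[i]]_m) (g : R[i] -> 'cV[R[i]]_m) : Prop :=
  in_Hp_vec p g /\
  taylor_coefs_vec g (fun n => \col_k fourier_coef (fun t => h t k 0) n%:Z).

Notation ratfun R := {fraction {poly R[i]}}.

(* The representative of x need not be a reduced fraction, so this may return
   a junk value at finitely many points besides the poles; it is only used
   almost everywhere on the circle. *)
Definition rat_eval (R : realType) (x : ratfun R) (z : R[i]) : R[i] :=
  (frac (repr x)).1.[z] / (frac (repr x)).2.[z].

(* In the reduced fraction s / q the poles are exactly the roots of q. *)
Definition in_Rat0 (R : realType) (x : ratfun R) : Prop :=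
  exists s q : {poly R[i]},
    [/\ x = @FracField.tofrac _ s / @FracField.tofrac _ q,
        coprimep s q, (size s < size q)%N
      & forall z, root q z -> normc z = 1].

Definition in_Rat0_vec (R : realType) (m : nat) (r : 'cV[ratfun R]_m) : Prop :=
  forall k, in_Rat0 (r k 0).

(* The graph of T_Omega: f is in Dom(T_Omega) and T_Omega f = g.  It is
   single-valued because a nonzero element of Rat_0^m is not in L^p_m.  The
   product Omega f is taken on the circle, f being identified there with its
   radial boundary values phi. *)
Definition toeplitz_like (R : realType) (p : R) (m : nat)
    (Omega : 'M[ratfun R]_m) (f g : R[i] -> 'cV[R[i]]_m) : Prop :=
  in_Hp_vec p f /\
  exists (phi h : R -> 'cV[R[i]]_m) (r : 'cV[ratfun R]_m),
    [/\ boundary_values_vec f phi, in_Lp_vec p h, in_Rat0_vec r,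
        circle_ae (fun t =>
          map_mx (fun x => rat_eval x (cis t)) Omega *m phi t =
          h t + map_mx (fun x => rat_eval x (cis t)) r)
      & riesz_projection p h g].

Definition block_toeplitz_representation (R : realType) (p : R) (m : nat)
    (Omega : 'M[ratfun R]_m) (t : nat -> nat -> 'M[R[i]]_m) : Prop :=
  forall (w : 'cV[R[i]]_m) (j : nat),
    exists g : R[i] -> 'cV[R[i]]_m,
      toeplitz_like p Omega (fun z => z ^+ j *: w) g /\
      taylor_coefs_vec g (fun i => t i j *m w).

Definition euclidean_norm (R : realType) (m : nat) (x : 'cV[R[i]]_m) : R :=
  Num.sqrt (\sum_k normc (x k 0) ^+ 2).

Definition opnorm (R : realType) (m : nat) (A : 'M[R[i]]_m) : R :=
  sup [set euclidean_norm (A *m x) | x in [set x | euclidean_norm x <= 1]].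

(* With 0-based block indices the (i, j) block of H_k^+ is a_(i + j + 1) and
   that of H_k^- is a_(-(i + j + 1)). *)
Definition hankel_plus (R : realType) (m : nat) (a : int -> 'M[R[i]]_m)
    (k : nat) :=
  \mxblock_(i < k, j < k) a (i + j).+1%:Z.

Definition hankel_minus (R : realType) (m : nat) (a : int -> 'M[R[i]]_m)
    (k : nat) :=
  \mxblock_(i < k, j < k) a (- (i + j).+1%:Z).

(* n = max_(k >= 1) u k. *)
Definition is_max_ge1 (u : nat -> nat) (n : nat) : Prop :=
  (exists2 k, (1 <= k)%N & u k = n) /\ (forall k, (1 <= k)%N -> (u k <= n)%N).

(* Main.v *)
(* Split Omega as A + B, where A has its poles outside the closed disc and B is
   strictly proper with its poles in the closed disc.  The a_n, n >= 0, are the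
   Taylor coefficients of A at 0, and the a_(-n), n >= 1, are the coefficients of
   B at infinity: for a pole on the circle they come from the polynomial part of
   z^n B, which T_Omega keeps when it discards the remaining element of Rat_0.
   By Kronecker's theorem the ranks in (iii) are bounded exactly when each entry
   of (a_n), n >= 1, and of (a_(-n)), n >= 1, satisfies a linear recurrence; we
   write act Q x = 0 for the recurrence with characteristic polynomial Q.
   The poles are the roots of the minimal Q (or their inverses), and minimality
   makes each root z visible in the growth of the sequence: z^n is bounded by a
   constant times the sum of |x_n|, ..., |x_(n+d)|.  So polynomial growth means
   roots in the closed disc.  A root on the circle is impossible for (a_n),
   n >= 0: the function of (i) has nonnegative coefficients b_n, so it would be of
   order 1 / (1 - r) at r and, by a derivative bound, on an arc of length of order
   1 - r; its p-th means would be at least of order (1 - r)^(1 - p), and p > 1.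
   Uniqueness of the decomposition Omega f = h + r holds because an element of
   Rat_0 that is integrable on the circle has no poles. *)

Require Import Defs.
From HB Require Import structures.
From mathcomp Require Import all_boot all_order all_algebra.
From mathcomp Require Import all_classical all_reals all_analysis.
From mathcomp Require Import complex measurable_realfun.
From mathcomp Require Import ring lra zify.

Set Implicit Arguments.
Unset Strict Implicit.
Unset Printing Implicit Defensive.

Import Order.TTheory GRing.Theory Num.Theory numFieldNormedType.Exports.

Local Open Scope classical_set_scope.
Local Open Scope ring_scope.
Local Open Scope complex_scope.

(** * Linear recurrences *)

(** The problem is treated entry by entry: [opnorm] bounds every entry and is bounded by the sum of
    their moduli, so the recurrences, the poles and (ii) are matters of scalar sequences. Condition
    (i) is the exception, since it concerns the function whose coefficients are the norms. What
    passes to it from an entry is a lower bound: a root on the circle keeps windows of the entry,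
    hence windows of the norms, away from 0. The decomposition of Omega z^j is a Euclidean division:
    for V / Q with poles on the circle, the quotient of z^j V by Q goes into h and the remainder
    over Q is r. Comparing decompositions for different j by uniqueness yields the recurrence and
    the growth of (a_(-n)). The memberships in H^p and L^p to be proved concern only monomials,
    Taylor series with geometric decay and bounded functions; conversely, h in L^p is used through
    L^1, where Fourier coefficients are bounded. *)

Section PolyAction.
Variable K : comNzRingType.
Implicit Types (P Q : {poly K}) (x y : nat -> K).

(** This is Q evaluated at the left shift. Sequences thus form a module over the polynomials
    ([actM]), on which minimal annihilators and the Bezout splitting of [scalar_symbol] rest. *)
Definition act Q x (n : nat) : K := \sum_(i < size Q) Q`_i * x (n + i)%N.

Lemma actE N Q x n : (size Q <= N)%N ->
  act Q x n = \sum_(i < N) Q`_i * x (n + i)%N.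
Proof.
move=> sQN; rewrite /act (big_ord_widen N (fun i => Q`_i * x (n + i)%N)) //.
rewrite big_mkcond; apply: eq_bigr => i _; case: ifPn => //.
by rewrite -leqNgt => h; rewrite nth_default // mul0r.
Qed.

Lemma actDl P Q x n : act (P + Q) x n = act P x n + act Q x n.
Proof.
pose N := maxn (size P) (size Q).
rewrite !(@actE N) ?leq_maxl ?leq_maxr ?size_polyD //.
by rewrite -big_split; apply: eq_bigr => i _; rewrite coefD mulrDl.
Qed.

Lemma actZl c Q x n : act (c *: Q) x n = c * act Q x n.
Proof.
rewrite (@actE (size Q)) ?size_scale_leq // mulr_sumr.
by apply: eq_bigr => i _; rewrite coefZ mulrA.
Qed.

Lemma actC c x n : act c%:P x n = c * x n.
Proof.
by rewrite (@actE 1) ?size_polyC_leq1 // big_ord1 coefC eqxx addn0.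
Qed.

Lemma actXM Q x n : act (Q * 'X) x n = act Q x n.+1.
Proof.
rewrite (@actE (size Q).+1) ?big_ord_recl; last first.
  by case: (eqVneq Q 0) => [->|h]; rewrite ?mul0r ?size_poly0 // size_mulX.
rewrite coefMX eqxx mul0r add0r; apply: eq_bigr => i _.
by rewrite coefMX lift0 /= addSn addnS.
Qed.

Lemma act_shift Q x n k : act Q (fun i => x (i + k)%N) n = act Q x (n + k)%N.
Proof. by apply: eq_bigr => i _; rewrite addnAC. Qed.

Lemma eq_act Q x y : x =1 y -> act Q x =1 act Q y.
Proof. by move=> xy n; apply: eq_bigr => i _; rewrite xy. Qed.

Lemma actM P Q x n : act (P * Q) x n = act P (act Q x) n.
Proof.
elim/poly_ind: P n => [|P c IH] n; first by rewrite mul0r /act size_poly0 !big_ord0.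
rewrite mulrDl actDl -mulrA ['X * Q]mulrC mulrA actXM IH.
by rewrite mul_polyC actZl actDl actXM actC.
Qed.

Lemma act0 P x n : x =1 (fun=> 0) -> act P x n = 0.
Proof. by move=> x0; apply: big1 => i _; rewrite x0 mulr0. Qed.

Lemma actXsubC c x n : act ('X - c%:P) x n = x n.+1 - c * x n.
Proof. by rewrite -polyCN actDl actC -['X]mul1r actXM actC mul1r mulNr. Qed.

(* If Q annihilates x, then polar_num Q x / Q has the expansion
   \sum_n x_n z^(-n-1) at infinity. *)
Definition polar_num Q x : {poly K} :=
  \poly_(k < (size Q).-1) \sum_(k.+1 <= i < size Q) Q`_i * x (i - k.+1)%N.

Lemma coef_polar_num Q x k :
  (polar_num Q x)`_k = \sum_(k.+1 <= i < size Q) Q`_i * x (i - k.+1)%N.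
Proof.
rewrite coef_poly; case: ifPn => // h; rewrite big_geq //; lia.
Qed.

Lemma size_polar_num Q x : Q != 0 -> (size (polar_num Q x) < size Q)%N.
Proof.
rewrite -size_poly_gt0 => Q0; apply: leq_ltn_trans (size_poly _ _) _; lia.
Qed.

(** Multiplying \sum_n x_n z^(-n-1) by z splits off the constant x_0 and shifts the rest; this is
    that identity times Q. The hypothesis is its coefficient of index 0. *)
Lemma polar_num_step Q x : act Q x 0 = 0 ->
  'X * polar_num Q x = x 0 *: Q + polar_num Q (fun n => x n.+1).
Proof.
move=> Qx; have [->|Q0] := eqVneq Q 0.
  have num0 y : polar_num 0 y = 0.
    by apply/polyP => k; rewrite coef_polar_num size_poly0 big_geq // coef0.
  by rewrite !num0 mulr0 scaler0 add0r.
apply/polyP => -[|k]; rewrite mulrC coefMX coefD coefZ !coef_polar_num /=.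
  rewrite -[LHS]Qx /act -(big_mkord predT (fun i => Q`_i * x (0 + i)%N)).
  rewrite [LHS]big_ltn ?size_poly_gt0 // mulrC; congr (_ + _).
  rewrite [LHS]big_nat_cond [RHS]big_nat_cond.
  by apply: eq_bigr => i /andP[/andP[i0 _] _]; congr (_ * x _); lia.
have [sQ|sQ] := leqP (size Q) k.+1.
  by rewrite [LHS]big_geq // nth_default // mulr0 add0r big_geq // (leq_trans sQ).
rewrite [LHS]big_ltn // subnn mulrC; congr (_ + _).
rewrite [LHS]big_nat_cond [RHS]big_nat_cond.
by apply: eq_bigr => i /andP[/andP[i0 _] _]; congr (_ * x _); lia.
Qed.

(** The polynomial part of z^N \sum_n x_n z^(-n-1). *)
Definition expansion x N : {poly K} := \poly_(i < N) x (N.-1 - i)%N.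

Lemma expansionS x N : expansion x N.+1 = 'X * expansion x N + (x N)%:P.
Proof.
apply/polyP => k; rewrite mulrC coefD coefMX coefC !coef_poly ltnS /=.
case: k => [|k] /=; first by rewrite subn0 add0r.
by rewrite addr0; case: ltnP => // h; congr (x _); lia.
Qed.

(** For nonzero Q this is the Euclidean division of z^N [polar_num Q x] by Q, the remainder being
    the numerator of the shifted sequence. Over Q, it gives the decomposition of z^N times the
    symbol into a polynomial and a strictly proper part. *)
Lemma polar_num_iter Q x N : act Q x =1 (fun=> 0) ->
  'X^N * polar_num Q x = expansion x N * Q + polar_num Q (fun n => x (n + N)%N).
Proof.
move=> Qx; elim: N => [|N IH].
  rewrite expr0 mul1r /expansion poly_def big_ord0 mul0r add0r.
  by congr polar_num; apply/funext => n; rewrite addn0.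
rewrite exprS -mulrA IH mulrDr polar_num_step ?act_shift // add0n addrA mulrA.
rewrite -mul_polyC -mulrDl -expansionS; congr (_ + polar_num _ _).
by apply/funext => n; rewrite addSnnS.
Qed.

End PolyAction.

Section MinimalAnnihilator.
Variable K : fieldType.
Implicit Types (P Q : {poly K}) (x y : nat -> K).

(** The annihilators of x form an ideal, generated by a nonzero member of least size. *)
Lemma min_annihilator P x : P != 0 -> act P x =1 (fun=> 0) ->
  exists Q, [/\ Q \is monic, act Q x =1 (fun=> 0) &
    forall S, act S x =1 (fun=> 0) -> Q %| S].
Proof.
move=> P0 Px.
pose A n := `[< exists Q, [/\ Q != 0, size Q = n & act Q x =1 (fun=> 0)] >].
have exA : exists n, A n by exists (size P); apply/asboolP; exists P.
case: (ex_minnP exA) => n /asboolP[Q [Q0 sQ Qx]] minQ.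
have Qxn : act ((lead_coef Q)^-1 *: Q) x =1 (fun=> 0).
  by move=> k; rewrite actZl Qx mulr0.
have lQ : (lead_coef Q)^-1 != 0 by rewrite invr_eq0 lead_coef_eq0.
exists ((lead_coef Q)^-1 *: Q); split=> //.
  by rewrite monicE lead_coefZ mulVf ?lead_coef_eq0.
move=> S Sx; rewrite dvdpZl //; apply/modp_eq0P/eqP; apply: contraT => SQ0.
have: A (size (S %% Q)).
  apply/asboolP; exists (S %% Q); split=> // k.
  have -> : S %% Q = S - (S %/ Q) * Q by rewrite {2}(divp_eq S Q); ring.
  rewrite -scaleN1r actDl actZl actM Sx (act0 _ _ Qx); ring.
by move/minQ; rewrite -sQ leqNgt ltn_modp Q0.
Qed.

Lemma act_neq0 Q x z : (forall S, act S x =1 (fun=> 0) -> ('X - z%:P) * Q %| S) ->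
  Q != 0 -> act (('X - z%:P) * Q) x =1 (fun=> 0) ->
  act Q x 0%N != 0 /\ forall n, act Q x n = z ^+ n * act Q x 0.
Proof.
move=> minQ Q0 Qx.
have yE n : act Q x n = z ^+ n * act Q x 0.
  elim: n => [|n IH]; first by rewrite expr0 mul1r.
  have := Qx n; rewrite actM actXsubC => /subr0_eq ->.
  by rewrite IH exprS mulrA.
split=> //; apply/negP => /eqP y0.
have /minQ : act Q x =1 (fun=> 0) by move=> n; rewrite yE y0 mulr0.
move/(dvdp_leq Q0); rewrite size_mul ?polyXsubC_eq0 // size_XsubC; lia.
Qed.

End MinimalAnnihilator.

(** * Growth of sequences annihilated by a polynomial *)

Section Modulus.
Variable R : rcfType.
Implicit Types (z w : R[i]) (x : nat -> R[i]).

Lemma normc_ge0 z : 0 <= normc z.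
Proof. by case: z => a b /=; rewrite sqrtr_ge0. Qed.

Lemma normc_eq0 z : (normc z == 0) = (z == 0).
Proof.
apply/eqP/eqP => [/Normc.eq0_normc //|->]; exact: Normc.normc0.
Qed.

Lemma normc_gt0 z : (0 < normc z) = (z != 0).
Proof. by rewrite lt_def normc_ge0 andbT normc_eq0. Qed.

Lemma normcX z n : normc (z ^+ n) = normc z ^+ n.
Proof.
elim: n => [|n IH]; first by rewrite !expr0 Normc.normc1.
by rewrite !exprS Normc.normcM IH.
Qed.

Lemma normc_sum (I : Type) (r : seq I) (P : pred I) (F : I -> R[i]) :
  normc (\sum_(i <- r | P i) F i) <= \sum_(i <- r | P i) normc (F i).
Proof.
elim/big_rec2: _ => [|i y u _ h]; first by rewrite Normc.normc0.
exact: le_trans (le_normcD _ _) (lerD _ _).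
Qed.

Lemma normc_real (a : R) : normc a%:C = `|a|.
Proof. by rewrite /= expr0n addr0 sqrtr_sqr. Qed.

Lemma normRe_le z : `|complex.Re z| <= normc z.
Proof.
case: z => a b /=; rewrite -[X in X <= _]sqrtr_sqr ler_sqrt ?addr_ge0 ?sqr_ge0 //.
by rewrite lerDl sqr_ge0.
Qed.

Lemma normIm_le z : `|complex.Im z| <= normc z.
Proof.
case: z => a b /=; rewrite -[X in X <= _]sqrtr_sqr ler_sqrt ?addr_ge0 ?sqr_ge0 //.
by rewrite lerDr sqr_ge0.
Qed.

Lemma normc_le_ReIm z : normc z <= `|complex.Re z| + `|complex.Im z|.
Proof.
case: z => a b /=.
rewrite (_ : `|a| + `|b| = Num.sqrt ((`|a| + `|b|) ^+ 2)); last first.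
  by rewrite sqrtr_sqr (ger0_norm (addr_ge0 (normr_ge0 a) (normr_ge0 b))).
rewrite ler_sqrt ?sqr_ge0 // sqrrD !real_normK ?num_real //.
by rewrite -addrA addrCA lerDr mulrn_wge0 // mulr_ge0.
Qed.

Lemma normcB_le z w : normc z - normc w <= normc (z - w).
Proof. by rewrite lerBlDr -{1}(subrK w z) le_normcD. Qed.

Lemma normc_poly (Q : {poly R[i]}) : exists2 C, 0 <= C &
  forall z, normc z <= 1 -> normc Q.[z] <= C.
Proof.
exists (\sum_(i < size Q) normc Q`_i); first by apply: sumr_ge0 => i _; exact: normc_ge0.
move=> z z1; rewrite horner_coef; apply: le_trans (normc_sum _ _ _) _.
apply: ler_sum => i _; rewrite Normc.normcM normcX ler_piMr ?normc_ge0 //.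
by rewrite exprn_ile1 ?normc_ge0.
Qed.

Lemma strict_radius (s : seq R[i]) : (forall z, z \in s -> normc z < 1) ->
  exists r : R, [/\ 0 < r, r < 1 & forall z, z \in s -> normc z < r].
Proof.
elim: s => [_|z s IH h]; first by exists 2^-1; split=> //; lra.
have [|r [r0 r1 hr]] := IH; first by move=> w ws; apply: h; rewrite in_cons ws orbT.
have z1 : normc z < 1 by apply: h; rewrite mem_head.
have z0 := normc_ge0 z.
exists (Num.max r ((1 + normc z) / 2)); split.
- by rewrite lt_max r0.
- by rewrite gt_max r1 /=; lra.
- move=> w; rewrite in_cons lt_max => /orP[/eqP->|/hr -> //].
  by apply/orP; right; lra.
Qed.

(** By induction on the roots: x_(n+1) - z x_n obeys the recurrence with one root fewer. The strict
    inequality |z| < r absorbs the polynomial factors that multiple roots produce. *)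
Lemma geometric_growth (s : seq R[i]) (r : R) x : 0 < r ->
    (forall z, z \in s -> normc z < r) ->
    act (\prod_(z <- s) ('X - z%:P)) x =1 (fun=> 0) ->
  exists2 C, 0 <= C & forall n, normc (x n) <= C * r ^+ n.
Proof.
move=> r0; elim: s x => [|z s IH] x hs.
  rewrite big_nil => x0; exists 0 => // n.
  have := x0 n; rewrite -[1]/(1%:P) actC mul1r => ->.
  by rewrite Normc.normc0 mul0r.
rewrite big_cons mulrC => hx.
have [|n|C C0 hC] := IH (act ('X - z%:P) x).
- by move=> w ws; apply: hs; rewrite in_cons ws orbT.
- by rewrite -actM hx.
have zr : normc z < r by apply: hs; rewrite mem_head.
have z0 := normc_ge0 z.
(* The second term gives C + |z| D <= r D, so that the bound D r^n reproduces itself from n to n +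
   1. *)
pose D := Num.max (normc (x 0)) (C / (r - normc z)).
have D1 : C <= D * (r - normc z).
  by rewrite -ler_pdivrMr ?subr_gt0 // le_max lexx orbT.
exists D => [|n]; first by rewrite le_max normc_ge0.
elim: n => [|n IHn]; first by rewrite expr0 mulr1 le_max lexx.
have := hC n; rewrite actXsubC => hn.
have -> : x n.+1 = (x n.+1 - z * x n) + z * x n by rewrite subrK.
apply: le_trans (le_normcD _ _) _; rewrite Normc.normcM.
apply: le_trans (lerD hn (ler_wpM2l z0 IHn)) _.
rewrite exprS !mulrA -mulrDl.
rewrite ler_wpM2r ?exprn_ge0 ?(ltW r0) //.
by move: D1; rewrite mulrBr lerBrDr [D * normc z]mulrC.
Qed.

(** Each root costs one power of n: since |z| <= 1, |x_n| is at most |x_0| plus the sum of the first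
    n moduli of x_(k+1) - z x_k. *)
Lemma polynomial_growth (s : seq R[i]) x :
    (forall z, z \in s -> normc z <= 1) ->
    act (\prod_(z <- s) ('X - z%:P)) x =1 (fun=> 0) ->
  exists C N, 0 <= C /\ forall n, normc (x n) <= C * n.+1%:R ^+ N.
Proof.
elim: s x => [|z s IH] x hs.
  rewrite big_nil => x0; exists 0, 0%N; split=> // n.
  have := x0 n; rewrite -[1]/(1%:P) actC mul1r => ->.
  by rewrite Normc.normc0 mul0r.
rewrite big_cons mulrC => hx.
have [|n|C [N [C0 hC]]] := IH (act ('X - z%:P) x).
- by move=> w ws; apply: hs; rewrite in_cons ws orbT.
- by rewrite -actM hx.
have z1 : normc z <= 1 by apply: hs; rewrite mem_head.
have z0 := normc_ge0 z.
have hsum n : normc (x n) <= normc (x 0) + n%:R * (C * n.+1%:R ^+ N).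
  elim: n => [|n IHn]; first by rewrite mul0r addr0.
  have := hC n; rewrite actXsubC => hn.
  have -> : x n.+1 = (x n.+1 - z * x n) + z * x n by rewrite subrK.
  apply: le_trans (le_normcD _ _) _; rewrite Normc.normcM.
  have h1 : normc z * normc (x n) <= normc (x n) by rewrite ler_piMl ?normc_ge0.
  have h2 : C * n.+1%:R ^+ N <= C * n.+2%:R ^+ N.
    by rewrite ler_wpM2l // lerXn2r ?nnegrE ?ler0n // ler_nat.
  have h3 : n%:R * (C * n.+1%:R ^+ N) <= n%:R * (C * n.+2%:R ^+ N).
    by rewrite ler_wpM2l.
  by rewrite -[n.+1%:R]natr1 mulrDl mul1r; lra.
exists (normc (x 0) + C), N.+1; split=> [|n]; first by rewrite addr_ge0 ?normc_ge0.
apply: le_trans (hsum n) _; rewrite mulrDl; apply: lerD.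
  by rewrite ler_peMr ?normc_ge0 // exprn_ege1 // ler1n.
rewrite mulrCA ler_wpM2l // exprSr mulrC ler_wpM2l ?exprn_ge0 ?ler0n //.
by rewrite ler_nat.
Qed.

(* Removing the factor X - z from the minimal annihilator Q leaves a sequence
   act P x that is geometric of ratio z and, by minimality, nonzero. *)
Lemma root_growth Q x z : Q \is monic -> act Q x =1 (fun=> 0) ->
    (forall S, act S x =1 (fun=> 0) -> Q %| S) -> root Q z ->
  exists2 C, 0 <= C &
    forall n, normc z ^+ n <= C * \sum_(i < size Q) normc (x (n + i)%N).
Proof.
move=> Qm Qx minQ /factor_theorem[P QE]; rewrite mulrC in QE.
have P0 : P != 0.
  by apply: contraTneq Qm => P0; rewrite QE P0 mulr0 monicE lead_coef0 eq_sym oner_eq0.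
rewrite QE in Qx minQ; have [y0 yE] := act_neq0 minQ P0 Qx.
have sP : (size P <= size Q)%N.
  by rewrite QE size_mul ?polyXsubC_eq0 // size_XsubC /= leq_addl.
have y0' : 0 < normc (act P x 0) by rewrite normc_gt0.
pose D := \sum_(i < size Q) normc P`_i.
have PD i : (i < size Q)%N -> normc P`_i <= D.
  move=> hi; rewrite /D (bigD1 (Ordinal hi)) //= lerDl sumr_ge0 // => j _.
  exact: normc_ge0.
exists (D / normc (act P x 0)).
  by rewrite divr_ge0 ?normc_ge0 // sumr_ge0 // => j _; exact: normc_ge0.
move=> n; rewrite mulrAC ler_pdivlMr // -normcX -Normc.normcM -yE.
rewrite (actE _ _ sP) mulr_sumr; apply: le_trans (normc_sum _ _ _) _.
apply: ler_sum => i _; rewrite Normc.normcM ler_wpM2r ?normc_ge0 //.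
exact: PD.
Qed.

Lemma monic_roots (Q : {poly R[i]}) : Q \is monic ->
  exists s : seq R[i], Q = \prod_(z <- s) ('X - z%:P).
Proof.
move=> /monicP lQ; have [s hs] := closed_field_poly_normal Q.
by exists s; rewrite [LHS]hs lQ scale1r.
Qed.


Lemma annihilated_decay Q x : Q \is monic -> act Q x =1 (fun=> 0) ->
    (forall z, root Q z -> normc z < 1) ->
  exists C (r : R), [/\ 0 <= C, 0 < r, r < 1 & forall n, normc (x n) <= C * r ^+ n].
Proof.
move=> /monic_roots[s ->] Qx hs.
have [|r [r0 r1 hr]] := @strict_radius s.
  by move=> z zs; apply: hs; rewrite root_prod_XsubC.
by have [C C0 hC] := geometric_growth r0 hr Qx; exists C, r.
Qed.

Lemma annihilated_polynomial_growth Q x : Q \is monic ->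
    act Q x =1 (fun=> 0) -> (forall z, root Q z -> normc z <= 1) ->
  exists C N, 0 <= C /\ forall n, normc (x n) <= C * n.+1%:R ^+ N.
Proof.
move=> /monic_roots[s ->] Qx hs; apply: polynomial_growth Qx => z zs.
by apply: hs; rewrite root_prod_XsubC.
Qed.

End Modulus.

(** * Integration on the circle *)

Section CircleFunctions.
Variable R : realType.
Implicit Types (g h : R -> R[i]) (z w : R[i]).

Lemma ReD z w : complex.Re (z + w) = complex.Re z + complex.Re w.
Proof. by case: z => ? ?; case: w. Qed.
Lemma ImD z w : complex.Im (z + w) = complex.Im z + complex.Im w.
Proof. by case: z => ? ?; case: w. Qed.
Lemma ReM z w :
  complex.Re (z * w) = complex.Re z * complex.Re w - complex.Im z * complex.Im w.
Proof. by case: z => ? ?; case: w. Qed.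
Lemma ImM z w :
  complex.Im (z * w) = complex.Re z * complex.Im w + complex.Im z * complex.Re w.
Proof. by case: z => ? ?; case: w => ? ?. Qed.

Lemma complex_eta z : z = complex.Re z +i* complex.Im z.
Proof. by case: z. Qed.

Lemma cisD (s t : R) : cis (s + t) = cis s * cis t.
Proof.
rewrite [RHS]complex_eta ReM ImM /cis cosD sinD /=.
by rewrite [sin s * cos t + _]addrC.
Qed.

Lemma cis0 : cis 0 = 1 :> R[i].
Proof. by rewrite /cis cos0 sin0. Qed.

Lemma normc_cis (t : R) : normc (cis t) = 1.
Proof. by rewrite /= cos2Dsin2 sqrtr1. Qed.

Lemma cis_neq0 (t : R) : cis t != 0.
Proof. by rewrite -normc_eq0 normc_cis oner_eq0. Qed.

Lemma cisN (t : R) : cis (- t) = (cis t)^-1.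
Proof.
by apply: (mulIf (cis_neq0 t)); rewrite mulVf ?cis_neq0 // -cisD addNr cis0.
Qed.

Lemma cisX n (t : R) : cis (n%:R * t) = cis t ^+ n.
Proof.
elim: n => [|n IH]; first by rewrite mul0r cis0 expr0.
by rewrite -natr1 mulrDl mul1r cisD IH exprSr.
Qed.

Lemma cis_2pi (n : int) : cis (n%:~R * (2 * pi)) = 1 :> R[i].
Proof.
have c : cis (2 * pi) = 1 :> R[i].
  by rewrite /cis mulr_natl cos2pi sin2pi.
case: n => n; first by rewrite -[Posz n]/(n%:Z) -pmulrn cisX c expr1n.
by rewrite NegzE mulrNz mulNr cisN -pmulrn cisX c expr1n invr1.
Qed.

Lemma measurable_circle : measurable (@circle R).
Proof. exact: measurable_itv. Qed.
Hint Resolve measurable_circle : core.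

Lemma twopi_gt0 : 0 < 2 * pi :> R.
Proof. by rewrite mulr_gt0 ?pi_gt0. Qed.

Lemma lebesgue_circle : lebesgue_measure (@circle R) = (2 * pi)%:E.
Proof. by rewrite /circle lebesgue_measure_itv /= lte_fin twopi_gt0 oppr0 adde0. Qed.

Lemma circle_ae2 (P Q S : R -> Prop) :
  (forall t, circle t -> P t -> Q t -> S t) ->
  circle_ae P -> circle_ae Q -> circle_ae S.
Proof.
have F : Filter (almost_everywhere (@lebesgue_measure R)).
  exact: ae_filter_ringOfSetsType.
move=> h; rewrite /circle_ae => hP hQ.
by apply: (filterS2 _ _ hP hQ) => t p q ct; exact: h (p ct) (q ct).
Qed.

Lemma circle_ae1 (P S : R -> Prop) :
  (forall t, circle t -> P t -> S t) -> circle_ae P -> circle_ae S.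
Proof. by move=> h hP; apply: (circle_ae2 _ hP hP) => t ct p _; exact: h. Qed.

Lemma circle_aeT (P : R -> Prop) : (forall t, circle t -> P t) -> circle_ae P.
Proof.
have F : Filter (almost_everywhere (@lebesgue_measure R)).
  exact: ae_filter_ringOfSetsType.
by move=> h; rewrite /circle_ae; apply: nearW => t; exact: h.
Qed.

Definition cmeas h :=
  measurable_fun (@circle R) (fun t => complex.Re (h t)) /\
  measurable_fun (@circle R) (fun t => complex.Im (h t)).

Lemma cmeas_cst z : cmeas (fun=> z).
Proof. by split; exact: measurable_cst. Qed.

Lemma cmeasD g h : cmeas g -> cmeas h -> cmeas (fun t => g t + h t).
Proof.
move=> [g1 g2] [h1 h2]; split.
  by under eq_fun do rewrite ReD; exact: measurable_funD.
by under eq_fun do rewrite ImD; exact: measurable_funD.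
Qed.

Lemma cmeasM g h : cmeas g -> cmeas h -> cmeas (fun t => g t * h t).
Proof.
move=> [g1 g2] [h1 h2]; split.
  by under eq_fun do rewrite ReM; apply: measurable_funB; exact: measurable_funM.
by under eq_fun do rewrite ImM; apply: measurable_funD; exact: measurable_funM.
Qed.

Lemma cmeas_sum (I : Type) (s : seq I) (F : I -> R -> R[i]) :
  (forall i, cmeas (F i)) -> cmeas (fun t => \sum_(i <- s) F i t).
Proof.
move=> hF; elim: s => [|i s IH].
  by under eq_fun do rewrite big_nil; exact: cmeas_cst.
by under eq_fun do rewrite big_cons; exact: cmeasD.
Qed.

Lemma cmeas_cis (a : R) : cmeas (fun t => cis (a * t)).
Proof.
have c : continuous (fun t : R => a * t) by move=> t; exact: mulrl_continuous.
split; apply: measurable_funTS; apply: continuous_measurable_fun => t /=.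
  apply: (@continuous_comp _ _ _ (fun t : R => a * t) (@cos R)); first exact: c.
  exact: continuous_cos.
apply: (@continuous_comp _ _ _ (fun t : R => a * t) (@sin R)); first exact: c.
exact: continuous_sin.
Qed.

Lemma cmeas_horner (q : {poly R[i]}) : cmeas (fun t => q.[cis t]).
Proof.
under eq_fun do rewrite horner_coef.
apply: cmeas_sum => i; apply: cmeasM; first exact: cmeas_cst.
by under eq_fun do rewrite -cisX; exact: cmeas_cis.
Qed.

Lemma measurable_normc h : cmeas h ->
  measurable_fun (@circle R) (fun t => normc (h t)).
Proof.
move=> [h1 h2].
rewrite [X in measurable_fun _ X](_ : _ = (@Num.sqrt R) \o
    (fun t => complex.Re (h t) ^+ 2 + complex.Im (h t) ^+ 2)); last first.
  by apply/funext => t /=; case: (h t).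
apply: measurableT_comp; last by apply: measurable_funD; exact: measurable_funX.
by apply: continuous_measurable_fun; exact: sqrt_continuous.
Qed.

Lemma cmeas_cvg (T : nat -> R -> R[i]) h (e : nat -> R) :
  (forall n, cmeas (T n)) -> e @ \oo --> 0 ->
  (forall n t, circle t -> normc (h t - T n t) <= e n) -> cmeas h.
Proof.
move=> mT e0 hT; split.
  apply: (@measurable_fun_cvg _ _ _ _ (fun n t => complex.Re (T n t))).
    by move=> n; case: (mT n).
  move=> t ct; apply/cvgrPdist_le => /= eps eps0.
  have /cvgrPdist_le /(_ _ eps0) := e0; apply: filterS => n.
  rewrite sub0r normrN => he; apply: le_trans (le_trans (ler_norm _) he).
  apply: le_trans (hT n t ct); apply: le_trans (normRe_le _).
  by case: (h t) => ? ?; case: (T n t).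
apply: (@measurable_fun_cvg _ _ _ _ (fun n t => complex.Im (T n t))).
  by move=> n; case: (mT n).
move=> t ct; apply/cvgrPdist_le => /= eps eps0.
have /cvgrPdist_le /(_ _ eps0) := e0; apply: filterS => n.
rewrite sub0r normrN => he; apply: le_trans (le_trans (ler_norm _) he).
apply: le_trans (hT n t ct); apply: le_trans (normIm_le _).
by case: (h t) => ? ?; case: (T n t).
Qed.

Notation mu := (@lebesgue_measure R).

Definition cint h :=
  mu.-integrable (@circle R) (EFin \o (fun t => complex.Re (h t))) /\
  mu.-integrable (@circle R) (EFin \o (fun t => complex.Im (h t))).

Lemma cint_meas h : cint h -> cmeas h.
Proof. by move=> [/measurable_int/measurable_EFinP + /measurable_int/measurable_EFinP]. Qed.

Lemma integrable_cst (C : R) : mu.-integrable (@circle R) (EFin \o (fun=> C)).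
Proof.
apply: measurable_bounded_integrable => //; first by rewrite /= lebesgue_circle ltry.
exact: bounded_cst.
Qed.

Lemma cint_dominated (f : R -> R) h : cmeas h ->
  mu.-integrable (@circle R) (EFin \o f) ->
  (forall t, circle t -> normc (h t) <= f t) -> cint h.
Proof.
move=> [h1 h2] fi hf; split; apply: le_integrable fi => //.
- exact/measurable_EFinP.
- move=> t ct; rewrite /= lee_fin (le_trans (normRe_le _)) //.
  by rewrite (le_trans (hf _ ct)) // ler_norm.
- exact/measurable_EFinP.
- move=> t ct; rewrite /= lee_fin (le_trans (normIm_le _)) //.
  by rewrite (le_trans (hf _ ct)) // ler_norm.
Qed.

Lemma cint_bounded (C : R) h : cmeas h ->
  (forall t, circle t -> normc (h t) <= C) -> cint h.
Proof. by move=> mh; apply: cint_dominated mh _; exact: integrable_cst. Qed.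

Lemma integrable_normc h : cint h ->
  mu.-integrable (@circle R) (EFin \o (fun t => normc (h t))).
Proof.
move=> ih; have [i1 i2] := ih.
have fi : mu.-integrable (@circle R)
    (EFin \o (fun t => `|complex.Re (h t)| + `|complex.Im (h t)|)).
  have -> : EFin \o (fun t => `|complex.Re (h t)| + `|complex.Im (h t)|) =
    (fun t => `|(EFin \o (fun t => complex.Re (h t))) t| +
              `|(EFin \o (fun t => complex.Im (h t))) t|)%E by [].
  by apply: integrableD => //; exact: integrable_abse.
apply: le_integrable fi => //.
  by apply/measurable_EFinP; apply: measurable_normc; exact: cint_meas.
move=> t ct; rewrite /= lee_fin ger0_norm ?normc_ge0 //.
by rewrite (le_trans (normc_le_ReIm _)) // ler_norm.
Qed.

Lemma cintD g h : cint g -> cint h -> cint (fun t => g t + h t).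
Proof.
move=> ig ih; apply: (@cint_dominated (fun t => normc (g t) + normc (h t))).
- by apply: cmeasD; exact: cint_meas.
- have -> : EFin \o (fun t => normc (g t) + normc (h t)) =
    ((EFin \o (fun t => normc (g t))) \+ (EFin \o (fun t => normc (h t))))%E by [].
  by apply: integrableD => //; exact: integrable_normc.
- by move=> t _; exact: le_normcD.
Qed.

Lemma cintM (C : R) g h : cmeas g -> (forall t, circle t -> normc (g t) <= C) ->
  cint h -> cint (fun t => g t * h t).
Proof.
move=> mg gC ih; apply: (@cint_dominated (fun t => C * normc (h t))).
- by apply: cmeasM => //; exact: cint_meas.
- have -> : EFin \o (fun t => C * normc (h t)) =
    (fun t => C%:E * (EFin \o (fun t => normc (h t))) t)%E by [].
  by apply: integrableZl => //; exact: integrable_normc.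
- by move=> t ct; rewrite Normc.normcM ler_wpM2r ?normc_ge0 // gC.
Qed.

Lemma cint_cst z : cint (fun=> z).
Proof. by apply: (@cint_bounded (normc z)) => //; exact: cmeas_cst. Qed.

Lemma cintZ z h : cint h -> cint (fun t => z * h t).
Proof. by apply: (@cintM (normc z)) => //; exact: cmeas_cst. Qed.

Lemma cint_sum (I : Type) (s : seq I) (F : I -> R -> R[i]) :
  (forall i, cint (F i)) -> cint (fun t => \sum_(i <- s) F i t).
Proof.
move=> hF; elim: s => [|i s IH].
  by under eq_fun do rewrite big_nil; exact: cint_cst.
by under eq_fun do rewrite big_cons; exact: cintD.
Qed.

Lemma cint_hornerM q h : cint h -> cint (fun t => q.[cis t] * h t).
Proof.
have [C _ hC] := normc_poly q; apply: (@cintM C); first exact: cmeas_horner.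
by move=> t _; rewrite hC // normc_cis.
Qed.

Lemma cint_horner (q : {poly R[i]}) : cint (fun t => q.[cis t]).
Proof.
have [C _ hC] := normc_poly q; apply: (@cint_bounded C); first exact: cmeas_horner.
by move=> t _; rewrite hC // normc_cis.
Qed.

Lemma cint_cisM (a : R) h : cint h -> cint (fun t => h t * cis (a * t)).
Proof.
move=> ih; under eq_fun do rewrite mulrC; apply: (@cintM 1) => //.
  exact: cmeas_cis.
by move=> t _; rewrite normc_cis.
Qed.

Lemma circle_integralD g h : cint g -> cint h ->
  circle_integral (fun t => g t + h t) = circle_integral g + circle_integral h.
Proof.
move=> [g1 g2] [h1 h2]; rewrite /circle_integral.
under eq_Rintegral do rewrite ReD.
under [X in _ +i* X]eq_Rintegral do rewrite ImD.
by rewrite !RintegralD.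
Qed.

Lemma circle_integralZ z h : cint h ->
  circle_integral (fun t => z * h t) = z * circle_integral h.
Proof.
move=> [h1 h2]; rewrite /circle_integral.
under eq_Rintegral do rewrite ReM.
under [X in _ +i* X]eq_Rintegral do rewrite ImM.
have k1 (a : R) (f : R -> R) : mu.-integrable (@circle R) (EFin \o f) ->
  mu.-integrable (@circle R) (EFin \o (fun t => a * f t)).
  move=> fi; have -> : EFin \o (fun t => a * f t) =
    (fun t => a%:E * (EFin \o f) t)%E by [].
  exact: integrableZl.
rewrite RintegralB ?RintegralD ?RintegralZl //; try exact: k1.
by case: z.
Qed.

Lemma ae_circle_integral g h : cmeas g -> cmeas h ->
  circle_ae (fun t => g t = h t) -> circle_integral g = circle_integral h.
Proof.
move=> [g1 g2] [h1 h2] gh; congr (_ +i* _); congr fine;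
  apply: ae_eq_integral => //; try exact/measurable_EFinP;
  by apply: circle_ae1 gh => t ct ->.
Qed.

(** The factor 2 is the price of estimating the real and imaginary parts separately; later constants
    absorb it. *)
Lemma normc_circle_integral h : cint h ->
  normc (circle_integral h) <= 2 * Rintegral mu (@circle R) (fun t => normc (h t)).
Proof.
move=> ih; have [h1 h2] := ih; have ni := integrable_normc ih.
have abs_int (f : R -> R) : mu.-integrable (@circle R) (EFin \o f) ->
    mu.-integrable (@circle R) (EFin \o (fun t => `|f t|)).
  by move=> /integrable_abse.
apply: le_trans (normc_le_ReIm _) _; rewrite mulr_natl mulr2n /=.
apply: lerD; (apply: le_trans (le_normr_Rintegral _ _) _ => //);
  apply: le_Rintegral => //; try exact: abs_int.
  by move=> t _; exact: normRe_le.
by move=> t _; exact: normIm_le.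
Qed.

End CircleFunctions.

(** * Fourier coefficients of integrable functions *)

Section Fourier.
Variable R : realType.
Implicit Types (g h : R -> R[i]) (z w : R[i]).
Notation mu := (@lebesgue_measure R).

Lemma cint_fourier (n : int) h : cint h ->
  cint (fun t => h t * cis (- (n%:~R * t))).
Proof.
have -> : (fun t => h t * cis (- (n%:~R * t))) = (fun t => h t * cis (- n%:~R * t)).
  by apply/funext => t; rewrite mulNr.
exact: cint_cisM.
Qed.

Lemma fourierD g h n : cint g -> cint h ->
  fourier_coef (fun t => g t + h t) n = fourier_coef g n + fourier_coef h n.
Proof.
move=> ig ih; rewrite /fourier_coef -mulrDr -circle_integralD;
  [|exact: cint_fourier ig|exact: cint_fourier ih].
by under eq_fun do rewrite mulrDl.
Qed.

Lemma fourierZ z h n : cint h ->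
  fourier_coef (fun t => z * h t) n = z * fourier_coef h n.
Proof.
move=> ih; rewrite /fourier_coef mulrCA -(circle_integralZ z (cint_fourier n ih)).
by under eq_fun do rewrite -mulrA.
Qed.

Lemma fourier_sum (I : Type) (s : seq I) (F : I -> R -> R[i]) n :
  (forall i, cint (F i)) ->
  fourier_coef (fun t => \sum_(i <- s) F i t) n = \sum_(i <- s) fourier_coef (F i) n.
Proof.
move=> hF; elim: s => [|i s IH].
  rewrite big_nil; under [fun t => _]eq_fun do rewrite big_nil -(mul0r 0).
  by rewrite fourierZ ?mul0r //; exact: cint_cst.
rewrite big_cons; under [fun t => _]eq_fun do rewrite big_cons.
by rewrite fourierD ?IH //; exact: cint_sum.
Qed.

Lemma fourier_ae g h n : cint g -> cint h ->
  circle_ae (fun t => g t = h t) -> fourier_coef g n = fourier_coef h n.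
Proof.
move=> ig ih gh; congr (_ * _); apply: ae_circle_integral.
- exact/cint_meas/cint_fourier.
- exact/cint_meas/cint_fourier.
- by apply: circle_ae1 gh => t _ ->.
Qed.

Lemma fourier_shift h (k n : int) :
  fourier_coef (fun t => cis (k%:~R * t) * h t) n = fourier_coef h (n - k).
Proof.
congr (_ * circle_integral _); apply/funext => t.
rewrite mulrAC mulrC; congr (_ * _); rewrite -cisD; congr cis.
by rewrite mulrzDr mulrNz; ring.
Qed.

Lemma fourier_bound h n : cint h ->
  normc (fourier_coef h n) <=
    pi^-1 * Rintegral mu (@circle R) (fun t => normc (h t)).
Proof.
move=> ih; rewrite /fourier_coef Normc.normcM normc_real.
have i1 := cint_fourier n ih.
rewrite ger0_norm ?invr_ge0 ?(ltW (twopi_gt0 _)) //.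
rewrite ler_pdivrMl ?twopi_gt0 //; apply: le_trans (normc_circle_integral i1) _.
rewrite mulrA -[2 * pi / pi]mulrA divff ?mulr1 ?lt0r_neq0 ?pi_gt0 //.
by under eq_Rintegral do rewrite Normc.normcM normc_cis mulr1.
Qed.

Lemma fourier_le (C : R) h n : cint h ->
  (forall t, circle t -> normc (h t) <= C) -> normc (fourier_coef h n) <= 2 * C.
Proof.
move=> ih hC; apply: le_trans (fourier_bound n ih) _.
rewrite ler_pdivrMl ?pi_gt0 //.
apply: (@le_trans _ _ (Rintegral mu (@circle R) (fun=> C))).
  apply: le_Rintegral => //; [exact: measurable_circle|exact: integrable_normc|].
  exact: integrable_cst.
rewrite Rintegral_cst; last exact: measurable_circle.
rewrite -[X in fine X]/(lebesgue_measure (@circle R)) lebesgue_circle /=; lra.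
Qed.

(** Serves both Taylor polynomials on a circle of radius r < 1 and partial sums of Laurent series on
    the unit circle. *)
Lemma fourier_uniform_limit (T : nat -> R -> R[i]) (e : nat -> R) h :
    (forall N, cint (T N)) -> e @ \oo --> 0 ->
    (forall N t, circle t -> normc (h t - T N t) <= e N) ->
  cint h /\
  forall n N, normc (fourier_coef h n - fourier_coef (T N) n) <= 2 * e N.
Proof.
move=> iT e0 hT.
have mh : cmeas h by apply: cmeas_cvg e0 hT => N; exact: cint_meas.
have id N : cint (fun t => h t - T N t).
  apply: (@cint_bounded _ (e N)); last by move=> t; exact: hT.
  by under eq_fun do rewrite -mulN1r; apply: cmeasD => //; apply: cint_meas; exact: cintZ.
have hE N : h = fun t => (h t - T N t) + T N t.
  by apply/funext => t; rewrite subrK.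
have ih : cint h by rewrite (hE 0%N); exact: cintD.
split=> // n N; have -> : fourier_coef h n - fourier_coef (T N) n =
    fourier_coef (fun t => h t - T N t) n.
  by rewrite [in LHS](hE N) fourierD // addrK.
by apply: fourier_le => // t; exact: hT.
Qed.

Lemma integral_trig (m : int) : m != 0 ->
  Rintegral mu (@circle R) (fun t => cos (m%:~R * t)) = 0 /\
  Rintegral mu (@circle R) (fun t => sin (m%:~R * t)) = 0.
Proof.
move=> m0; pose a : R := m%:~R.
have a0 : a != 0 by rewrite intr_eq0.
have [c2 s2] : cos (a * (2 * pi)) = 1 /\ sin (a * (2 * pi)) = 0.
  by have [] := cis_2pi R m.
have cm (k : R) : continuous (fun t : R => k * t) by move=> t; exact: mulrl_continuous.
have cs (f : R -> R) : continuous f -> continuous (fun t => f (a * t)).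
  by move=> cf t; apply: (@continuous_comp _ _ _ (fun t : R => a * t) f); [exact: cm|exact: cf].
have dm (t : R) : is_derive t 1 (fun t : R => a * t) a.
  by rewrite -[X in is_derive _ _ _ X]mulr1; exact: is_deriveZ.
have ds (t : R) : is_derive t 1 (fun t : R => a^-1 * sin (a * t)) (cos (a * t)).
  have h := @is_derive1_comp _ sin (fun t : R => a * t) t _ _ (is_derive_sin _) (dm t).
  have -> : cos (a * t) = a^-1 * (cos (a * t) * a) by rewrite mulrCA mulVf ?mulr1.
  exact: is_deriveZ.
have dc (t : R) : is_derive t 1 (fun t : R => - a^-1 * cos (a * t)) (sin (a * t)).
  have h := @is_derive1_comp _ cos (fun t : R => a * t) t _ _ (is_derive_cos _) (dm t).
  have -> : sin (a * t) = - a^-1 * (- sin (a * t) * a).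
    by rewrite [RHS]mulNr [- sin _ * a]mulNr mulrN opprK mulrCA mulVf ?mulr1.
  exact: is_deriveZ.
have ftc (f F : R -> R) : continuous f -> continuous F ->
    (forall t : R, is_derive t 1 F (f t)) -> F 0 = F (2 * pi) ->
    Rintegral mu (@circle R) f = 0.
  move=> cf cF dF F02; rewrite /Rintegral /circle.
  rewrite (@continuous_FTC2 _ f F) ?twopi_gt0 //.
  - by rewrite F02 /= subrr.
  - exact: continuous_subspaceT.
  - split; first by move=> t _; have [] := dF t.
      by apply: cvg_at_right_filter; exact: cF.
    by apply: cvg_at_left_filter; exact: cF.
  - by move=> t _; rewrite derive1E; apply: derive_val.
split.
  apply: (ftc _ (fun t => a^-1 * sin (a * t))).
  - by apply: cs; exact: continuous_cos.
  - move=> t; apply: (@continuous_comp _ _ _ (fun t => sin (a * t)) (fun x => a^-1 * x)).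
      by apply: cs; exact: continuous_sin.
    exact: cm.
  - by rewrite mulr0 sin0 s2.
apply: (ftc _ (fun t => - a^-1 * cos (a * t))).
- by apply: cs; exact: continuous_sin.
- move=> t; apply: (@continuous_comp _ _ _ (fun t => cos (a * t)) (fun x => - a^-1 * x)).
    by apply: cs; exact: continuous_cos.
  exact: cm.
- by rewrite mulr0 cos0 c2.
Qed.

Lemma fourier_cis (k n : int) :
  fourier_coef (fun t : R => cis (k%:~R * t)) n = (n == k)%:R.
Proof.
under [fun t => _]eq_fun do rewrite -[cis _]mulr1.
rewrite fourier_shift -subr_eq0; move: (n - k) => m; rewrite /fourier_coef.
under [fun t => _]eq_fun do rewrite mul1r -mulNr -mulrNz.
have [->|m0] := eqVneq m 0; last first.
  rewrite /circle_integral /cis /=.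
  have [] := @integral_trig (- m); first by rewrite oppr_eq0.
  by move=> -> ->; rewrite mulr0.
under [fun t => _]eq_fun do rewrite oppr0 mul0r cis0.
rewrite /circle_integral /= !Rintegral_cst; try exact: measurable_circle.
rewrite -[X in fine X]/(lebesgue_measure (@circle R)) lebesgue_circle /=.
rewrite mul1r mul0r complexr0 -rmorphM mulVf ?rmorph1 //.
exact: lt0r_neq0 (twopi_gt0 _).
Qed.

Lemma cisXz n (t : R) : cis t ^+ n = cis (n%:Z%:~R * t).
Proof. by rewrite -cisX -pmulrn. Qed.

Lemma fourier_hornerM q h n : cint h ->
  fourier_coef (fun t => q.[cis t] * h t) n =
  \sum_(i < size q) q`_i * fourier_coef h (n - i%:Z).
Proof.
move=> ih.
have E : (fun t => q.[cis t] * h t) =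
    fun t => \sum_(i < size q) q`_i * (cis (i%:Z%:~R * t) * h t).
  apply/funext => t; rewrite horner_coef mulr_suml.
  by apply: eq_bigr => i _; rewrite cisXz mulrA.
have ic (k : int) : cint (fun t => cis (k%:~R * t) * h t).
  by under eq_fun do rewrite mulrC; exact: cint_cisM.
rewrite E fourier_sum => [|i]; last exact: cintZ.
by apply: eq_bigr => i _; rewrite fourierZ // fourier_shift.
Qed.

Lemma fourier_horner q n :
  fourier_coef (fun t : R => q.[cis t]) n = if n is Posz k then q`_k else 0.
Proof.
under [fun t => _]eq_fun do rewrite -[_.[_]]mulr1.
rewrite fourier_hornerM; last exact: cint_cst.
have one k : fourier_coef (fun=> 1 : R[i]) k = (k == 0)%:R.
  have <- : (fun t : R => cis ((0 : int)%:~R * t)) = (fun=> 1 : R[i]).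
    by apply/funext => t; rewrite mul0r cis0.
  exact: fourier_cis.
under eq_bigr do rewrite one subr_eq0.
case: n => n; last by apply: big1 => i _; rewrite mulr0.
have [sn|sn] := ltnP n (size q); last first.
  rewrite nth_default //; apply: big1 => i _; rewrite eqz_nat.
  by rewrite gtn_eqF ?mulr0 // (leq_trans (ltn_ord i)).
rewrite (bigD1 (Ordinal sn)) //= eqxx mulr1 big1 ?addr0 // => i.
rewrite -val_eqE /= eqz_nat eq_sym => /negPf ->; exact: mulr0.
Qed.

End Fourier.

(** * Power series and Hardy spaces *)

Section PowerSeries.
Variable R : realType.
Implicit Types (c : nat -> R[i]) (z w : R[i]) (q r C : R) (F : R[i] -> R[i]).

(** The norm of [R[i]^o] takes its values in R[i]; this replaces its radii by real ones. *)
Lemma ccvgP (T : Type) (G : set_system T) (u : T -> R[i]) (l : R[i]) :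
  Filter G ->
  (u t @[t --> G] --> (l : R[i]^o)) <->
  (forall e : R, 0 < e -> \forall t \near G, normc (l - u t) <= e).
Proof.
move=> FG; split.
  move=> /(@cvgrPdist_le _ R[i]^o _ G FG) h e e0.
  have e0' : (0 : R[i]) < e%:C by rewrite ltcR.
  have := h _ e0'; apply: filterS => t ht.
  by rewrite -lecR; exact: ht.
move=> h; apply/(@cvgrPdist_le _ R[i]^o _ G FG) => e e0.
have [r r0 ->] : exists2 r : R, 0 < r & e = r%:C.
  move: e0; case: e => a b; rewrite ltcE /= => /andP[/eqP -> a0].
  by exists a.
have := h _ r0; apply: filterS => t; rewrite -lecR; exact.
Qed.

Lemma ccvg_bound (u : nat -> R[i]) (l a : R[i]) C (N : nat) :
  (u @ \oo --> (l : R[i]^o)) ->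
  (forall M, (N <= M)%N -> normc (u M - a) <= C) -> normc (l - a) <= C.
Proof.
move=> /(ccvgP _ _ _) h hC; apply/ler_addgt0Pr => e e0.
have [N' _ hN'] := h _ e0.
have h1 : normc (l - u (maxn N N')) <= e by apply: hN'; rewrite /= leq_maxr.
have h2 := hC _ (leq_maxl N N').
rewrite -(subrKA (u (maxn N N'))); apply: le_trans (le_normcD _ _) _.
by rewrite addrC; apply: lerD.
Qed.

Lemma geometric_sum q N k : q != 1 ->
  \sum_(N <= n < N + k) q ^+ n = (q ^+ N - q ^+ (N + k)) / (1 - q).
Proof.
move=> q1; have q1' : 1 - q != 0 by rewrite subr_eq0 eq_sym.
apply: (mulIf q1'); rewrite divfK //.
elim: k => [|k IH]; first by rewrite addn0 big_geq // mul0r subrr.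
by rewrite addnS big_nat_recr ?leq_addr //= mulrDl IH exprS; ring.
Qed.

Lemma geometric_tail_le q N M : 0 <= q -> q < 1 ->
  \sum_(N <= n < M) q ^+ n <= q ^+ N / (1 - q).
Proof.
move=> q0 q1; have q1' : 0 < 1 - q by rewrite subr_gt0.
have [MN|/ltnW NM] := leqP M N.
  by rewrite big_geq // divr_ge0 ?exprn_ge0 // ltW.
rewrite -(subnKC NM) geometric_sum ?lt_eqF // ler_pM2r ?invr_gt0 //.
by rewrite lerBlDr lerDl exprn_ge0.
Qed.

(** Turns geometric error bounds into equalities: x will be the modulus of a difference. *)
Lemma geometric_le0 q C (x : R) N0 : 0 <= q -> q < 1 ->
  (forall N, (N0 <= N)%N -> x <= C * q ^+ N) -> x <= 0.
Proof.
move=> q0 q1 h; apply/ler_addgt0Pr => e e0; rewrite add0r.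
have q1' : `|q| < 1 by rewrite ger0_norm.
have /cvgrPdist_le /(_ _ e0)[N _ hN] := @cvg_geometric _ C _ q1'.
have := hN (maxn N N0) (leq_maxl _ _).
rewrite /= sub0r normrN => h1; apply: le_trans (le_trans (ler_norm _) h1).
by apply: h; rewrite leq_maxr.
Qed.

Lemma power_series_tail c q C z N M : 0 <= q -> q < 1 ->
  (forall n, normc (c n * z ^+ n) <= C * q ^+ n) -> (N <= M)%N ->
  normc (series (fun n => c n * z ^+ n) M - series (fun n => c n * z ^+ n) N)
    <= C / (1 - q) * q ^+ N.
Proof.
move=> q0 q1 hc NM.
have C0 : 0 <= C by have := hc 0%N; rewrite [q ^+ 0]expr0 mulr1; apply: le_trans; exact: normc_ge0.
rewrite sub_series_geq //; apply: le_trans (normc_sum _ _ _) _.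
apply: (@le_trans _ _ (\sum_(N <= n < M) C * q ^+ n)); first exact: ler_sum.
rewrite -mulr_sumr mulrAC -mulrA ler_wpM2l //; exact: geometric_tail_le.
Qed.

(** With q < 1 the function is bounded on the disc, hence in H^p. Apart from monomials, every member
    of H^p constructed below arises in this way. *)
Lemma taylor_of_decay c C q : 0 <= C -> 0 <= q -> q <= 1 ->
    (forall n, normc (c n) <= C * q ^+ n) ->
  exists F, taylor_coefs F c /\
    (q < 1 -> forall z, normc z < 1 -> normc (F z) <= C / (1 - q)).
Proof.
move=> C0 q0 q1 hc.
have hz z n : normc (c n * z ^+ n) <= C * (normc z) ^+ n.
  rewrite Normc.normcM normcX ler_wpM2r ?exprn_ge0 ?normc_ge0 //.
  by apply: le_trans (hc n) _; rewrite ler_piMr // exprn_ile1.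
pose u z n := complex.Re (c n * z ^+ n); pose v z n := complex.Im (c n * z ^+ n).
have cv (w : nat -> R) z : normc z < 1 ->
    (forall n, `|w n| <= normc (c n * z ^+ n)) -> cvgn (series w).
  move=> z1 hw; apply: normed_cvg.
  apply: (@series_le_cvg _ _ (geometric C (normc z))).
  - by move=> n; exact: normr_ge0.
  - by move=> n /=; rewrite mulr_ge0 ?exprn_ge0 ?normc_ge0.
  - by move=> n; apply: le_trans (hw n) (hz z n).
  - by apply: is_cvg_geometric_series; rewrite ger0_norm ?normc_ge0.
have serE z n : series (fun n => c n * z ^+ n) n = series (u z) n +i* series (v z) n.
  rewrite /series /=; elim: n => [|n IH]; first by rewrite !big_geq.
  rewrite !big_nat_recr //= IH [c n * z ^+ n]complex_eta.
  by rewrite [LHS]complex_eta ReD ImD.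
pose F z : R[i] := limn (series (u z)) +i* limn (series (v z)).
have tF : taylor_coefs F c.
  move=> z z1; apply/ccvgP => e e0.
  have cu : cvgn (series (u z)) by apply: (cv _ _ z1) => n; exact: normRe_le.
  have cv' : cvgn (series (v z)) by apply: (cv _ _ z1) => n; exact: normIm_le.
  have e2 : 0 < e / 2 by rewrite divr_gt0.
  have /cvgrPdist_le /(_ _ e2) h1 := cu.
  have /cvgrPdist_le /(_ _ e2) h2 := cv'.
  apply: filterS2 h1 h2 => n h1 h2; rewrite [X in normc (_ - X)](serE z n).
  apply: le_trans (normc_le_ReIm _) _; rewrite /= (splitr e); exact: lerD.
exists F; split=> // q1' z z1.
rewrite -[F z]subr0; apply: (@ccvg_bound _ _ _ _ 0%N (tF z z1)) => M _.
have hq n : normc (c n * z ^+ n) <= C * q ^+ n.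
  rewrite Normc.normcM normcX; apply: le_trans (hc n); rewrite ler_piMr ?normc_ge0 //.
  by rewrite exprn_ile1 ?normc_ge0 // ltW.
have := power_series_tail q0 q1' hq (leq0n M).
by rewrite expr0 mulr1 [series _ 0%N]/series /= big_geq.
Qed.

Lemma taylor_bounded F c r : taylor_coefs F c -> 0 <= r -> r < 1 ->
  exists2 M, 0 <= M & forall n, normc (c n) * r ^+ n <= M.
Proof.
move=> tF r0 r1; have nr : normc r%:C = r by rewrite normc_real ger0_norm.
have /(ccvgP _ _ _) /(_ _ ltr01)[N _ hN] := tF r%:C (eq_ind_r (fun x => x < 1) r1 nr).
pose D := \sum_(i < N) normc (c i) * r ^+ i.
have t0 i : 0 <= normc (c i) * r ^+ i by rewrite mulr_ge0 ?exprn_ge0 ?normc_ge0.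
have D0 : 0 <= D by apply: sumr_ge0 => i _.
(* A term is the difference of two consecutive partial sums; from N on both lie within 1 of the
   limit, and D covers the terms before N. *)
exists (D + 2); first by rewrite addr_ge0.
move=> n; have [Nn|nN] := leqP N n; last first.
  rewrite /D (bigD1 (Ordinal nN)) //= -addrA lerDl addr_ge0 //.
  by apply: sumr_ge0.
have h1 := hN n Nn; have h2 := hN n.+1 (leqW Nn); rewrite /= in h1 h2.
have -> : normc (c n) * r ^+ n = normc (c n * r%:C ^+ n).
  by rewrite Normc.normcM normcX nr.
have -> : c n * r%:C ^+ n =
    (F r%:C - series (fun n => c n * r%:C ^+ n) n) -
    (F r%:C - series (fun n => c n * r%:C ^+ n) n.+1).
  by rewrite opprB [RHS]addrC addrA subrK seriesS addrK.
apply: le_trans (le_normcD _ _) _; rewrite normcN; lra.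
Qed.

(** Convergence at a radius r' strictly between r and 1 bounds |c_n| r'^n, so on the circle of
    radius r the Taylor polynomials converge uniformly, with an error of order (r / r')^N. *)
Lemma taylor_fourier F c r : taylor_coefs F c -> 0 < r -> r < 1 ->
  cint (fun t => F (r%:C * cis t)) /\
  forall n, fourier_coef (fun t => F (r%:C * cis t)) n%:Z = c n * (r ^+ n)%:C.
Proof.
move=> tF r0 r1; pose r' := (1 + r) / 2; pose q := r / r'.
have r'1 : r' < 1 by rewrite /r'; lra.
have rr' : r < r' by rewrite /r'; lra.
have r'0 : 0 < r' by exact: lt_trans rr'.
have q0 : 0 < q by rewrite divr_gt0.
have q1 : q < 1 by rewrite ltr_pdivrMr ?mul1r.
have [M M0 hM] := taylor_bounded tF (ltW r'0) r'1.
have nz t : normc (r%:C * cis t) = r.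
  by rewrite Normc.normcM normc_cis mulr1 normc_real ger0_norm // ltW.
have hc t n : normc (c n * (r%:C * cis t) ^+ n) <= M * q ^+ n.
  rewrite Normc.normcM normcX nz.
  have -> : r ^+ n = r' ^+ n * q ^+ n.
    by rewrite -exprMn mulrC divfK // lt0r_neq0.
  by rewrite mulrA ler_wpM2r ?hM // exprn_ge0 // ltW.
pose p N : {poly R[i]} := \poly_(i < N) (c i * (r ^+ i)%:C).
have pE N t : (p N).[cis t] = series (fun n => c n * (r%:C * cis t) ^+ n) N.
  rewrite /series /= big_mkord horner_poly; apply: eq_bigr => i _.
  by rewrite exprMn rmorphXn mulrA.
pose e N := M / (1 - q) * q ^+ N.
have e0 : e @ \oo --> 0 by apply: cvg_geometric; rewrite ger0_norm // ltW.
have iT N : cint (fun t => (p N).[cis t]) by exact: cint_horner.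
have hT N t : circle t -> normc (F (r%:C * cis t) - (p N).[cis t]) <= e N.
  move=> _; rewrite pE; apply: (@ccvg_bound _ _ _ _ N (tF _ _)) => [|K NK].
    by rewrite nz.
  exact: power_series_tail (ltW q0) q1 (hc t) NK.
have [ci hF] := fourier_uniform_limit iT e0 hT.
split=> // n; apply/eqP; rewrite -subr_eq0 -normc_eq0 eq_le normc_ge0 andbT.
apply: (@geometric_le0 q (2 * (M / (1 - q))) _ n.+1 (ltW q0) q1) => N nN.
have := hF n N; rewrite fourier_horner coef_poly nN.
by rewrite -mulrA => h; exact: h.
Qed.

Lemma taylor_coefs_inj F c c' : taylor_coefs F c -> taylor_coefs F c' -> c =1 c'.
Proof.
move=> h h' n; have r0 : 0 < 2^-1 :> R by rewrite invr_gt0.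
have r1 : 2^-1 < 1 :> R by lra.
have [_ e] := taylor_fourier h r0 r1; have [_ e'] := taylor_fourier h' r0 r1.
have : ((2^-1 : R) ^+ n)%:C != 0.
  by rewrite fmorph_eq0 expf_neq0 // lt0r_neq0.
by move/mulIf; apply; rewrite -e -e'.
Qed.

End PowerSeries.

(** * Means of order p and elementary estimates *)

Section HardyBounds.
Variable R : realType.
Implicit Types (g h : R -> R[i]) (z w : R[i]) (p r : R).
Notation mu := (@lebesgue_measure R).

(* No measurability is required: the integral of a nonnegative function is a
   supremum over the simple functions below it. *)
Lemma ge0_integral_mono (A D : set R) (f1 f2 : R -> \bar R) : A `<=` D ->
  (forall t, A t -> (0 <= f1 t)%E) -> (forall t, D t -> (0 <= f2 t)%E) ->
  (forall t, A t -> (f1 t <= f2 t)%E) ->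
  (\int[mu]_(t in A) f1 t <= \int[mu]_(t in D) f2 t)%E.
Proof.
move=> AD f10 f20 f12; rewrite !ge0_integralE //; apply: le_ereal_sup.
move=> _ [k hk <-]; exists k => // t; apply: le_trans (hk t) _.
rewrite /patch; case: ifPn => [/set_mem At|_].
  by rewrite mem_set ?f12 //; exact: AD.
by case: ifPn => // /set_mem; exact: f20.
Qed.

Lemma integral_le_cst (f : R -> R) (C : R) :
  (forall t, circle t -> 0 <= f t <= C) ->
  (\int[mu]_(t in @circle R) (f t)%:E <= (C * (2 * pi))%:E)%E.
Proof.
move=> fC; rewrite EFinM -lebesgue_circle -integral_cst; last exact: measurable_circle.
apply: ge0_integral_mono => // t /fC /andP[f0 fC1]; rewrite lee_fin //.
exact: le_trans fC1.
Qed.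

Lemma powR_normc_le p (C : R) z : 0 <= p -> normc z <= C ->
  0 <= powR (normc z) p <= powR C p.
Proof.
move=> p0 zC; rewrite powR_ge0 ge0_ler_powR ?nnegrE ?normc_ge0 //.
exact: le_trans (normc_ge0 z) zC.
Qed.

Lemma bounded_in_Lp p (C : R) h : 0 <= p -> cmeas h ->
  (forall t, circle t -> normc (h t) <= C) -> in_Lp p h.
Proof.
move=> p0 [h1 h2] hC; split=> //.
apply: le_lt_trans (integral_le_cst _) (ltry _) => t ct.
by apply: powR_normc_le => //; exact: hC.
Qed.

Lemma bounded_in_Hp p (C : R) (F : R[i] -> R[i]) : 0 <= p ->
  (exists c, taylor_coefs F c) -> (forall z, normc z < 1 -> normc (F z) <= C) ->
  in_Hp p F.
Proof.
move=> p0 tF FC; split=> //; exists (powR C p * (2 * pi)) => r /andP[r0 r1].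
apply: integral_le_cst => t _; apply: powR_normc_le => //; apply: FC.
by rewrite Normc.normcM normc_cis mulr1 normc_real ger0_norm.
Qed.

(** Takes the place of Holder's inequality: the circle has finite measure, so this puts L^p into L^1
    at the cost of the 2 pi in [Rintegral_normc_le]. *)
Lemma le_1DpowR p (x : R) : 1 <= p -> 0 <= x -> x <= 1 + powR x p.
Proof.
move=> p1 x0; have [x1|/ltW x1] := leP x 1.
  by rewrite (le_trans x1) // lerDl powR_ge0.
have := ler_powR x1 p1; rewrite powRr1 // => /le_trans; apply.
by rewrite lerDr.
Qed.

Lemma Rintegral_normc_le p (K : R) h : 1 <= p -> cmeas h ->
  (\int[mu]_(t in @circle R) (powR (normc (h t)) p)%:E <= K%:E)%E ->
  cint h /\ Rintegral mu (@circle R) (fun t => normc (h t)) <= 2 * pi + K.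
Proof.
move=> p1 mh hK.
have mP : measurable_fun (@circle R) (fun t => powR (normc (h t)) p).
  by apply: (measurableT_comp (measurable_powR p)); exact: measurable_normc.
have iP : mu.-integrable (@circle R) (EFin \o (fun t => powR (normc (h t)) p)).
  apply/integrableP; split; first exact/measurable_EFinP.
  apply: le_lt_trans (ltry K); apply: le_trans hK.
  apply: ge0_integral_mono => // t _ /=; last by rewrite ger0_norm ?powR_ge0.
  by rewrite lee_fin powR_ge0.
have i1 : mu.-integrable (@circle R) (EFin \o (fun t => 1 + powR (normc (h t)) p)).
  have -> : EFin \o (fun t => 1 + powR (normc (h t)) p) =
    ((EFin \o (fun=> 1%R)) \+ (EFin \o (fun t => powR (normc (h t)) p)))%E by [].
  apply: integrableD => //; [exact: measurable_circle|exact: integrable_cst].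
have ih : cint h.
  apply: (cint_dominated mh i1) => t _; exact: le_1DpowR p1 (normc_ge0 _).
split=> //.
apply: (@le_trans _ _ (Rintegral mu (@circle R) (fun t => 1 + powR (normc (h t)) p))).
  apply: le_Rintegral => //; first exact: measurable_circle.
    exact: integrable_normc.
  by move=> t _; exact: le_1DpowR p1 (normc_ge0 _).
rewrite RintegralD //; [|exact: measurable_circle|exact: integrable_cst].
apply: lerD.
  rewrite Rintegral_cst; last exact: measurable_circle.
  by rewrite -[X in fine X]/(lebesgue_measure (@circle R)) lebesgue_circle mul1r.
rewrite -lee_fin /Rintegral fineK //.
by apply: integrable_fin_num iP; exact: measurable_circle.
Qed.

Lemma in_Lp_cint p h : 1 <= p -> in_Lp p h -> cint h.
Proof.
move=> p1 [h1 h2 hp].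
have : (\int[mu]_(t in @circle R) (powR (normc (h t)) p)%:E)%E \is a fin_num.
  rewrite ge0_fin_numE //; apply: integral_ge0 => t _.
  by rewrite lee_fin powR_ge0.
move=> /fineK hK.
have [] // := @Rintegral_normc_le p
  (fine (\int[mu]_(t in @circle R) (powR (normc (h t)) p)%:E)%E) h p1 _ _.
by rewrite hK.
Qed.

Lemma cis_lipschitz (t : R) : 0 <= t -> normc (cis t - 1) <= 2 * t.
Proof.
move=> t0; apply: le_trans (normc_le_ReIm _) _; rewrite /cis /= oppr0 addr0.
rewrite mulr_natl mulr2n; apply: lerD.
  have [|c _] := @MVT_segment R cos (fun x => - sin x) 0 t t0 (fun x _ => is_derive_cos x).
    by apply: continuous_subspaceT; exact: continuous_cos.
  rewrite cos0 subr0 => ->; rewrite normrM [`|t|]ger0_norm // ler_piMl //.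
  by rewrite normrN ler_norml sin_geN1 sin_le1.
have [|c _] := @MVT_segment R sin cos 0 t t0 (fun x _ => is_derive_sin x).
  by apply: continuous_subspaceT; exact: continuous_sin.
rewrite sin0 !subr0 => ->; rewrite normrM [`|t|]ger0_norm // ler_piMl //.
by rewrite ler_norml cos_geN1 cos_le1.
Qed.

Lemma cisX_lipschitz (t : R) n : 0 <= t -> normc (cis t ^+ n - 1) <= 2 * (n%:R * t).
Proof. by move=> t0; rewrite -cisX cis_lipschitz // mulr_ge0. Qed.

Lemma bernoulli (s : R) n : 0 <= s -> s <= 1 -> 1 - n%:R * s <= (1 - s) ^+ n.
Proof.
move=> s0 s1; elim: n => [|n IH]; first by rewrite mul0r subr0 expr0.
have s1' : 0 <= 1 - s by rewrite subr_ge0.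
rewrite exprS; apply: le_trans (ler_wpM2l s1' IH).
rewrite -natr1; have : 0 <= n%:R * s * s by rewrite !mulr_ge0.
lra.
Qed.

Lemma sum_mulr_geometric_le r N : 0 <= r -> r < 1 ->
  \sum_(n < N) n%:R * r ^+ n <= (1 - r)^-1 ^+ 2.
Proof.
move=> r0 r1; have s0 : 0 < 1 - r by rewrite subr_gt0.
suff h : (1 - r) ^+ 2 * \sum_(n < N) n%:R * r ^+ n <= 1.
  by rewrite exprVn -[leRHS]mulr1 ler_pdivlMl // exprn_gt0.
(* Closed form of the partial sums of r / (1 - r)^2; the two subtracted terms are nonnegative. *)
suff -> : (1 - r) ^+ 2 * (\sum_(n < N) n%:R * r ^+ n) =
    r - N%:R * r ^+ N * (1 - r) - r * r ^+ N.
  have h1 : 0 <= N%:R * r ^+ N * (1 - r) by rewrite !mulr_ge0 ?exprn_ge0 // ltW.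
  have h2 : 0 <= r * r ^+ N by rewrite mulr_ge0 ?exprn_ge0.
  lra.
elim: N => [|N IH]; first by rewrite big_ord0 expr0; ring.
by rewrite big_ord_recr /= mulrDr IH (exprS r N) -natr1; ring.
Qed.

Lemma powR_unbounded (q K y0 : R) : 0 < q -> 0 < y0 ->
  exists2 y, y0 <= y & K < powR y q.
Proof.
move=> q0 y00; exists (Num.max y0 (powR (`|K| + 1) q^-1)); first by rewrite le_max lexx.
apply: (@lt_le_trans _ _ (`|K| + 1)).
  by rewrite (le_lt_trans (ler_norm K)) // ltrDl.
have K1 : 0 <= `|K| + 1 by rewrite addr_ge0.
rewrite -{1}[`|K| + 1](powRr1 K1) -(mulVf (lt0r_neq0 q0)) powRrM.
rewrite ge0_ler_powR ?nnegrE ?powR_ge0 ?(ltW q0) //.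
  by rewrite le_max (ltW y00).
by rewrite le_max lexx orbT.
Qed.

Lemma ccvg_lower_bound (u : nat -> R[i]) (l : R[i]) (C : R) (N : nat) :
  (u @ \oo --> (l : R[i]^o)) ->
  (forall M, (N <= M)%N -> C <= normc (u M)) -> C <= normc l.
Proof.
move=> /(ccvgP _ _ _) h hC; apply/ler_addgt0Pr => e e0.
have [N' _ hN'] := h _ e0.
have h1 : normc (l - u (maxn N N')) <= e by apply: hN'; rewrite /= leq_maxr.
have h2 := hC _ (leq_maxl N N'); apply: le_trans h2 _.
have := normcB_le (u (maxn N N')) l; rewrite -[normc (_ - l)]normcN opprB; lra.
Qed.

End HardyBounds.

(** * Taylor coefficients of functions in H^p *)

Section HardyCoefficients.
Variable R : realType.
Implicit Types (p r : R) (F : R[i] -> R[i]).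
Notation mu := (@lebesgue_measure R).

Lemma in_Hp_coef_bounded p F c : 1 <= p -> in_Hp p F -> taylor_coefs F c ->
  exists2 K, 0 <= K & forall n, normc (c n) <= K.
Proof.
move=> p1 [_ [K0 hK0]] tF; pose K1 := pi^-1 * (2 * pi + K0).
have hr r n : 0 < r -> r < 1 -> normc (c n) * r ^+ n <= K1.
  move=> r0 r1; have [ci hf] := taylor_fourier tF r0 r1.
  have [|_ hI] := Rintegral_normc_le p1 (cint_meas ci) (hK0 r _).
    by rewrite (ltW r0).
  have -> : normc (c n) * r ^+ n = normc (c n * (r ^+ n)%:C).
    by rewrite Normc.normcM normc_real ger0_norm // exprn_ge0 // ltW.
  rewrite -hf; apply: le_trans (fourier_bound _ ci) _.
  by rewrite ler_wpM2l // invr_ge0 ltW // pi_gt0.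
have K10 : 0 <= K1.
  have := hr 2^-1 0%N; rewrite expr0 mulr1 => h; apply: le_trans (h _ _); first exact: normc_ge0.
    by rewrite invr_gt0.
  lra.
exists (2 * K1) => [|n]; first by rewrite mulr_ge0.
(* The bound |c_n| r^n <= K1 is uniform in r. At r = 1 - s Bernoulli's inequality gives r^n >= 1/2,
   whence the factor 2. *)
pose s : R := (2 * n.+1%:R)^-1.
have s0 : 0 < s by rewrite invr_gt0 mulr_gt0.
have s1 : s <= 2^-1 by rewrite lef_pV2 ?posrE ?mulr_gt0 // ler_peMr // ler1n.
have ns : n%:R * s <= 2^-1.
  rewrite /s invfM mulrCA ler_piMr // ler_pdivrMr // mul1r ler_nat //.
have := @bernoulli _ s n (ltW s0); have := hr (1 - s) n.
have := normc_ge0 (c n); set x := normc _; set y := (_ ^+ n) => x0 h1 h2.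
have {}h1 : x * y <= K1 by apply: h1; lra.
have {}h2 : 2^-1 <= y by apply: le_trans (h2 _); lra.
have : x * 2^-1 <= x * y by rewrite ler_wpM2l.
lra.
Qed.

(* Summing c <= b n + ... + b (n + D - 1) against r^n. *)
Lemma nonneg_series_growth (b : nat -> R) (c r : R) D :
  (forall n, 0 <= b n) -> 0 < c -> (forall n, c <= \sum_(i < D) b (n + i)%N) ->
  2^-1 <= r -> r < 1 ->
  exists N, forall M, (N <= M)%N ->
    c / (2 * D%:R * 2 ^+ D) / (1 - r) <= \sum_(n < M) b n * r ^+ n.
Proof.
move=> b0 c0 hb r2 r1; have r0 : 0 < r by lra.
have s0 : 0 < 1 - r by lra.
have D0 : (0 < D)%N.
  by case: (posnP D) (hb 0%N) => // ->; rewrite big_ord0 leNgt c0.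
pose f n := b n * r ^+ n.
have f0 n : 0 <= f n by rewrite mulr_ge0 ?exprn_ge0 // ltW.
(* The geometric sum up to N0 is then at least half of 1 / (1 - r): this is the 2 in the
   constant. *)
have [N0 hN0] : exists N0, r ^+ N0 <= 2^-1.
  have nr : `|r| < 1 by rewrite ger0_norm // ltW.
  have h2 : 0 < 2^-1 :> R by rewrite invr_gt0.
  have /cvgrPdist_le /(_ _ h2)[N _ hN] := cvg_expr nr.
  exists N; have := hN N (leqnn _); rewrite /= sub0r normrN.
  by apply: le_trans; exact: ler_norm.
have mono M N : (M <= N)%N -> \sum_(n < M) f n <= \sum_(n < N) f n.
  move=> MN; rewrite -!(big_mkord predT f) [leRHS](@big_cat_nat _ _ _ M) //= lerDl.
  exact: sumr_ge0.
exists (N0 + D)%N => M NM; apply: le_trans (mono _ _ NM).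
set S := \sum_(n < _) _.
(* As r >= 1/2, r^n is at most 2^D r^(n+i) for i < D. After the sums are exchanged, each of the D
   shifts contributes at most 2^D S. *)
have key : c * \sum_(n < N0) r ^+ n <= (D%:R * 2 ^+ D) * S.
  apply: (@le_trans _ _ (\sum_(n < N0) \sum_(i < D) 2 ^+ D * f (n + i)%N)).
    rewrite mulr_sumr; apply: ler_sum => n _.
    apply: le_trans (ler_wpM2r _ (hb n)) _; first by rewrite exprn_ge0 // ltW.
    rewrite mulr_suml; apply: ler_sum => i _.
    rewrite /f exprD mulrCA ler_wpM2l // mulrCA ler_peMr ?exprn_ge0 ?(ltW r0) //.
    apply: (@le_trans _ _ (2 ^+ i * r ^+ i)).
      rewrite -exprMn exprn_ege1 //; lra.
    rewrite ler_wpM2r ?exprn_ge0 ?(ltW r0) // ler_eXn2l ?ltr1n //.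
    exact: ltnW.
  rewrite exchange_big /=; apply: (@le_trans _ _ (\sum_(i < D) 2 ^+ D * S)).
    apply: ler_sum => i _; rewrite -mulr_sumr ler_wpM2l ?exprn_ge0 //.
    apply: (@le_trans _ _ (\sum_(n < N0 + i) f n)); last first.
      by apply: mono; rewrite leq_add2l ltnW.
    rewrite -(big_mkord predT (fun n => f (n + i)%N)) -(big_mkord predT f).
    rewrite [leRHS](@big_cat_nat _ _ _ i) ?leq_addl //=.
    have -> : \sum_(i <= n < N0 + i) f n = \sum_(0 <= n < N0) f (n + i)%N.
      by rewrite -[X in \sum_(X <= _ < _) _]add0n big_addn addnK.
    by rewrite lerDr sumr_ge0.
  by rewrite sumr_const card_ord -[leLHS]mulr_natl mulrA.
have geo : (1 - r) * \sum_(n < N0) r ^+ n = 1 - r ^+ N0.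
  rewrite -(big_mkord predT (fun n => r ^+ n)) -[N0 in LHS]add0n.
  by rewrite geometric_sum ?lt_eqF // expr0 add0n mulrC divfK // lt0r_neq0.
have k0 : 0 < D%:R * 2 ^+ D :> R by rewrite mulr_gt0 ?exprn_gt0 // ltr0n.
have k2 : 0 < 2 * D%:R * 2 ^+ D :> R by rewrite -mulrA mulr_gt0.
rewrite ler_pdivrMr // ler_pdivrMr //.
have -> : S * (1 - r) * (2 * D%:R * 2 ^+ D) =
    2 * ((1 - r) * (D%:R * 2 ^+ D * S)) by ring.
have := ler_wpM2l (ltW s0) key; rewrite mulrCA geo.
have : c * 2^-1 <= c * (1 - r ^+ N0) by rewrite ler_wpM2l ?(ltW c0) //; lra.
lra.
Qed.

Lemma in_Hp_nonneg_coefs_vanish p F (b : nat -> R) (c : R) D :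
  1 < p -> in_Hp p F -> taylor_coefs F (fun n => (b n)%:C) ->
  (forall n, 0 <= b n) -> 0 < c -> (forall n, c <= \sum_(i < D) b (n + i)%N) ->
  False.
Proof.
move=> p1 hF tF b0 c0 hb.
have [K K0 hK] := in_Hp_coef_bounded (ltW p1) hF tF.
have {}hK n : b n <= K by have := hK n; rewrite normc_real ger0_norm.
have [_ [K1 hK1]] := hF.
have D0 : (0 < D)%N.
  by case: (posnP D) (hb 0%N) => // ->; rewrite big_ord0 leNgt c0.
set c1 := c / (2 * D%:R * 2 ^+ D).
have c10 : 0 < c1 by rewrite divr_gt0 // !mulr_gt0 ?exprn_gt0 // ltr0n.
(* The arc will have length d (1 - r). The term 4 K gives 2 K d <= c1 / 2, so F loses at most half
   of its size along the arc; the term c1 gives d <= 1, which keeps the arc inside [0, 2 pi]. *)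
pose d := c1 / (4 * K + c1 + 4).
have d0 : 0 < d by rewrite divr_gt0 //; lra.
have d1 : d <= 1 by rewrite ler_pdivrMr ?mul1r; lra.
have dK : 2 * K * d <= c1 / 2.
  by rewrite /d mulrA ler_pdivrMr; [nra|lra].
(* The coefficients are at most K, so F moves by at most 2 K t / (1 - r)^2 along
   an arc of length t, while F r is at least c1 / (1 - r). *)
have lower r t : 2^-1 <= r -> r < 1 -> 0 <= t -> t <= d * (1 - r) ->
    c1 / (1 - r) / 2 <= normc (F (r%:C * cis t)).
  move=> r2 r1 t0 td; have s0 : 0 < 1 - r by lra.
  have r0 : 0 <= r by lra.
  have [N hN] := nonneg_series_growth b0 c0 hb r2 r1.
  have z1 : normc (r%:C * cis t) < 1.
    by rewrite Normc.normcM normc_cis mulr1 normc_real ger0_norm.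
  apply: (@ccvg_lower_bound _ _ _ _ N (tF _ z1)) => M NM.
  set S := series _ M.
  have SE : S = (\sum_(n < M) b n * r ^+ n)%:C +
      \sum_(n < M) (b n * r ^+ n)%:C * (cis t ^+ n - 1).
    rewrite /S /series /= big_mkord rmorph_sum -big_split; apply: eq_bigr => n _ /=.
    by rewrite -[X in X + _]mulr1 -mulrDr addrC subrK exprMn mulrA -rmorphXn -rmorphM.
  have hS : normc (\sum_(n < M) (b n * r ^+ n)%:C * (cis t ^+ n - 1)) <=
      c1 / (1 - r) / 2.
    apply: le_trans (normc_sum _ _ _) _.
    apply: (@le_trans _ _ (2 * K * t * \sum_(n < M) n%:R * r ^+ n)).
      rewrite mulr_sumr; apply: ler_sum => n _; rewrite Normc.normcM normc_real.
      have rn : 0 <= r ^+ n by rewrite exprn_ge0.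
      rewrite ger0_norm ?mulr_ge0 //.
      apply: le_trans (ler_wpM2l _ (cisX_lipschitz n t0)) _; first by rewrite mulr_ge0.
      have -> : 2 * K * t * (n%:R * r ^+ n) = K * (r ^+ n * (2 * (n%:R * t))) by ring.
      by rewrite -mulrA ler_wpM2r // !mulr_ge0.
    have Kt : 0 <= 2 * K * t by rewrite !mulr_ge0.
    apply: le_trans (ler_wpM2l Kt (sum_mulr_geometric_le M r0 r1)) _.
    have h2 : 2 * K * t <= c1 / 2 * (1 - r).
      apply: le_trans (_ : _ <= 2 * K * (d * (1 - r))) _.
        by rewrite ler_wpM2l // mulr_ge0.
      by rewrite mulrA ler_wpM2r // ltW.
    rewrite expr2 mulrA ler_pdivrMr // ler_pdivrMr //.
    have -> // : c1 / (1 - r) / 2 * (1 - r) * (1 - r) = c1 / 2 * (1 - r).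
    by field; rewrite lt0r_neq0.
  have := normcB_le (\sum_(n < M) b n * r ^+ n)%:C
     (- \sum_(n < M) (b n * r ^+ n)%:C * (cis t ^+ n - 1)).
  rewrite opprK -SE normcN; apply: le_trans; rewrite normc_real.
  have := hN M NM; rewrite -/c1 => h; have := ler_norm (\sum_(n < M) b n * r ^+ n).
  lra.
have key r : 2^-1 <= r -> r < 1 ->
    powR (c1 / (1 - r) / 2) p * (d * (1 - r)) <= K1.
  move=> r2 r1; have s0 : 0 < 1 - r by lra.
  have ds0 : 0 < d * (1 - r) by rewrite mulr_gt0.
  rewrite -lee_fin; have rr : 0 <= r < 1 by apply/andP; split; lra.
  have := hK1 r rr; apply: le_trans.
  have -> : (powR (c1 / (1 - r) / 2) p * (d * (1 - r)))%:E =
      (\int[mu]_(t in `[0%R, (d * (1 - r))%R]%classic) cst (powR (c1 / (1 - r) / 2) p)%:E t)%E.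
    have mA : measurable (`[0, d * (1 - r)]%classic : set R) by exact: measurable_itv.
    rewrite integral_cst //.
    have := lebesgue_measure_itv `[0, d * (1 - r)]%R.
    by rewrite /= lte_fin ds0 oppr0 adde0 => e; rewrite EFinM -e.
  apply: ge0_integral_mono.
  - move=> t /=; rewrite /circle /= !in_itv /= => /andP[-> /= td].
    have := pi_ge2 R; nra.
  - by move=> t _; rewrite lee_fin powR_ge0.
  - by move=> t _; rewrite lee_fin powR_ge0.
  - move=> t /=; rewrite in_itv /= => /andP[t0 td]; rewrite lee_fin.
    rewrite ge0_ler_powR ?nnegrE ?normc_ge0 //; first by lra.
      by rewrite !divr_ge0 // ltW.
    exact: lower.
have q0 : 0 < p - 1 by rewrite subr_gt0.
(* With r chosen so that c1 / (1 - r) / 2 = y, [key] says y^(p-1) c1 d / 2 <= K1, which a large y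
   violates because p > 1. The bound y >= c1 ensures r >= 1/2. *)
have [y cy hy] := powR_unbounded (2 * K1 / (c1 * d)) q0 c10.
have y0 : 0 < y := lt_le_trans c10 cy.
pose r := 1 - c1 / (2 * y).
have sE : 1 - r = c1 / (2 * y) by rewrite /r opprB addrC subrK.
have s12 : c1 / (2 * y) <= 2^-1 by rewrite ler_pdivrMr ?mulr_gt0 //; lra.
have s0 : 0 < c1 / (2 * y) by rewrite divr_gt0 // mulr_gt0.
have := key r; rewrite sE; have -> : (2^-1 <= r) by rewrite /r; lra.
have -> : r < 1 by rewrite /r; lra.
move=> /(_ isT isT).
have -> : c1 / (c1 / (2 * y)) / 2 = y by field; rewrite ?lt0r_neq0.
have -> : powR y p = y * powR y (p - 1).
  by rewrite -[X in X * _](powRr1 (ltW y0)) -powRD ?lt0r_neq0 ?implybT // addrC subrK.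
rewrite leNgt => /negP; apply.
move: hy; rewrite (ltr_pdivrMr _ _ (mulr_gt0 c10 d0)) => hy.
have -> : y * powR y (p - 1) * (d * (c1 / (2 * y))) = powR y (p - 1) * (c1 * d) / 2.
  by field; rewrite lt0r_neq0.
rewrite ltr_pdivlMr //; lra.
Qed.

End HardyCoefficients.

(** * Rational functions on the circle *)

Section ExpansionAtInfinity.
Variable R : realType.
Implicit Types (Q : {poly R[i]}) (x : nat -> R[i]) (w z : R[i]).

Lemma horner_expansion x N w : w != 0 ->
  (expansion x N).[w] = w ^+ N * \sum_(k < N) x k * w^-1 ^+ k.+1.
Proof.
move=> w0; elim: N => [|N IH].
  by rewrite /expansion poly_def !big_ord0 horner0 mulr0.
rewrite expansionS hornerD hornerM hornerX hornerC IH big_ord_recr /= mulrDr.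
rewrite [w * _]mulrA -[w * w ^+ N]exprS; congr (_ + _).
by rewrite mulrCA -exprMn divff // expr1n mulr1.
Qed.

(** Dividing [polar_num_iter] by w^N Q(w) puts the tail of the series at infinity in closed form. *)
Lemma polar_num_horner Q x N w : act Q x =1 (fun=> 0) -> w != 0 -> Q.[w] != 0 ->
  (polar_num Q x).[w] / Q.[w] - \sum_(k < N) x k * w^-1 ^+ k.+1 =
  w^-1 ^+ N * (polar_num Q (fun n => x (n + N)%N)).[w] / Q.[w].
Proof.
move=> Qx w0 Qw0; have wN0 : w ^+ N != 0 by rewrite expf_neq0.
have /(congr1 (fun p => p.[w])) := polar_num_iter N Qx.
rewrite hornerM hornerXn hornerD hornerM horner_expansion // => h.
apply: (mulfI wN0); rewrite exprVn mulrBr !mulrA divff // mul1r h mulrDl mulfK //.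
by rewrite addrAC subrr add0r.
Qed.

Lemma polar_num_decay Q x (C q : R) : 0 <= C -> 0 <= q -> q <= 1 ->
  (forall n, normc (x n) <= C * q ^+ n) ->
  exists2 D, 0 <= D & forall N w, normc w = 1 ->
    normc (polar_num Q (fun n => x (n + N)%N)).[w] <= D * q ^+ N.
Proof.
move=> C0 q0 q1 hx; pose B := \sum_(i < size Q) normc Q`_i.
have B0 : 0 <= B by apply: sumr_ge0 => i _; exact: normc_ge0.
exists ((size Q)%:R * (B * C)); first by rewrite !mulr_ge0.
move=> N w w1; set p := polar_num Q _.
have hp i : normc p`_i <= B * C * q ^+ N.
  rewrite coef_polar_num; apply: le_trans (normc_sum _ _ _) _.
  rewrite -mulrA mulr_suml -(big_mkord predT (fun i => normc Q`_i * (C * q ^+ N))).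
  have h1 j : normc (Q`_j * x (j - i.+1 + N)%N) <= normc Q`_j * (C * q ^+ N).
    rewrite Normc.normcM ler_wpM2l ?normc_ge0 //; apply: le_trans (hx _) _.
    by rewrite ler_wpM2l // exprD ler_piMl ?exprn_ge0 // exprn_ile1.
  have h0 j : 0 <= normc Q`_j * (C * q ^+ N).
    by rewrite !mulr_ge0 ?normc_ge0 ?exprn_ge0.
  have [sQ|/ltnW sQ] := leqP (size Q) i.+1.
    by rewrite [leLHS]big_geq //; apply: sumr_ge0 => j _; exact: h0.
  rewrite [leRHS](@big_cat_nat _ _ _ i.+1) //=.
  apply: ler_wpDl; first by apply: sumr_ge0 => j _; exact: h0.
  by apply: ler_sum => j _; exact: h1.
have sp : (size p <= size Q)%N.
  have [Q0|Q0] := eqVneq Q 0; last exact/ltnW/size_polar_num.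
  rewrite /p /polar_num Q0 size_poly0 /=; apply: size_poly.
rewrite (horner_coef_wide _ sp); apply: le_trans (normc_sum _ _ _) _.
apply: (@le_trans _ _ (\sum_(i < size Q) B * C * q ^+ N)).
  apply: ler_sum => i _; rewrite Normc.normcM normcX w1 expr1n mulr1; exact: hp.
by rewrite sumr_const card_ord -[leLHS]mulr_natl !mulrA.
Qed.

Lemma monic_lower_bound Q : Q \is monic -> (forall z, root Q z -> normc z < 1) ->
  exists2 c : R, 0 < c & forall w, normc w = 1 -> c <= normc Q.[w].
Proof.
move=> /monic_roots[s ->] hs.
exists (\prod_(z <- s) (1 - normc z)).
  rewrite big_seq; apply: prodr_gt0 => z zs; rewrite subr_gt0 hs //.
  by rewrite root_prod_XsubC.
move=> w w1; rewrite horner_prod.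
have -> : normc (\prod_(z <- s) ('X - z%:P).[w]) =
    \prod_(z <- s) normc ('X - z%:P).[w].
  elim: (s) => [|z r IH]; first by rewrite !big_nil Normc.normc1.
  by rewrite !big_cons Normc.normcM IH.
rewrite big_seq [leRHS]big_seq; apply: ler_prod => z zs.
rewrite subr_ge0 ltW ?hs ?root_prod_XsubC //= hornerXsubC -w1.
exact: normcB_le.
Qed.

(* For sg = 1 this is the Laurent series of polar_num Q x / Q on the circle, for
   sg = -1 that of its composition with the inversion z |-> 1 / z. *)
Lemma fourier_at_infinity Q x (sg : int) : sg != 0 -> Q \is monic ->
    act Q x =1 (fun=> 0) -> (forall z, root Q z -> normc z < 1) ->
  let h t := (polar_num Q x).[cis (sg%:~R * t)] / Q.[cis (sg%:~R * t)] in
  [/\ cint h, exists C, forall t, normc (h t) <= C,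
      forall k : nat, fourier_coef h (- sg * k.+1%:Z) = x k &
      forall n, (forall k : nat, n != - sg * k.+1%:Z) -> fourier_coef h n = 0].
Proof.
move=> sg0 Qm Qx hQ h.
have [C [q [C0 q0 q1 hx]]] := annihilated_decay Qm Qx hQ.
have [D D0 hD] := polar_num_decay Q C0 (ltW q0) (ltW q1) hx.
have [c c0 hc] := monic_lower_bound Qm hQ.
pose T N t : R[i] := \sum_(k < N) x k * cis ((- sg * k.+1%:Z)%:~R * t).
have iT N : cint (T N).
  apply: cint_sum => k; apply: cintZ.
  by apply: (@cint_bounded _ 1) => [|t _]; [exact: cmeas_cis|rewrite normc_cis].
have w1 (t : R) : normc (cis (sg%:~R * t)) = 1 by rewrite normc_cis.
have hT N t : normc (h t - T N t) <= D / c * q ^+ N.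
  have Qw0 : Q.[cis (sg%:~R * t)] != 0.
    by rewrite -normc_gt0 (lt_le_trans c0) // hc.
  have -> : T N t = \sum_(k < N) x k * (cis (sg%:~R * t))^-1 ^+ k.+1.
    apply: eq_bigr => k _; congr (_ * _).
    rewrite -cisN -cisX; congr cis; rewrite intrM mulrNz -pmulrn; ring.
  rewrite polar_num_horner ?cis_neq0 // !Normc.normcM normcX !Normc.normcV w1 invr1 expr1n mul1r.
  rewrite ler_pdivrMr ?normc_gt0 //; apply: le_trans (hD _ _ (w1 t)) _.
  rewrite (_ : D / c * q ^+ N * _ = D * q ^+ N * (normc Q.[cis (sg%:~R * t)] / c)).
    rewrite ler_peMr ?mulr_ge0 ?exprn_ge0 ?(ltW q0) //.
    by rewrite ler_pdivlMr // mul1r hc.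
  by ring.
have e0 : (fun N => D / c * q ^+ N) @ \oo --> 0.
  by apply: cvg_geometric; rewrite ger0_norm // ltW.
have [ih hF] := fourier_uniform_limit iT e0 (fun N t _ => hT N t).
have FT n N : fourier_coef (T N) n =
    \sum_(k < N) x k * (n == - sg * k.+1%:Z)%:R.
  rewrite fourier_sum => [|k]; last first.
    by apply: cintZ; apply: (@cint_bounded _ 1) => [|t _];
      [exact: cmeas_cis|rewrite normc_cis].
  apply: eq_bigr => k _; rewrite fourierZ ?fourier_cis //.
  by apply: (@cint_bounded _ 1) => [|t _]; [exact: cmeas_cis|rewrite normc_cis].
(* Each Fourier coefficient of the partial sums is constant from some N0 on, and that constant is
   the coefficient of h. *)
have lim n y N0 : (forall N, (N0 <= N)%N -> fourier_coef (T N) n = y) ->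
    fourier_coef h n = y.
  move=> hy; apply/eqP; rewrite -subr_eq0 -normc_eq0 eq_le normc_ge0 andbT.
  apply: (@geometric_le0 _ q (2 * (D / c)) _ N0 (ltW q0) q1) => N NN.
  by rewrite -mulrA -(hy N NN); exact: hF.
split=> //.
- exists (D / c) => t; have := hT 0%N t.
  by rewrite /T big_ord0 subr0 expr0 mulr1.
- move=> k; apply: (lim _ _ k.+1) => N kN; rewrite FT (bigD1 (Ordinal kN)) //=.
  rewrite eqxx mulr1 big1 ?addr0 // => i ik.
  have /negPf-> : - sg * k.+1%:Z != - sg * i.+1%:Z; last by rewrite mulr0.
  rewrite (inj_eq (mulfI _)) ?oppr_eq0 // eqz_nat eqSS eq_sym.
  by move: ik; rewrite -val_eqE.
- move=> n hn; apply: (lim _ _ 0%N) => N _; rewrite FT big1 // => k _.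
  by rewrite (negPf (hn k)) mulr0.
Qed.

End ExpansionAtInfinity.

Notation tofrac := (@FracField.tofrac _).

Section RationalFunctions.
Variable R : realType.
Implicit Types (x y : ratfun R) (s q : {poly R[i]}) (z w : R[i]).
Notation mu := (@lebesgue_measure R).

Lemma negligible_subsingleton (A : set R) :
  (forall a b, A a -> A b -> a = b) -> mu.-negligible A.
Proof.
move=> hA; have [[a Aa]|nA] := pselect (exists a, A a).
  exists [set a]; split; [exact: measurable_set1|exact: lebesgue_measure_set1|].
  by move=> b Ab /=; exact: hA.
exists set0; split; [exact: measurable0|exact: measure0|].
by move=> a Aa; apply: nA; exists a.
Qed.

(** Since cos is injective on [0, pi], each closed half of the circle takes the value z at most
    once; the second half is brought back by a shift of pi. *)
Lemma ae_cis_neq z : circle_ae (fun t : R => cis t != z).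
Proof.
pose A : set R := [set t | 0 <= t <= pi /\ cis t = z].
pose B : set R := [set t | pi <= t <= 2 * pi /\ cis t = z].
have nA : mu.-negligible A.
  apply: negligible_subsingleton => a b [ha az] [hb bz].
  apply: cos_inj; rewrite ?in_itv //=.
  by move: az; rewrite -bz => -[].
have nB : mu.-negligible B.
  apply: negligible_subsingleton => a b [/andP[ha1 ha2] az] [/andP[hb1 hb2] bz].
  have : a - pi = b - pi.
    apply: cos_inj; rewrite ?in_itv /=; try by apply/andP; split; lra.
    by rewrite !cosB cospi sinpi !mulr0; move: az; rewrite -bz => -[-> _].
  by move/addIr.
apply: (@negligibleS _ _ _ (@lebesgue_measure R) (A `|` B)); last first.
  exact: (@negligibleU _ _ _ (@lebesgue_measure R)).
move=> t /=.
rewrite /circle /= in_itv /= => /not_implyP[/andP[t0 t2] /negP/negPn/eqP tz].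
by have [tp|/ltW tp] := leP t pi; [left|right]; split=> //; apply/andP.
Qed.

Lemma ae_horner_neq0 q : q != 0 -> circle_ae (fun t : R => q.[cis t] != 0).
Proof.
move=> q0; have [r hr] := closed_field_poly_normal q.
have : circle_ae (fun t : R => cis t \notin r).
  elim: r {hr} => [|z r IH]; first exact: circle_aeT.
  apply: circle_ae2 (ae_cis_neq z) IH => t _ tz tr.
  by rewrite in_cons negb_or tz.
apply: circle_ae1 => t _; apply: contra => qt.
rewrite -root_prod_XsubC /root; move: qt; rewrite hr hornerZ mulf_eq0.
by rewrite lead_coef_eq0 (negPf q0).
Qed.

Lemma tofrac_repr (T : idomainType) (x : {fraction T}) :
  x * tofrac (frac (repr x)).2 = tofrac (frac (repr x)).1.
Proof.
rewrite -{1}[x]reprK !piE; apply/eqP; rewrite piE /equivf /FracField.mulf.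
by rewrite !numden_Ratio ?mulr1 ?oner_eq0 ?denom_ratioP // mulrC.
Qed.

Lemma ratfunP x : exists s q, q != 0 /\ x = tofrac s / tofrac q.
Proof.
exists (frac (repr x)).1, (frac (repr x)).2.
have d0 := denom_ratioP (repr x); split=> //.
by rewrite -tofrac_repr mulfK // tofrac_eq0.
Qed.

(** The representative read by [rat_eval] and s / q agree after cross-multiplication, hence in value
    off the zeros of the two denominators. *)
Lemma rat_eval_ae s q : q != 0 ->
  circle_ae (fun t => rat_eval (tofrac s / tofrac q) (cis t) = s.[cis t] / q.[cis t]).
Proof.
move=> q0; set x := tofrac s / tofrac q; rewrite /rat_eval.
have d0 := denom_ratioP (repr x); have := tofrac_repr x.
move: d0; set n := (frac _).1; set d := (frac _).2 => d0.
rewrite /x mulrAC => /(canRL (divfK _)); rewrite tofrac_eq0 => /(_ q0).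
rewrite -!tofracM => /eqP; rewrite tofrac_eq => /eqP snd.
apply: circle_ae2 (ae_horner_neq0 q0) (ae_horner_neq0 d0) => t _ qt dt.
by apply/eqP; rewrite eqr_div // -!hornerM snd.
Qed.

Lemma circle_ae_and (P Q : R -> Prop) :
  circle_ae P -> circle_ae Q -> circle_ae (fun t => P t /\ Q t).
Proof. by apply: circle_ae2. Qed.

Lemma rat_evalD_ae x y : circle_ae (fun t =>
  rat_eval (x + y) (cis t) = rat_eval x (cis t) + rat_eval y (cis t)).
Proof.
have [s [q [q0 ->]]] := ratfunP x; have [s' [q' [q'0 ->]]] := ratfunP y.
rewrite addf_div ?tofrac_eq0 // -!tofracM -tofracD.
have nz := circle_ae_and (ae_horner_neq0 q0) (ae_horner_neq0 q'0).
have ev := circle_ae_and (rat_eval_ae s q0) (rat_eval_ae s' q'0).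
have := circle_ae_and nz (circle_ae_and ev (rat_eval_ae (s * q' + s' * q) (mulf_neq0 q0 q'0))).
apply: circle_ae1 => t _ [[qt q't] [[-> ->] ->]].
by rewrite hornerD !hornerM addf_div.
Qed.

Lemma rat_evalM_ae x y : circle_ae (fun t =>
  rat_eval (x * y) (cis t) = rat_eval x (cis t) * rat_eval y (cis t)).
Proof.
have [s [q [q0 ->]]] := ratfunP x; have [s' [q' [q'0 ->]]] := ratfunP y.
rewrite mulf_div -!tofracM.
have ev := circle_ae_and (rat_eval_ae s q0) (rat_eval_ae s' q'0).
have := circle_ae_and ev (rat_eval_ae (s * s') (mulf_neq0 q0 q'0)).
by apply: circle_ae1 => t _ [[-> ->] ->]; rewrite !hornerM mulf_div.
Qed.

Lemma rat_eval_tofrac_ae q :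
  circle_ae (fun t => rat_eval (tofrac q) (cis t) = q.[cis t]).
Proof.
have := rat_eval_ae q (oner_neq0 _); rewrite tofrac1 divr1.
by apply: circle_ae1 => t _ ->; rewrite hornerC divr1.
Qed.

Lemma rat_eval_sum_ae (n : nat) (F : 'I_n -> ratfun R) : circle_ae (fun t =>
  rat_eval (\sum_i F i) (cis t) = \sum_i rat_eval (F i) (cis t)).
Proof.
elim: n F => [|n IH] F.
  have := rat_eval_tofrac_ae 0; rewrite tofrac0.
  by apply: circle_ae1 => t _; rewrite !big_ord0 horner0.
rewrite big_ord_recr /=.
have := circle_ae_and (IH (fun i => F (widen_ord (leqnSn n) i)))
  (rat_evalD_ae (\sum_(i < n) F (widen_ord (leqnSn n) i)) (F ord_max)).
by apply: circle_ae1 => t _ [e ->]; rewrite e big_ord_recr.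
Qed.

(** Spares the later constructions any coprimality: dividing by the gcd lowers both degrees equally
    and can only remove roots of q. *)
Lemma in_Rat0_intro s q : q != 0 -> (size s < size q)%N ->
  (forall z, root q z -> normc z = 1) -> in_Rat0 (tofrac s / tofrac q).
Proof.
move=> q0 sq hq; pose g := gcdp s q.
have g0 : g != 0 by rewrite gcdp_eq0 (negPf q0) andbF.
have sE : s = s %/ g * g by rewrite divpK ?dvdp_gcdl.
have qE : q = q %/ g * g by rewrite divpK ?dvdp_gcdr.
have qg0 : q %/ g != 0 by apply: contra_neq q0 => h; rewrite qE h mul0r.
exists (s %/ g), (q %/ g); split.
- rewrite {1}sE {1}qE !tofracM invfM mulrACA divff ?mulr1 ?tofrac_eq0 //.
- by apply: coprimep_div_gcd; rewrite q0 orbT.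
- by rewrite !size_divp // ltn_sub2r // (leq_trans _ (dvdp_leq q0 (dvdp_gcdr s q))) //
    prednK // size_poly_gt0.
- move=> z; move/(root_dvdp (divp_dvd (dvdp_gcdr s q))); exact: hq.
Qed.

Lemma in_Rat0D x y : in_Rat0 x -> in_Rat0 y -> in_Rat0 (x + y).
Proof.
move=> [s [q [-> _ sq hq]]] [s' [q' [-> _ sq' hq']]].
have q0 : q != 0 by rewrite -size_poly_gt0 (leq_ltn_trans _ sq).
have q'0 : q' != 0 by rewrite -size_poly_gt0 (leq_ltn_trans _ sq').
rewrite addf_div ?tofrac_eq0 // -!tofracM -tofracD; apply: in_Rat0_intro.
- by rewrite mulf_neq0.
- apply: leq_ltn_trans (size_polyD _ _) _; rewrite gtn_max.
  rewrite (size_mul q0 q'0); apply/andP; split;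
    apply: (leq_ltn_trans (size_polyMleq _ _)); move: sq sq';
    by move: (size s) (size s') (size q) (size q') => *; lia.
- by move=> z; rewrite rootM => /orP[/hq|/hq'].
Qed.

Lemma in_Rat0Z (c : R[i]) x : in_Rat0 x -> in_Rat0 (tofrac c%:P * x).
Proof.
move=> [s [q [-> _ sq hq]]]; rewrite mulrA -tofracM; apply: in_Rat0_intro => //.
  by rewrite -size_poly_gt0 (leq_ltn_trans _ sq).
by rewrite mul_polyC (leq_ltn_trans (size_scale_leq _ _)).
Qed.

Lemma in_Rat0_0 : in_Rat0 (0 : ratfun R).
Proof.
rewrite -(mul0r (tofrac (1 : {poly R[i]}))^-1) -tofrac0; apply: in_Rat0_intro.
- exact: oner_neq0.
- by rewrite size_poly0 size_poly_gt0 oner_neq0.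
- by move=> z; rewrite (negPf (root1 _)).
Qed.

Lemma in_Rat0_sum (n : nat) (F : 'I_n -> ratfun R) :
  (forall i, in_Rat0 (F i)) -> in_Rat0 (\sum_i F i).
Proof. by move=> hF; elim/big_ind: _ => //; [exact: in_Rat0_0|exact: in_Rat0D]. Qed.

End RationalFunctions.

(** * Integrability excludes poles on the circle *)

Section PolesOnCircle.
Variable R : realType.
Implicit Types (s q : {poly R[i]}) (z w : R[i]) (h : R -> R[i]).
Notation mu := (@lebesgue_measure R).

(** The strict bound leaves room for an interval to the right of th inside [0, 2 pi]. *)
Lemma cis_surj z : normc z = 1 -> exists2 th : R, 0 <= th < 2 * pi & cis th = z.
Proof.
case: z => a b z1; have {z1}ab : a ^+ 2 + b ^+ 2 = 1.
  have h0 : 0 <= a ^+ 2 + b ^+ 2 by rewrite addr_ge0 ?sqr_ge0.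
  by rewrite -[LHS](sqr_sqrtr h0); move: z1 => /= ->; rewrite expr1n.
have a1 : -1 <= a <= 1.
  rewrite -ler_norml -(@ler_pXn2r _ 2) ?nnegrE // expr1n real_normK ?num_real //.
  by rewrite -ab lerDl sqr_ge0.
have sE : sin (acos a) = `|b| by rewrite sin_acos // -ab addrAC subrr add0r sqrtr_sqr.
have cE : cos (acos a) = a by rewrite acosK // in_itv.
have h0 := acos_ge0 a1; have hpi := acos_lepi a1; have pi0 := pi_gt0 R.
have [b0|b0] := leP 0 b.
  exists (acos a); first by apply/andP; split=> //; lra.
  by rewrite /cis cE sE ger0_norm.
exists (2 * pi - acos a); last first.
  by rewrite /cis cosB sinB mulr_natl cos2pi sin2pi cE sE ltr0_norm //
    !mul0r !mul1r sub0r addr0 opprK.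
apply/andP; split; first lra.
rewrite ltrBlDr ltrDl lt_def h0 andbT; apply/eqP => e.
by move: sE; rewrite e sin0 => /esym/eqP; rewrite normr_eq0 lt_eqF.
Qed.

(** The intervals are open at th, so every t leaves them eventually; dominated convergence with
    majorant |h| does the rest. *)
Lemma integrable_tail_vanish h (th e : R) : cint h -> 0 <= th -> 0 < e ->
  (fun n => \int[mu]_(t in @circle R)
     (normc (h t) * \1_(`]th, (th + e * harmonic n)%R]%classic) t)%:E)%E @ \oo --> 0%E.
Proof.
move=> ih th0 e0; have ni := integrable_normc ih.
pose A n : set R := `]th, (th + e * harmonic n)%R]%classic.
have mA n : measurable (A n) by exact: measurable_itv.
have mi n : measurable_fun (@circle R) (fun t => normc (h t) * \1_(A n) t).
  apply: measurable_funM; last exact: measurable_indic.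
  by apply: measurable_normc; exact: cint_meas.
pose f n t := (normc (h t) * \1_(A n) t)%:E.
have mf n : measurable_fun (@circle R) (f n) by exact/measurable_EFinP.
have flt : circle_ae (fun t => f n t @[n --> \oo] --> cst 0%E t).
  apply: circle_aeT => t _ /=; apply: cvg_near_cst.
  have [tth|tth] := leP t th.
    apply: nearW => n; rewrite /f indicE memNset ?mulr0 //.
    by rewrite /A /= in_itv /= ltNge tth.
  have d0 : 0 < (t - th) / (2 * e) by rewrite divr_gt0 ?subr_gt0 ?mulr_gt0.
  have /cvgrPdist_le /(_ _ d0) := @cvg_harmonic R.
  apply: filterS => n; rewrite sub0r normrN ger0_norm ?harmonic_ge0 //.
  rewrite ler_pdivlMr ?mulr_gt0 // => hn; rewrite /f indicE memNset ?mulr0 //.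
  rewrite /A /= in_itv /= => /andP[_ ht].
  have {}ht : t <= th + e * harmonic n by exact: ht.
  move: hn ht; move: (harmonic n) => k; nra.
have fg : {ae mu, forall t n, @circle R t -> (`|f n t| <= (EFin \o (fun t => normc (h t))) t)%E}.
  have F : Filter (almost_everywhere (@lebesgue_measure R)).
    exact: ae_filter_ringOfSetsType.
  apply: nearW => t n _; rewrite /f /= lee_fin indicE ger0_norm.
    by case: (t \in A n); rewrite ?mulr1 ?mulr0 // normc_ge0.
  by rewrite mulr_ge0 ?normc_ge0.
have mD : measurable (@circle R) by exact: measurable_circle.
have [_ _] := @dominated_convergence _ _ _ mu _ mD f (cst 0%E) _ mf (measurable_cst _) flt ni fg.
by rewrite integral0.
Qed.

(* A pole at cis th makes |s / q| at least of the order of 1 / e on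
   (th, th + e], so that its integral there does not tend to 0 with e. *)
Lemma integrable_no_pole h s q : coprimep s q -> q != 0 -> cint h ->
  circle_ae (fun t => h t = s.[cis t] / q.[cis t]) ->
  forall z, root q z -> normc z != 1.
Proof.
move=> cop q0 ih hE z qz; apply/eqP => /cis_surj[th /andP[th0 th2] thz].
have sz0 : s.[z] != 0 by apply: coprimep_root qz; rewrite coprimep_sym.
have [q1 qE] : exists q1, q = q1 * ('X - z%:P) by apply/factor_theorem.
have [s1 sE] : exists s1, s - s.[z]%:P = s1 * ('X - z%:P).
  by apply/factor_theorem; rewrite /root !hornerE subrr.
have [B B0 hB] := normc_poly q1; have [L L0 hL] := normc_poly s1.
have c0 : 0 < normc s.[z] by rewrite normc_gt0.
(* Near z the numerator is at least |s(z)| / 2 and the denominator at most 2 (B + 1) (t - th). In e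
   below, the first bound keeps the interval inside the circle and the second keeps s within |s(z)|
   / 2 of s(z); the increments of B and L by 1 make the divisors positive. *)
pose c := normc s.[z] / 2 / (2 * (B + 1)).
have cp : 0 < c by rewrite !divr_gt0 // mulr_gt0 // ltr_wpDl.
pose e := Num.min ((2 * pi - th) / 2) (normc s.[z] / (4 * (L + 1))).
have e0 : 0 < e.
  rewrite lt_min; apply/andP; split; first by rewrite divr_gt0 // subr_gt0.
  by rewrite divr_gt0 // mulr_gt0 // ltr_wpDl.
have e1 : e <= (2 * pi - th) / 2 by rewrite ge_min lexx.
have e2 : e * (4 * (L + 1)) <= normc s.[z].
  by rewrite -ler_pdivlMr ?mulr_gt0 ?ltr_wpDl // ge_min lexx orbT.
have lip t : th <= t -> normc (cis t - z) <= 2 * (t - th).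
  move=> tt; have -> : cis t - z = cis th * (cis (t - th) - 1).
    by rewrite mulrBr mulr1 -cisD thz [th + _]addrC subrK.
  by rewrite Normc.normcM normc_cis mul1r cis_lipschitz // subr_ge0.
have lower t : th <= t -> t - th <= e -> q.[cis t] != 0 ->
    c <= normc (s.[cis t] / q.[cis t]) * (t - th).
  move=> tt te qt0; have tt' : 0 <= t - th by rewrite subr_ge0.
  have c1 : normc (cis t) <= 1 by rewrite normc_cis.
  rewrite Normc.normcM Normc.normcV mulrAC ler_pdivlMr ?normc_gt0 //.
  have hq : normc q.[cis t] <= 2 * (B + 1) * (t - th).
    rewrite qE hornerM hornerXsubC Normc.normcM.
    apply: le_trans (ler_pM _ _ (hB _ c1) (lip _ tt)) _; rewrite ?normc_ge0 //.
    nra.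
  have hs : normc s.[z] / 2 <= normc s.[cis t].
    have : normc (s.[z] - s.[cis t]) <= L * (2 * (t - th)).
      have -> : s.[z] - s.[cis t] = - (s1.[cis t] * (cis t - z)).
        have := congr1 (fun p => p.[cis t]) sE.
        by rewrite hornerD hornerN hornerC hornerM hornerXsubC => <-; rewrite opprB.
      by rewrite normcN Normc.normcM ler_pM ?normc_ge0 ?hL ?lip.
    have := normcB_le s.[z] s.[cis t]; nra.
  apply: (@le_trans _ _ (normc s.[z] / 2 * (t - th))); last by rewrite ler_wpM2r.
  apply: le_trans (ler_wpM2l (ltW cp) hq) _.
  by rewrite mulrA divfK // lt0r_neq0 // mulr_gt0 // ltr_wpDl.
pose A n : set R := `]th, (th + e * harmonic n)%R]%classic.
have h0 n : 0 < harmonic n :> R by exact: harmonic_gt0.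
have h1 n : harmonic n <= 1 :> R by rewrite /harmonic /= invf_le1 ?ler1n.
have eh n : 0 < e * harmonic n by rewrite mulr_gt0.
have mA n : measurable (A n) by exact: measurable_itv.
have key n : (c%:E <= \int[mu]_(t in @circle R) (normc (h t) * \1_(A n) t)%:E)%E.
  have -> : c%:E = (\int[mu]_(t in A n) cst (c / (e * harmonic n))%:E t)%E.
    rewrite integral_cst; last exact: mA.
    have := lebesgue_measure_itv (Interval (BRight th) (BRight (th + e * harmonic n))).
    rewrite /= lte_fin ltrDl eh -EFinB addrAC subrr add0r => mE.
    rewrite mE -EFinM divfK //; exact: lt0r_neq0 (eh n).
  apply: (@le_trans _ _ (\int[mu]_(t in @circle R) (c / (e * harmonic n) * \1_(A n) t)%:E)%E).
    apply: ge0_integral_mono.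
    - move=> t; rewrite /A /circle /= !in_itv /= => /andP[t1 ht].
      have {}ht : t <= th + e * harmonic n by exact: ht.
      have := ler_piMr (ltW e0) (h1 n); move=> *; apply/andP; split; lra.
    - by move=> t _; rewrite lee_fin divr_ge0 // ltW.
    - by move=> t _; rewrite lee_fin mulr_ge0 // divr_ge0 // ltW.
    - by move=> t At; rewrite indicE mem_set // mulr1.
  apply: ae_ge0_le_integral; first exact: measurable_circle.
  - by move=> t _; rewrite lee_fin mulr_ge0 // divr_ge0 // ltW.
  - apply/measurable_EFinP; apply: measurable_funM; first exact: measurable_cst.
    by apply: measurable_indic; exact: mA.
  - by move=> t _; rewrite lee_fin mulr_ge0 ?normc_ge0.
  - apply/measurable_EFinP; apply: measurable_funM; last by apply: measurable_indic; exact: mA.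
    by apply: measurable_normc; exact: cint_meas.
  - apply: circle_ae2 hE (ae_horner_neq0 q0) => t _ ht qt.
    rewrite lee_fin indicE; have [/set_mem|_] := boolP (t \in A n); last by rewrite !mulr0.
    rewrite /A /= in_itv /= => /andP[t1 t2]; rewrite !mulr1 ht.
    rewrite ler_pdivrMr; last exact: (eh n).
    have te : t - th <= e * harmonic n by rewrite lerBlDl.
    have te' : t - th <= e by apply: le_trans te _; rewrite ler_piMr // ltW.
    apply: le_trans (lower t (ltW t1) te' qt) _.
    by rewrite ler_wpM2l ?normc_ge0.
have c2 : 0 < c / 2 by rewrite divr_gt0.
have /fine_cvgP[fin /cvgrPdist_le /(_ _ c2) hI] := integrable_tail_vanish ih th0 e0.
have [N [hf hc]] := filter_ex (filterI fin hI).
have := key N; rewrite -(fineK hf) lee_fin.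
move: hc; rewrite sub0r normrN => hc hcI.
have := le_trans (le_trans hcI (ler_norm _)) hc; lra.
Qed.

(** The reduced denominator has no root, on the circle by integrability and elsewhere by definition.
    It is therefore constant, and strict properness leaves only the zero numerator. *)
Lemma integrable_Rat0_eq0 (x : ratfun R) h : in_Rat0 x -> cint h ->
  circle_ae (fun t => h t = rat_eval x (cis t)) -> x = 0.
Proof.
move=> [s [q [-> cop sq hq]]] ih hE.
have q0 : q != 0 by rewrite -size_poly_gt0 (leq_ltn_trans _ sq).
have := circle_ae2 _ hE (rat_eval_ae s q0) => /(_ (fun t => h t = s.[cis t] / q.[cis t])).
move=> /(_ (fun t _ e1 e2 => etrans e1 e2)) /(integrable_no_pole cop q0 ih) hno.
have q1 : size q == 1.
  apply: contraT => /closed_rootP[z qz].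
  by have := hno z qz; rewrite hq // eqxx.
move: sq; rewrite (eqP q1) ltnS leqn0 size_poly_eq0 => /eqP ->.
by rewrite tofrac0 mul0r.
Qed.

End PolesOnCircle.

(** * Block Hankel matrices *)

Section OperatorNorm.
Variables (R : realType) (m : nat).
Implicit Types (A : 'M[R[i]]_m) (x : 'cV[R[i]]_m).

Lemma euclidean_norm_ge0 x : 0 <= euclidean_norm x.
Proof. exact: sqrtr_ge0. Qed.

Lemma normc_le_euclidean_norm x k : normc (x k 0) <= euclidean_norm x.
Proof.
rewrite -[leLHS](ger0_norm (normc_ge0 _)) -sqrtr_sqr ler_sqrt; last first.
  by apply: sumr_ge0 => l _; rewrite sqr_ge0.
by rewrite (bigD1 k) //= lerDl sumr_ge0 // => l _; rewrite sqr_ge0.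
Qed.

Lemma euclidean_norm_le_sum x : euclidean_norm x <= \sum_k normc (x k 0).
Proof.
have s0 : 0 <= \sum_k normc (x k 0) by apply: sumr_ge0 => k _; exact: normc_ge0.
rewrite -[leRHS](ger0_norm s0) -sqrtr_sqr ler_sqrt ?sqr_ge0 //.
rewrite expr2 mulr_suml; apply: ler_sum => k _; rewrite expr2 ler_wpM2l ?normc_ge0 //.
by rewrite (bigD1 k) //= lerDl sumr_ge0 // => l _; exact: normc_ge0.
Qed.

Lemma euclidean_norm_mul_le A x : euclidean_norm x <= 1 ->
  euclidean_norm (A *m x) <= \sum_k \sum_l normc (A k l).
Proof.
move=> x1; apply: le_trans (euclidean_norm_le_sum _) _.
apply: ler_sum => k _; rewrite mxE; apply: le_trans (normc_sum _ _ _) _.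
apply: ler_sum => l _; rewrite Normc.normcM ler_piMr ?normc_ge0 //.
exact: le_trans (normc_le_euclidean_norm x l) x1.
Qed.

Lemma opnorm_le A : opnorm A <= \sum_k \sum_l normc (A k l).
Proof.
apply: ge_sup; last by move=> _ [x /= x1 <-]; exact: euclidean_norm_mul_le.
exists (euclidean_norm (A *m 0)), 0 => //=; apply: le_trans (euclidean_norm_le_sum _) _.
by rewrite big1 // => k _; rewrite mxE Normc.normc0.
Qed.

Lemma le_opnorm A x : euclidean_norm x <= 1 -> euclidean_norm (A *m x) <= opnorm A.
Proof.
move=> x1; apply: ub_le_sup; last by exists x.
by exists (\sum_k \sum_l normc (A k l)) => _ [y /= y1 <-]; exact: euclidean_norm_mul_le.
Qed.

Lemma entry_le_opnorm A k l : normc (A k l) <= opnorm A.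
Proof.
have -> : A k l = (A *m delta_mx l 0) k (0 : 'I_1) by rewrite -colE mxE.
apply: le_trans (normc_le_euclidean_norm _ _) (le_opnorm _ _).
apply: le_trans (euclidean_norm_le_sum _) _.
rewrite (bigD1 l) //= big1 ?addr0 => [|i il]; rewrite mxE ?eqxx ?Normc.normc1 //.
by rewrite (negPf il) Normc.normc0.
Qed.

Lemma opnorm_ge0 A : 0 <= opnorm A.
Proof.
apply: le_trans (le_opnorm A (_ : euclidean_norm 0 <= 1)); first exact: euclidean_norm_ge0.
apply: le_trans (euclidean_norm_le_sum _) _.
by rewrite big1 // => k _; rewrite mxE Normc.normc0.
Qed.

End OperatorNorm.

Section Hankel.
Variable K : fieldType.

Lemma mxrank_mxsub (m n m' n' : nat) (f : 'I_m' -> 'I_m) (g : 'I_n' -> 'I_n)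
  (A : 'M[K]_(m, n)) : (\rank (mxsub f g A) <= \rank A)%N.
Proof.
rewrite -[A in mxsub f g A]mulmx1 mxsub_mul rowsubE.
exact: leq_trans (mxrankM_maxl _ _) (mxrankM_maxr _ _).
Qed.

(* Among the left kernels of these matrices, which decrease with J, one of
   minimal dimension is contained in all the others. *)
Lemma bounded_rank_annihilator (x : nat -> K) r :
  (forall J, (\rank (\matrix_(i < r.+1, j < J) x (i + j)%N) <= r)%N) ->
  exists2 Q : {poly K}, Q != 0 & act Q x =1 (fun=> 0).
Proof.
pose M J := \matrix_(i < r.+1, j < J) x (i + j)%N; rewrite -/M => hr.
pose P n := `[< exists J, \rank (M J) = n >].
have exP : exists n, P n by exists (\rank (M 0%N)); apply/asboolP; exists 0%N.
have bP n : P n -> (n <= r)%N by move=> /asboolP[J <-]; exact: hr.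
case: (ex_maxnP exP bP) => _ /asboolP[J0 <-] maxJ.
have /rowV0Pn[v vM v0] : kermx (M J0) != 0.
  by rewrite kermx_eq0 /row_free neq_ltn ltnS hr.
have vMJ J : (J0 <= J)%N -> v *m M J = 0.
  move=> JJ; have sub : (kermx (M J) <= kermx (M J0))%MS.
    apply/sub_kermxP; have -> : M J0 = colsub (widen_ord JJ) (M J).
      by apply/matrixP => i j; rewrite !mxE.
    by rewrite mulmx_colsub mulmx_ker; apply/matrixP => i j; rewrite !mxE.
  apply/sub_kermxP; apply: submx_trans vM _.
  have : (\rank (kermx (M J0)) <= \rank (kermx (M J)))%N.
    by rewrite !mxrank_ker leq_sub2l // maxJ //; apply/asboolP; exists J.
  by rewrite (geq_leqif (mxrank_leqif_eq sub)) => /andP[_ h].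
exists (\poly_(i < r.+1) v 0 (inord i)).
  apply: contra_neq v0 => Q0; apply/rowP => i; rewrite mxE.
  by have := congr1 (fun p : {poly K} => p`_i) Q0;
    rewrite coef_poly ltn_ord inord_val coef0.
move=> n; rewrite (actE _ _ (size_poly _ _)).
have hn : (n < maxn J0 n.+1)%N by rewrite leq_max leqnn orbT.
have := congr1 (fun u : 'rV_(maxn J0 n.+1) => u 0 (Ordinal hn)) (vMJ _ (leq_maxl J0 n.+1)).
rewrite !mxE => h; rewrite -[RHS]h; apply: eq_bigr => i _.
by rewrite coef_poly ltn_ord inord_val mxE addnC.
Qed.

(** The entries of position (p, l) in the blocks form a scalar Hankel submatrix; a block matrix with
    k at least r + 1 and J contains the one of size (r + 1) x J. *)
Lemma hankel_rank_annihilator (m r : nat) (c : nat -> 'M[K]_m) :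
  (forall k, (1 <= k)%N -> (\rank (\mxblock_(i < k, j < k) c (i + j)%N) <= r)%N) ->
  forall p l, exists2 Q : {poly K}, Q != 0 & act Q (fun n => c n p l) =1 (fun=> 0).
Proof.
move=> hr p l; apply: (@bounded_rank_annihilator _ r) => J.
pose k := maxn r.+1 J.
have rk : (r.+1 <= k)%N by exact: leq_maxl.
have Jk : (J <= k)%N by exact: leq_maxr.
apply: leq_trans (hr k (leq_trans (ltn0Sn r) rk)).
set H := \mxblock_(i, j) _.
have -> : \matrix_(i < r.+1, j < J) c (i + j)%N p l =
    mxsub (fun i => tagnat.Rank (widen_ord rk i) p)
          (fun j => tagnat.Rank (widen_ord Jk j) l) H.
  apply/matrixP => i j; rewrite [LHS]mxE [RHS]mxE.
  have /matrixP /(_ p l) <- :=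
    mxblockK (fun i j : 'I_k => c (i + j)%N) (widen_ord rk i) (widen_ord Jk j).
  by rewrite [LHS]mxE.
exact: mxrank_mxsub.
Qed.

Lemma act_modp (Q S : {poly K}) (x : nat -> K) n : act Q x =1 (fun=> 0) ->
  act (S %% Q) x n = act S x n.
Proof.
move=> Qx; rewrite [in RHS](divp_eq S Q) actDl actM (act0 _ _ Qx).
by rewrite add0r.
Qed.

(* Reducing X^i modulo Q expresses the i-th block row through the first
   (size Q).-1 ones. *)
Lemma hankel_rank_bounded (m : nat) (c : nat -> 'M[K]_m) (Q : {poly K}) : Q != 0 ->
  (forall p l, act Q (fun n => c n p l) =1 (fun=> 0)) ->
  forall k, (\rank (\mxblock_(i < k, j < k) c (i + j)%N) <=
    \sum_(s < (size Q).-1) m)%N.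
Proof.
move=> Q0 hQ k.
have -> : \mxblock_(i < k, j < k) c (i + j)%N =
   (\mxblock_(i < k, s < (size Q).-1) ((('X^i %% Q)`_s)%:M : 'M[K]_m)) *m
   (\mxblock_(s < (size Q).-1, j < k) c (s + j)%N).
  rewrite mul_mxblock; apply: eq_mxblock => i j; apply/matrixP => p l.
  have sz : (size ('X^i %% Q)%R <= (size Q).-1)%N.
    by rewrite -ltnS prednK ?size_poly_gt0 // ltn_modp.
  have := @act_modp Q 'X^i _ j (hQ p l).
  rewrite (actE _ _ sz) => h.
  have -> : c (i + j)%N p l = act 'X^i (fun n => c n p l) j.
    rewrite /act size_polyXn big_ord_recr /= big1 ?add0r.
      by rewrite coefXn eqxx mul1r addnC.
    by move=> s _; rewrite coefXn ltn_eqF ?mul0r //.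
  rewrite -h summxE; apply: eq_bigr => s _.
  by rewrite mul_scalar_mx mxE addnC.
exact: leq_trans (mxrankM_maxl _ _) (rank_leq_col _).
Qed.

End Hankel.

Lemma is_max_ge1_bounded (u : nat -> nat) (B : nat) :
  (forall k, (1 <= k)%N -> (u k <= B)%N) -> exists n, is_max_ge1 u n.
Proof.
move=> hB; pose P n := `[< exists2 k, (1 <= k)%N & u k = n >].
have exP : exists n, P n by exists (u 1%N); apply/asboolP; exists 1%N.
have bP n : P n -> (n <= B)%N by move=> /asboolP[k k1 <-]; exact: hB.
case: (ex_maxnP exP bP) => n /asboolP hn maxn.
exists n; split=> // k k1; apply: maxn; apply/asboolP; by exists k.
Qed.

(** For j >= N one has j + 1 <= (N + 1) (j - N + 1), and every factor of the falling factorial N!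
    'C(j, N) is at least j - N + 1. *)
Lemma polynomial_le_binomial (R : realType) (N : nat) :
  exists2 D : R, 0 < D &
    forall j, (N <= j)%N -> j.+1%:R ^+ N <= D * 'C(j, N)%:R.
Proof.
exists ((N.+1 ^ N * N`!)%:R); first by rewrite ltr0n muln_gt0 expn_gt0 fact_gt0.
move=> j Nj; rewrite -natrX -natrM ler_nat -mulnA [(N`! * _)%N]mulnC bin_ffact.
apply: (@leq_trans ((N.+1 * (j - N).+1) ^ N)).
  have [->|N0] := posnP N; first by rewrite !expn0.
  by rewrite leq_exp2r //; nia.
rewrite expnMn leq_mul2l; apply/orP; right.
have -> : ((j - N).+1 ^ N = \prod_(i < N) (j - N).+1)%N.
  by rewrite prod_nat_const card_ord.
rewrite ffact_prod.
by apply: leq_prod => i _; move: (nat_of_ord i) (ltn_ord i) => k kN; lia.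
Qed.

(** * From the symbol to the conditions *)

Section ScalarSymbol.
Variable R : realType.
Implicit Types (x : nat -> R[i]) (s q Q : {poly R[i]}) (w : ratfun R).

(** If a > 1, its (N+1)-st root b also exceeds 1 and b^n grows at least linearly; the power N + 1 of
    this outgrows any multiple of (n + 1)^N. *)
Lemma polynomial_pow_le1 (a C : R) N : 0 <= a ->
  (forall n, a ^+ n <= C * n.+1%:R ^+ N) -> a <= 1.
Proof.
move=> a0 h; rewrite leNgt; apply/negP => a1.
pose b := powR a N.+1%:R^-1.
have bE : b ^+ N.+1 = a.
  by rewrite -powR_mulrn ?powR_ge0 // -powRrM mulVf ?powRr1 // pnatr_eq0.
have b0 : 0 <= b by exact: powR_ge0.
have b1 : 1 < b.
  rewrite ltNge; apply/negP => b1.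
  by have := exprn_ile1 N.+1 b0 b1; rewrite bE leNgt a1.
(* The bound by 1 starts the induction for d (n + 1) <= b^n, and the bound by b - 1 carries it
   on. *)
pose d := Num.min 1 (b - 1).
have d0 : 0 < d by rewrite lt_min ltr01 subr_gt0.
have d1 : d <= 1 by rewrite ge_min lexx.
have db : d <= b - 1 by rewrite ge_min lexx orbT.
have bn n : d * n.+1%:R <= b ^+ n.
  elim: n => [|n IH]; first by rewrite expr0 mulr1.
  have bn1 : 1 <= b ^+ n by rewrite exprn_ege1 // ltW.
  rewrite exprS -natr1 mulrDr mulr1.
  have : (b - 1) * b ^+ n >= b - 1 by rewrite ler_peMr // subr_ge0 ltW.
  lra.
have key n : n.+1%:R <= C / d ^+ N.+1.
  rewrite ler_pdivlMr ?exprn_gt0 //.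
  have n0 : 0 < n.+1%:R ^+ N :> R by rewrite exprn_gt0.
  rewrite -(ler_pM2r n0); apply: le_trans (h n).
  rewrite -bE -exprM mulnC exprM mulrAC -exprS -exprMn mulrC.
  by rewrite lerXn2r ?nnegrE ?mulr_ge0 ?exprn_ge0 ?(ltW d0).
have := key (Num.truncn (C / d ^+ N.+1)).
by rewrite leNgt truncnS_gt.
Qed.

Lemma annihilator_roots_le1 Q x (C : R) N : Q \is monic -> act Q x =1 (fun=> 0) ->
  (forall S, act S x =1 (fun=> 0) -> Q %| S) ->
  (forall n, normc (x n) <= C * n.+1%:R ^+ N) ->
  forall z, root Q z -> normc z <= 1.
Proof.
move=> Qm Qx minQ hx z /(root_growth Qm Qx minQ)[D D0 hD].
have C0 : 0 <= C.
  by have := hx 0%N; rewrite expr1n mulr1; apply: le_trans; exact: normc_ge0.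
apply: (@polynomial_pow_le1 _ (D * ((size Q)%:R * (C * (size Q)%:R ^+ N))) N).
  exact: normc_ge0.
move=> n; apply: le_trans (hD n) _; rewrite -mulrA ler_wpM2l //.
(* For i < size Q, n + i + 1 is at most (size Q) (n + 1). *)
apply: (@le_trans _ _ (\sum_(i < size Q) C * ((size Q)%:R * n.+1%:R) ^+ N)).
  apply: ler_sum => i _; apply: le_trans (hx _) _; rewrite ler_wpM2l //.
  rewrite -natrM lerXn2r ?nnegrE ?ler0n // ler_nat.
  by move: (size Q) (nat_of_ord i) (ltn_ord i) => k j jk; nia.
by rewrite sumr_const card_ord -[leLHS]mulr_natl exprMn !mulrA.
Qed.

Lemma geometric_bound_sum (I : eqType) (r : seq I) (f : I -> nat -> R) :
  (forall i, exists C q : R, [/\ 0 <= C, 0 < q, q < 1 & forall n, f i n <= C * q ^+ n]) ->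
  exists C q : R, [/\ 0 <= C, 0 < q, q < 1 &
    forall n, \sum_(i <- r) f i n <= C * q ^+ n].
Proof.
move=> h; elim: r => [|i r [C [q [C0 q0 q1 IH]]]].
  by exists 0, 2^-1; split=> //; [lra|move=> n; rewrite big_nil mul0r].
have [D [t [D0 t0 t1 hD]]] := h i.
exists (D + C), (Num.max t q); split.
- exact: addr_ge0.
- by rewrite lt_max t0.
- by rewrite gt_max t1.
move=> n; rewrite big_cons mulrDl; apply: lerD.
  apply: le_trans (hD n) _; rewrite ler_wpM2l // lerXn2r ?nnegrE ?(ltW t0) //.
    by rewrite le_max (ltW t0).
  by rewrite le_max lexx.
apply: le_trans (IH n) _; rewrite ler_wpM2l // lerXn2r ?nnegrE ?(ltW q0) //.
  by rewrite le_max (ltW t0).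
by rewrite le_max lexx orbT.
Qed.

Lemma polynomial_bound_sum (I : eqType) (r : seq I) (f : I -> nat -> R) :
  (forall i, exists C N, 0 <= C /\ forall n, f i n <= C * n.+1%:R ^+ N) ->
  exists C N, 0 <= C /\
    forall n, \sum_(i <- r) f i n <= C * n.+1%:R ^+ N.
Proof.
move=> h; elim: r => [|i r [C [N [C0 IH]]]].
  by exists 0, 0%N; split=> // n; rewrite big_nil mul0r.
have [D [M [D0 hD]]] := h i.
exists (D + C), (maxn M N); split; first exact: addr_ge0.
move=> n; rewrite big_cons mulrDl; apply: lerD.
  apply: le_trans (hD n) _; rewrite ler_wpM2l // ler_weXn2l ?ler1n //.
  exact: leq_maxl.
apply: le_trans (IH n) _; rewrite ler_wpM2l // ler_weXn2l ?ler1n //.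
exact: leq_maxr.
Qed.

Lemma common_annihilator (I : eqType) (r : seq I) (x : I -> nat -> R[i]) :
  (forall i, exists2 Q, Q != 0 & act Q (x i) =1 (fun=> 0)) ->
  exists2 Q, Q != 0 & forall i, i \in r -> act Q (x i) =1 (fun=> 0).
Proof.
move=> h; elim: r => [|i r [Q Q0 hQ]]; first by exists 1; rewrite ?oner_neq0.
have [S S0 hS] := h i; exists (Q * S); first by rewrite mulf_neq0.
move=> j; rewrite in_cons => /orP[/eqP->|/hQ jr] n; last rewrite mulrC.
  by rewrite actM (act0 _ _ hS).
by rewrite actM (act0 _ _ jr).
Qed.

(** The reciprocal polynomial z^D Q(1 / z). The degree D is explicit because [taylor_symbol] also
    reverses a numerator whose degree may be smaller. *)
Definition rev_poly D Q : {poly R[i]} := \poly_(i < D.+1) Q`_(D - i).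

Lemma horner_rev_poly D Q z : (size Q <= D.+1)%N -> z != 0 ->
  (rev_poly D Q).[z] = z ^+ D * Q.[z^-1].
Proof.
move=> sQ z0; rewrite horner_poly (horner_coef_wide _ sQ) mulr_sumr.
rewrite (reindex_inj rev_ord_inj) /=; apply: eq_bigr => i _; rewrite subSS.
have iD : (i <= D)%N by rewrite -ltnS.
rewrite subKn // mulrCA; congr (_ * _).
have -> : z ^+ D = z ^+ (D - i) * z ^+ i by rewrite -exprD subnK.
by rewrite exprVn mulfK // expf_neq0.
Qed.

(** P may have roots outside the disc. The minimal annihilator keeps only roots compatible with
    boundedness, which lie in the closed disc, and as roots of P they avoid the circle. *)
Lemma annihilated_decay_of_bounded P x (C : R) : P != 0 -> act P x =1 (fun=> 0) ->
  (forall z, root P z -> normc z != 1) -> (forall n, normc (x n) <= C) ->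
  exists C (q : R), [/\ 0 <= C, 0 < q, q < 1 & forall n, normc (x n) <= C * q ^+ n].
Proof.
move=> P0 Px hP hx; have [Q [Qm Qx minQ]] := min_annihilator P0 Px.
apply: (annihilated_decay Qm Qx) => z Qz; rewrite lt_neqAle.
rewrite hP; last exact: root_dvdp (minQ P Px) Qz.
apply: (annihilator_roots_le1 (C := C) (N := 0) Qm Qx minQ) Qz => n.
by rewrite expr0 mulr1.
Qed.

End ScalarSymbol.

Section ScalarRepresentation.
Variable R : realType.
Implicit Types (x : nat -> R[i]) (s q Q : {poly R[i]}) (w : ratfun R) (c : int -> R[i]).

Lemma circle_ae_all (I : eqType) (r : seq I) (P : I -> R -> Prop) :
  (forall i, circle_ae (P i)) -> circle_ae (fun t => forall i, i \in r -> P i t).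
Proof.
move=> hP; elim: r => [|i r IH]; first exact: circle_aeT.
apply: circle_ae2 (hP i) IH => t _ pi hr j.
by rewrite in_cons => /orP[/eqP->|/hr].
Qed.

Lemma reduced_fraction w : exists s q,
  [/\ coprimep s q, q != 0 & w = tofrac s / tofrac q].
Proof.
have [s [q [q0 ->]]] := ratfunP w; pose g := gcdp s q.
have g0 : g != 0 by rewrite gcdp_eq0 (negPf q0) andbF.
have sE : s = s %/ g * g by rewrite divpK ?dvdp_gcdl.
have qE : q = q %/ g * g by rewrite divpK ?dvdp_gcdr.
exists (s %/ g), (q %/ g); split.
- by apply: coprimep_div_gcd; rewrite q0 orbT.
- by apply: contra_neq q0 => h; rewrite qE h mul0r.
- by rewrite {1}sE {1}qE !tofracM invfM mulrACA divff ?mulr1 ?tofrac_eq0.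
Qed.

(* The scalar version of block_toeplitz_representation, with L^p weakened to
   L^1 and no reference to the Hardy space. *)
Definition scalar_representation w c := forall j : nat,
  exists (h : R -> R[i]) (r : ratfun R),
    [/\ cint h, in_Rat0 r,
        circle_ae (fun t =>
          rat_eval w (cis t) * cis t ^+ j = h t + rat_eval r (cis t)) &
        forall n : nat, fourier_coef h n%:Z = c (n%:Z - j%:Z)].

Lemma rat_evalZ_ae (a : R[i]) w : circle_ae (fun t =>
  rat_eval (tofrac a%:P * w) (cis t) = a * rat_eval w (cis t)).
Proof.
have := circle_ae_and (rat_evalM_ae (tofrac a%:P) w) (rat_eval_tofrac_ae a%:P).
by apply: circle_ae1 => t _ [-> ->]; rewrite hornerC.
Qed.

Lemma rat_eval0_ae : circle_ae (fun t => rat_eval (0 : ratfun R) (cis t) = 0).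
Proof.
have := rat_eval_tofrac_ae (0 : {poly R[i]}); rewrite tofrac0.
by apply: circle_ae1 => t _ ->; rewrite horner0.
Qed.

(** Let w = s / q. Combining the decompositions of w z^(n+1+i) with the coefficients q_i gives the
    polynomial z^(n+1) s on the left, so the combined Rat_0 part [rho] is integrable and vanishes.
    The combined h, called X, then equals z^(n+1) s; its Fourier coefficient of index 0 is both 0
    and the value of [act q] at n. *)
Lemma scalar_annihilator_minus w c : scalar_representation w c ->
  exists2 Q, Q != 0 & act Q (fun n => c (- n.+1%:Z)) =1 (fun=> 0).
Proof.
move=> hw; have [s [q [q0 wE]]] := ratfunP w; exists q => // n.
have /choice[f hf] : forall j : nat, exists hr : (R -> R[i]) * ratfun R,
    [/\ cint hr.1, in_Rat0 hr.2,
        circle_ae (fun t =>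
          rat_eval w (cis t) * cis t ^+ j = hr.1 t + rat_eval hr.2 (cis t)) &
        forall n : nat, fourier_coef hr.1 n%:Z = c (n%:Z - j%:Z)].
  by move=> j; have [h [r hr]] := hw j; exists (h, r).
pose N (i : 'I_(size q)) := (n.+1 + i)%N.
pose X t := \sum_(i < size q) q`_i * (f (N i)).1 t.
pose rho := \sum_(i < size q) tofrac (q`_i)%:P * (f (N i)).2.
have rho_Rat0 : in_Rat0 rho.
  by apply: in_Rat0_sum => i; apply: in_Rat0Z; have [_ hr _ _] := hf (N i).
have iX : cint X.
  by apply: cint_sum => i; apply: cintZ; have [hc _ _ _] := hf (N i).
have eX : circle_ae (fun t => ('X^(n.+1) * s).[cis t] + -1 * X t = rat_eval rho (cis t)).
  have e1 := circle_ae_and (rat_eval_ae s q0) (ae_horner_neq0 q0).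
  have e2 : circle_ae (fun t => forall i, i \in enum 'I_(size q) ->
      rat_eval w (cis t) * cis t ^+ N i = (f (N i)).1 t + rat_eval (f (N i)).2 (cis t)).
    by apply: circle_ae_all => i; have [_ _ he _] := hf (N i).
  have e3 : circle_ae (fun t => forall i, i \in enum 'I_(size q) ->
      rat_eval (tofrac (q`_i)%:P * (f (N i)).2) (cis t) =
      q`_i * rat_eval (f (N i)).2 (cis t)).
    by apply: circle_ae_all => i; exact: rat_evalZ_ae.
  have e4 := rat_eval_sum_ae (fun i : 'I_(size q) => tofrac (q`_i)%:P * (f (N i)).2).
  apply: circle_ae1 (circle_ae_and (circle_ae_and e1 e2) (circle_ae_and e3 e4)).
  move=> t _ [[[et qt] {}e2] [{}e3 e4t]]; rewrite e4t.
  rewrite (eq_bigr _ (fun i _ => e3 i (mem_enum _ i))).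
  have -> : ('X^(n.+1) * s).[cis t] =
      \sum_(i < size q) q`_i * (rat_eval w (cis t) * cis t ^+ N i).
    have : s.[cis t] = q.[cis t] * (s.[cis t] / q.[cis t]) by rewrite mulrC divfK.
    rewrite hornerM hornerXn wE et; move: (s.[cis t] / q.[cis t]) => y ->.
    rewrite horner_coef mulr_suml mulr_sumr; apply: eq_bigr => i _.
    rewrite /N exprD; move: (cis t ^+ n.+1) (cis t ^+ i) => u v; ring.
  rewrite /X mulr_sumr -big_split; apply: eq_bigr => i _ /=.
  by rewrite e2 ?mem_enum //; ring.
have iY : cint (fun t => ('X^(n.+1) * s).[cis t] + -1 * X t).
  by apply: cintD; [exact: cint_horner|exact: cintZ].
have rho0 : rho = 0 by exact: integrable_Rat0_eq0 rho_Rat0 iY eX.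
have XE : circle_ae (fun t => X t = ('X^(n.+1) * s).[cis t]).
  rewrite rho0 in eX; apply: circle_ae2 eX rat_eval0_ae => t _ h1 h2.
  by move: h1; rewrite h2 mulN1r => /subr0_eq.
have := fourier_ae 0 iX (cint_horner _) XE.
rewrite fourier_horner -[X in _ = X -> _]/(('X^(n.+1) * s)`_0) coefXnM /=.
rewrite fourier_sum => [|i]; last by apply: cintZ; have [hc _ _ _] := hf (N i).
move=> <-; apply: eq_bigr => i _; have [hc _ _ hF] := hf (N i).
by rewrite fourierZ // (hF 0%N) sub0r.
Qed.

(** Let w = h0 + V / Q be the decomposition for j = 0, and let D_k be the quotient of z^k V by Q. By
    uniqueness the h of w z^k is z^k h0 + D_k. Hence c_(-k) is a Fourier coefficient of h0, which is
    bounded, plus the constant term of D_k, which satisfies the recurrence of Q, whose roots lie on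
    the circle. *)
Lemma scalar_growth_minus w c : scalar_representation w c ->
  exists C N, 0 <= C /\ forall n : nat, normc (c (- n%:Z)) <= C * n.+1%:R ^+ N.
Proof.
move=> hw; have [h0 [r0 [ih0 [V [Q [r0E _ sV hQ]]] e0 F0]]] := hw 0%N.
have Q0 : Q != 0 by rewrite -size_poly_gt0 (leq_ltn_trans _ sV).
pose D k := ('X^k * V) %/ Q; pose E k := ('X^k * V) %% Q.
have cE (k : nat) : c (- k%:Z) = fourier_coef h0 (- k%:Z) + (D k)`_0.
  have [h [r [ih rR eh Fh]]] := hw k.
  (* The difference of two candidates for the Rat_0 part of w z^k; on the circle it equals the
     integrable h - g. *)
  pose y := tofrac (E k) / tofrac Q + tofrac (-1)%:P * r.
  have yR : in_Rat0 y.
    by apply: in_Rat0D; [apply: in_Rat0_intro => //; rewrite ltn_modp|exact: in_Rat0Z].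
  pose g t := cis (k%:Z%:~R * t) * h0 t + (D k).[cis t].
  have ig : cint g.
    apply: cintD; last exact: cint_horner.
    by under eq_fun do rewrite mulrC; exact: cint_cisM.
  have iy : cint (fun t => h t + -1 * g t) by apply: cintD => //; exact: cintZ.
  have ey : circle_ae (fun t => h t + -1 * g t = rat_eval y (cis t)).
    have e1 := circle_ae_and (circle_ae_and eh e0) (ae_horner_neq0 Q0).
    have e2 := circle_ae_and (rat_eval_ae V Q0) (rat_eval_ae (E k) Q0).
    have e3 := circle_ae_and (rat_evalZ_ae (-1) r)
      (rat_evalD_ae (tofrac (E k) / tofrac Q) (tofrac (-1)%:P * r)).
    apply: circle_ae1 (circle_ae_and e1 (circle_ae_and e2 e3)) => t _.
    move=> [[[{}eh {}e0] Qt] [[e4 e5] [e6 ->]]]; rewrite e5 e6 /g.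
    have -> : h t = rat_eval w (cis t) * cis t ^+ k - rat_eval r (cis t).
      by rewrite eh addrK.
    rewrite -[rat_eval w _]mulr1 -[1](expr0 (cis t)) e0 r0E e4 -cisXz.
    have := congr1 (fun p => p.[cis t]) (divp_eq ('X^k * V) Q).
    rewrite hornerD !hornerM hornerXn -/(D k) -/(E k) => hV.
    have -> : (E k).[cis t] = cis t ^+ k * V.[cis t] - (D k).[cis t] * Q.[cis t].
      by rewrite hV addrAC subrr add0r.
    by field.
  have y0 : y = 0 by exact: integrable_Rat0_eq0 yR iy ey.
  have hg : circle_ae (fun t => h t = g t).
    rewrite y0 in ey; apply: circle_ae2 ey rat_eval0_ae => t _ h1 h2.
    by move: h1; rewrite h2 mulN1r => /subr0_eq.
  have := Fh 0%N; rewrite sub0r => <-; rewrite (fourier_ae _ ih ig hg) /g.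
  rewrite fourierD; [|by under eq_fun do rewrite mulrC; exact: cint_cisM|exact: cint_horner].
  by rewrite fourier_shift sub0r fourier_horner.
(* Division by Q is linear and \sum_i Q_i z^(n+1+i) V = Q z^(n+1) V, so the quotients combine to
   z^(n+1) V. Starting at index 1 makes its constant term 0. *)
have DQ : act Q (fun n => (D n.+1)`_0) =1 (fun=> 0).
  move=> n.
  have dsum (I : Type) (s : seq I) (F : I -> {poly R[i]}) :
      \sum_(i <- s) (F i %/ Q) = (\sum_(i <- s) F i) %/ Q.
    by elim/big_rec2: _ => [|i p1 p2 _ ->]; rewrite ?div0p ?divpD.
  have : \sum_(i < size Q) Q`_i *: D (n.+1 + i)%N = 'X^(n.+1) * V.
    under eq_bigr do rewrite -divpZl; rewrite dsum -[RHS](mulpK _ Q0).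
    congr (_ %/ _); rewrite -[Q in RHS]coefK poly_def mulr_sumr.
    by apply: eq_bigr => i _; rewrite exprD -!mul_polyC; ring.
  move/(congr1 (fun p : {poly R[i]} => p`_0)); rewrite coefXnM /= coef_sum => h; rewrite -[RHS]h.
  by apply: eq_bigr => i _; rewrite coefZ.
have [P [Pm Px minP]] := min_annihilator Q0 DQ.
have [z Pz|C [N [C0 hC]]] := annihilated_polynomial_growth Pm Px.
  by rewrite (hQ z) // (root_dvdp (minP Q DQ)).
pose B := pi^-1 * Rintegral lebesgue_measure (@circle R) (fun t => normc (h0 t)).
have B0 : 0 <= B := le_trans (normc_ge0 _) (fourier_bound 0 ih0).
exists (B + normc (D 0%N)`_0 + C), N; split.
  by rewrite !addr_ge0 ?normc_ge0.
move=> n; rewrite cE; apply: le_trans (le_normcD _ _) _.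
have n1 : 1 <= n.+1%:R ^+ N :> R by rewrite exprn_ege1 // ler1n.
rewrite -addrA mulrDl; apply: lerD.
  by apply: le_trans (fourier_bound _ ih0) _; rewrite ler_peMr.
case: n n1 => [|n] n1.
  by rewrite expr1n mulr1 lerDl.
rewrite mulrDl ler_wpDl ?mulr_ge0 ?normc_ge0 ?exprn_ge0 //.
apply: le_trans (hC n) _; rewrite ler_wpM2l // lerXn2r ?nnegrE ?ler0n //.
by rewrite ler_nat.
Qed.

(** The decomposition for j = 0 makes w - r = s / q integrable, so q has no root on the circle. The
    Fourier coefficients of q h = s give a recurrence, those of h are bounded, and bounded solutions
    without characteristic roots on the circle decay. *)
Lemma scalar_plus w c : scalar_representation w c ->
  exists2 Q, Q != 0 & act Q (fun n : nat => c n%:Z) =1 (fun=> 0) /\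
  exists C r : R, [/\ 0 <= C, 0 < r, r < 1 &
    forall n : nat, normc (c n%:Z) <= C * r ^+ n].
Proof.
move=> hw; have [h [r [ih rR e0 F0]]] := hw 0%N.
have {}F0 n : fourier_coef h n%:Z = c n%:Z by rewrite F0 subr0.
have [s [q [cop q0 wE]]] := reduced_fraction (w - r).
have eh : circle_ae (fun t => h t = s.[cis t] / q.[cis t]).
  have e1 := circle_ae_and e0 (rat_eval_ae s q0).
  have e2 := circle_ae_and e1 (rat_evalD_ae (w - r) r).
  apply: circle_ae1 e2 => t _ [[]]; rewrite subrK wE expr0 mulr1.
  by move=> -> -> /addIr.
have hq := integrable_no_pole cop q0 ih eh.
have eq : circle_ae (fun t => q.[cis t] * h t = s.[cis t]).
  apply: circle_ae2 eh (ae_horner_neq0 q0) => t _ -> qt.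
  by rewrite mulrC divfK.
have rec (n : int) : \sum_(i < size q) q`_i * fourier_coef h (n - i%:Z) =
    if n is Posz k then s`_k else 0.
  rewrite -fourier_hornerM // -fourier_horner.
  exact: fourier_ae (cint_hornerM _ ih) (cint_horner _) eq.
pose d := (size q).-1; have sq : size q = d.+1 by rewrite prednK ?size_poly_gt0.
(* Convolution with q runs down the indices while [act] runs up, hence the reversal; the power of X
   skips the indices where s contributes. *)
pose P := rev_poly d q * 'X^(size s).
have rev0 : (rev_poly d q)`_0 = lead_coef q.
  by rewrite coef_poly /= subn0 lead_coefE.
have P0 : P != 0.
  apply: mulf_neq0; last by rewrite monic_neq0 ?monicXn.
  apply/eqP => rq0; move: q0.
  by rewrite -lead_coef_eq0 -rev0 rq0 coef0 eqxx.
have actXn (k n : nat) (S : {poly R[i]}) x : act (S * 'X^k) x n = act S x (n + k)%N.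
  elim: k n => [|k IH] n; first by rewrite expr0 mulr1 addn0.
  by rewrite exprSr mulrA actXM IH addSnnS.
have Px : act P (fun n : nat => c n%:Z) =1 (fun=> 0).
  move=> n; rewrite /P actXn (actE _ _ (size_poly _ _)).
  have := rec (n + size s + d)%N; rewrite nth_default; last by rewrite addnAC leq_addl.
  move=> e; rewrite -[RHS]e sq (reindex_inj rev_ord_inj) /=; apply: eq_bigr => i _.
  have id : (i <= d)%N by rewrite -ltnS.
  rewrite subSS coef_poly ltnS leq_subr subKn //; congr (_ * _).
  rewrite -F0; congr fourier_coef; lia.
exists P => //; split=> //.
apply: (annihilated_decay_of_bounded P0 Px); last first.
  by move=> n; rewrite -F0; exact: fourier_bound.
move=> z; rewrite rootM => /orP[|]; last first.
  rewrite /root hornerXn expf_eq0 => /andP[_ /eqP ->].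
  by rewrite Normc.normc0 eq_sym oner_eq0.
have [->|z0] := eqVneq z 0; first by rewrite Normc.normc0 eq_sym oner_eq0.
rewrite /root horner_rev_poly ?sq // mulf_eq0 expf_eq0 (negPf z0) andbF /= => qz.
have := hq z^-1 qz; rewrite Normc.normcV; apply: contra => /eqP ->.
by rewrite invr1.
Qed.

End ScalarRepresentation.

Section Necessity.
Variables (R : realType) (p : R) (m : nat).
Hypothesis p1 : 1 < p.
Implicit Types (a : int -> 'M[R[i]]_m) (Omega : 'M[ratfun R]_m).

Lemma cvg_radial_monomial (j : nat) (u : R[i]) (t : R) :
  (r%:C * cis t) ^+ j * u @[r --> (1 : R)^'-] --> (cis t ^+ j * u : R[i]^o).
Proof.
apply/ccvgP => e e0; have n0 := normc_ge0 u.
have d0 : 0 < e / (normc u + 1) by rewrite divr_gt0 // ltr_wpDl.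
have c1 : (fun r : R => r ^+ j) r @[r --> (1 : R)^'-] --> (1 : R).
  rewrite -[X in _ --> X](expr1n R j).
  by apply: cvg_at_left_filter; exact: exprn_continuous.
have /cvgrPdist_le /(_ _ d0) := c1; apply: filterS => r hr.
have -> : cis t ^+ j * u - (r%:C * cis t) ^+ j * u = (1 - r ^+ j)%:C * (cis t ^+ j * u).
  by rewrite exprMn rmorphB rmorph1 rmorphXn; ring.
rewrite !Normc.normcM normcX normc_cis expr1n mul1r normc_real.
apply: le_trans (ler_wpM2r n0 hr) _.
by rewrite mulrAC ler_pdivrMr ?ltr_wpDl // ler_wpM2l ?(ltW e0) // lerDl.
Qed.

Lemma boundary_values_monomial (j : nat) (u : R[i]) (phi : R -> R[i]) :
  boundary_values (fun z => z ^+ j * u) phi ->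
  circle_ae (fun t => phi t = cis t ^+ j * u).
Proof.
apply: circle_ae1 => t _ h.
by apply: (cvg_unique (@norm_hausdorff _ R[i]^o) h); exact: cvg_radial_monomial.
Qed.

Lemma scalar_representation_of_block Omega a k l :
  block_toeplitz_representation p Omega (fun i j => a (i%:Z - j%:Z)) ->
  scalar_representation (Omega k l) (fun n => a n k l).
Proof.
move=> hO j; have [g [[_ [phi [h [r [bv hL rR hae [_ gT]]]]]] gt]] := hO (delta_mx l 0) j.
exists (fun t => h t k 0), (r k 0); split.
- by apply: in_Lp_cint (hL k); exact: ltW.
- exact: rR.
- have hphi : circle_ae (fun t => forall i, i \in enum 'I_m ->
      phi t i 0 = cis t ^+ j * (delta_mx l 0 : 'cV[R[i]]_m) i 0).
    apply: circle_ae_all => i; apply: boundary_values_monomial.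
    have := bv i; apply: circle_ae1 => t _.
    by under eq_fun do rewrite mxE.
  apply: circle_ae2 hae hphi => t _ /matrixP /(_ k 0) e1 e2.
  move: e1; rewrite [LHS]mxE [RHS]mxE [X in _ + X]mxE => <-.
  rewrite (bigD1 l) //= mxE e2 ?mem_enum // mxE !eqxx mulr1 big1 ?addr0 // => i il.
  by rewrite e2 ?mem_enum // !mxE (negPf il) !mulr0.
- move=> n; have := taylor_coefs_inj (gT k) (gt k) n; rewrite mxE => ->.
  by rewrite -colE mxE.
Qed.

Lemma necessity Omega a :
  block_toeplitz_representation p Omega (fun i j => a (i%:Z - j%:Z)) ->
  [/\ (exists F : R[i] -> R[i],
          in_Hp p F /\ taylor_coefs F (fun j => (opnorm (a j%:Z))%:C)),
      (exists (M : nat) (K : R),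
          [/\ (1 <= M)%N, 0 < K
            & forall j : nat, (1 <= j)%N -> (M - 1 <= j)%N ->
                opnorm (a (- j%:Z)) <= K * 'C(j, M - 1)%:R])
    & (exists n_plus : nat,
          is_max_ge1 (fun k => \rank (hankel_plus a k)) n_plus) /\
      (exists n_minus : nat,
          is_max_ge1 (fun k => \rank (hankel_minus a k)) n_minus)].
Proof.
move=> hO; have hs k l := scalar_representation_of_block k l hO.
have p0 : 0 <= p by exact: ltW (lt_trans ltr01 p1).
pose I := ('I_m * 'I_m)%type.
have opnorm_sum (A : 'M[R[i]]_m) : opnorm A <= \sum_(i <- enum {: I}) normc (A i.1 i.2).
  by rewrite big_enum /= -(pair_bigA _ (fun k l => normc (A k l))) /=; exact: opnorm_le.
have hankel_max (c : nat -> 'M[R[i]]_m) :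
    (forall i : I, exists2 Q : {poly R[i]}, Q != 0 & act Q (fun n => c n i.1 i.2) =1 (fun=> 0)) ->
    exists n, is_max_ge1 (fun k => \rank (\mxblock_(i < k, j < k) c (i + j)%N)) n.
  move=> /(common_annihilator (enum {: I}))[Q Q0 hQ].
  apply: is_max_ge1_bounded => k _; apply: hankel_rank_bounded Q0 _ k => q l.
  by apply: (hQ (q, l)); rewrite mem_enum.
split.
- have [|C [q [C0 q0 q1 hC]]] := geometric_bound_sum (enum {: I})
      (f := fun i n => normc (a n%:Z i.1 i.2)).
    by move=> [k l]; have [Q _ [_ h]] := scalar_plus (hs k l); exact: h.
  have hn n : normc (opnorm (a n%:Z))%:C <= C * q ^+ n.
    rewrite normc_real ger0_norm ?opnorm_ge0 //.
    exact: le_trans (opnorm_sum _) (hC n).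
  have [F [tF FC]] := taylor_of_decay C0 (ltW q0) (ltW q1) hn.
  exists F; split=> //; apply: (bounded_in_Hp p0 _ (FC q1)).
  by exists (fun j => (opnorm (a j%:Z))%:C).
- have [|C [N [C0 hC]]] := polynomial_bound_sum (enum {: I})
      (f := fun i n => normc (a (- n%:Z) i.1 i.2)).
    by move=> [k l]; exact: scalar_growth_minus (hs k l).
  have [D D0 hD] := @polynomial_le_binomial R N.
  (* Growth of degree N is matched by 'C(j, N), so M = N + 1; adding 1 makes the constant strictly
     positive. *)
  exists N.+1, (C * D + 1); split=> //; first by rewrite ltr_wpDl // mulr_ge0 // ltW.
  move=> j _; rewrite subn1 /= => Nj.
  apply: le_trans (opnorm_sum _) _; apply: le_trans (hC j) _.
  apply: le_trans (ler_wpM2l C0 (hD j Nj)) _.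
  by rewrite mulrA ler_wpM2r // lerDl.
- split.
    apply: (hankel_max (fun n => a n.+1%:Z)) => -[k l] /=.
    have [Q Q0 [hQ _]] := scalar_plus (hs k l); exists Q => // n.
    rewrite -[RHS](hQ (n + 1)%N) -act_shift; apply: eq_act => i.
    by rewrite addn1.
  apply: (hankel_max (fun n => a (- n.+1%:Z))) => -[k l] /=.
  exact: scalar_annihilator_minus (hs k l).
Qed.

End Necessity.

(** * From the conditions to the symbol *)

Section SymbolConstruction.
Variable R : realType.
Implicit Types (x : nat -> R[i]) (s q Q : {poly R[i]}) (c : int -> R[i]).

Lemma circle_factorization Q : Q \is monic -> (forall z, root Q z -> normc z <= 1) ->
  exists Q1 Q2, [/\ Q = Q1 * Q2, Q1 \is monic, Q2 \is monic, coprimep Q1 Q2 &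
    (forall z, root Q1 z -> normc z < 1) /\ (forall z, root Q2 z -> normc z = 1)].
Proof.
move=> /monic_roots[r ->] hr.
pose P (z : R[i]) := normc z < 1.
exists (\prod_(z <- r | P z) ('X - z%:P)), (\prod_(z <- r | ~~ P z) ('X - z%:P)).
have h1 z : root (\prod_(z <- r | P z) ('X - z%:P)) z -> normc z < 1.
  by rewrite -big_filter root_prod_XsubC mem_filter => /andP[].
have h2 z : root (\prod_(z <- r | ~~ P z) ('X - z%:P)) z -> normc z = 1.
  rewrite -big_filter root_prod_XsubC mem_filter /P -leNgt => /andP[z1 zr].
  by apply/eqP; rewrite eq_le z1 hr ?root_prod_XsubC.
split=> //.
- by rewrite (bigID P).
- exact: monic_prod_XsubC.
- exact: monic_prod_XsubC.
- apply/Pdiv.ClosedField.coprimepP => z /h1 z1; apply/negP => /h2 z2.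
  by move: z1; rewrite z2 ltxx.
Qed.

Lemma rev_poly_neq0 D Q : Q != 0 -> size Q = D.+1 -> rev_poly D Q != 0.
Proof.
move=> Q0 sQ; apply/eqP => /(congr1 (fun p : {poly R[i]} => p`_0)).
by rewrite coef_poly /= subn0 coef0 -[D]/(D.+1.-1) -sQ => /eqP; rewrite lead_coef_eq0 (negPf Q0).
Qed.

(* The power series with coefficients x n = c n is S / q, where S and q are the
   reversed polar_num Qp x and Qp; on the circle it is z^-1 times the value of
   polar_num Qp x / Qp at z^-1. *)
Lemma taylor_symbol Qp x : Qp \is monic -> act Qp x =1 (fun=> 0) ->
    (forall z, root Qp z -> normc z < 1) ->
  exists (w : ratfun R) (h : R -> R[i]),
    [/\ circle_ae (fun t => rat_eval w (cis t) = h t), cint h,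
        exists C, forall t, normc (h t) <= C,
        forall n : nat, fourier_coef h n%:Z = x n &
        forall n : nat, fourier_coef h (- n.+1%:Z) = 0].
Proof.
move=> Qm Qx hQ; have Q0 : Qp != 0 by exact: monic_neq0.
pose d := (size Qp).-1; have sQ : size Qp = d.+1 by rewrite prednK ?size_poly_gt0.
pose S := polar_num Qp x; have sS : (size S <= d)%N.
  by rewrite -ltnS -sQ; exact: size_polar_num.
have sg0 : (-1 : int) != 0 by [].
have := fourier_at_infinity sg0 Qm Qx hQ; cbv zeta.
set h := (fun t => _ / _) => -[ih [C hC] F1 F2].
have qw0 := rev_poly_neq0 Q0 sQ.
exists (tofrac (rev_poly d.-1 S) / tofrac (rev_poly d Qp)).
exists (fun t => cis ((-1)%:~R * t) * h t); split.
- apply: circle_ae1 (rat_eval_ae (rev_poly d.-1 S) qw0) => t _ ->.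
  have cV : (cis t)^-1 = cis ((-1)%:~R * t) by rewrite -cisN mulrN1z mulN1r.
  rewrite !horner_rev_poly ?cis_neq0 ?sQ //; last by rewrite (leq_trans sS) ?leqSpred.
  (* For d = 0 the numerator S vanishes. Otherwise reversing S in degree d - 1 and Qp in degree d
     leaves the factor 1 / z. *)
  rewrite /h -/S -cV; case: (d) sS => [|e] /= sS'.
    move: sS'; rewrite leqn0 size_poly_eq0 => /eqP ->.
    by rewrite horner0 mulr0 !mul0r mulr0.
  have ze : cis t ^+ e != 0 by rewrite expf_neq0 ?cis_neq0.
  rewrite exprS [cis t * _]mulrC -[_ * cis t * _]mulrA -mulf_div divff // mul1r.
  by rewrite invfM mulrCA.
- by under eq_fun do rewrite mulrC; exact: cint_cisM.
- by exists C => t; rewrite Normc.normcM normc_cis mul1r.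
- move=> n; rewrite fourier_shift -(F1 n); congr fourier_coef; lia.
- by move=> n; rewrite fourier_shift; apply: F2 => k; lia.
Qed.

Lemma laurent_symbol Q x : Q \is monic -> act Q x =1 (fun=> 0) ->
    (forall z, root Q z -> normc z < 1) ->
  exists h : R -> R[i],
    [/\ circle_ae (fun t =>
          rat_eval (tofrac (polar_num Q x) / tofrac Q) (cis t) = h t), cint h,
        exists C, forall t, normc (h t) <= C,
        forall n : nat, fourier_coef h n%:Z = 0 &
        forall n : nat, fourier_coef h (- n.+1%:Z) = x n].
Proof.
move=> Qm Qx hQ; have sg0 : (1 : int) != 0 by [].
have := fourier_at_infinity sg0 Qm Qx hQ; cbv zeta.
set h := (fun t => _ / _) => -[ih [C hC] F1 F2].
exists h; split=> //.
- apply: circle_ae1 (rat_eval_ae (polar_num Q x) (monic_neq0 Qm)) => t _ ->.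
  by rewrite /h mul1r.
- by exists C.
- by move=> n; apply: F2 => k; lia.
- by move=> n; rewrite -(F1 n) mulN1r.
Qed.

(** The symbol has three parts: one with the Taylor coefficients c_n, n >= 0, one with poles in the
    open disc and one with poles on the circle. Multiplication by z^j only shifts the Fourier
    coefficients of the first two; the third is divided as in [polar_num_iter], and its remainder is
    the Rat_0 part. *)
Lemma scalar_symbol Qp Qm c :
    Qp \is monic -> act Qp (fun n : nat => c n%:Z) =1 (fun=> 0) ->
    (forall z, root Qp z -> normc z < 1) ->
    Qm \is monic -> act Qm (fun n : nat => c (- n.+1%:Z)) =1 (fun=> 0) ->
    (forall z, root Qm z -> normc z <= 1) ->
  exists w : ratfun R, forall j : nat, exists (h : R -> R[i]) (r : ratfun R),
    [/\ cint h /\ exists C, forall t, normc (h t) <= C, in_Rat0 r,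
        circle_ae (fun t =>
          rat_eval w (cis t) * cis t ^+ j = h t + rat_eval r (cis t)) &
        forall n : nat, fourier_coef h n%:Z = c (n%:Z - j%:Z)].
Proof.
move=> Qp1 Qpx hQp Qm1 Qmy hQm; set y := (fun n : nat => _) in Qmy.
have [w1 [h1 [e1 i1 [C1 hC1] F1p F1m]]] := taylor_symbol Qp1 Qpx hQp.
have [Q1 [Q2 [QE m1 m2 cop [hQ1 hQ2]]]] := circle_factorization Qm1 hQm.
have /Bezout_eq1_coprimepP[[al be] /= bez] := cop.
(* The Bezout relation al Q1 + be Q2 = 1 splits y = u + v with Q1 annihilating u and Q2 annihilating
   v: the primary decomposition of y under the shift. *)
pose u := act (be * Q2) y; pose v := act (al * Q1) y.
have uv n : u n + v n = y n.
  by rewrite /u /v -actDl addrC bez -[1]/(1%:P) actC mul1r.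
have Q1u : act Q1 u =1 (fun=> 0).
  by move=> n; rewrite /u -actM mulrCA -QE actM; apply: act0.
have Q2v : act Q2 v =1 (fun=> 0).
  by move=> n; rewrite /v -actM mulrCA [Q2 * _]mulrC -QE actM; apply: act0.
have [h2 [e2 i2 [C2 hC2] F2p F2m]] := laurent_symbol m1 Q1u hQ1.
have Q20 := monic_neq0 m2.
exists (w1 + tofrac (polar_num Q1 u) / tofrac Q1 + tofrac (polar_num Q2 v) / tofrac Q2).
move=> j; pose D := expansion v j; pose V := polar_num Q2 (fun n => v (n + j)%N).
have [CD CD0 hD] := normc_poly D.
exists (fun t => cis (j%:Z%:~R * t) * (h1 t + h2 t) + D.[cis t]), (tofrac V / tofrac Q2).
have i12 : cint (fun t => cis (j%:Z%:~R * t) * (h1 t + h2 t)).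
  by under eq_fun do rewrite mulrC; apply: cint_cisM; exact: cintD.
split.
- split; first by apply: cintD => //; exact: cint_horner.
  exists (C1 + C2 + CD) => t; apply: le_trans (le_normcD _ _) _; apply: lerD.
    rewrite Normc.normcM normc_cis mul1r; apply: le_trans (le_normcD _ _) _.
    exact: lerD.
  by rewrite hD // normc_cis.
- apply: in_Rat0_intro => //; exact: size_polar_num.
- have a1 := circle_ae_and (circle_ae_and e1 e2) (ae_horner_neq0 Q20).
  have a2 := circle_ae_and (rat_eval_ae (polar_num Q2 v) Q20) (rat_eval_ae V Q20).
  have a3 := circle_ae_and
    (rat_evalD_ae w1 (tofrac (polar_num Q1 u) / tofrac Q1))
    (rat_evalD_ae (w1 + tofrac (polar_num Q1 u) / tofrac Q1) (tofrac (polar_num Q2 v) / tofrac Q2)).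
  apply: circle_ae1 (circle_ae_and a1 (circle_ae_and a2 a3)) => t _.
  move=> [[[{}e1 {}e2] Qt] [[-> ->] [e3 ->]]]; rewrite e3 e1 e2 -cisXz.
  have := congr1 (fun p => p.[cis t]) (polar_num_iter j Q2v).
  rewrite hornerM hornerXn hornerD hornerM -/D -/V => hV.
  have -> : V.[cis t] = cis t ^+ j * (polar_num Q2 v).[cis t] - D.[cis t] * Q2.[cis t].
    by rewrite hV addrAC subrr add0r.
  by field.
- move=> n; rewrite fourierD //; last exact: cint_horner.
  rewrite fourier_shift fourierD // fourier_horner coef_poly.
  have [jn|nj] := leqP j n.
    have -> : n%:Z - j%:Z = (n - j)%N%:Z by lia.
    by rewrite F1p F2p !addr0.
  (* For n < j the Laurent part contributes u and the polynomial D contributes v, both at index j -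
     1 - n; together they restore y. *)
  have -> : n%:Z - j%:Z = - (j.-1 - n).+1%:Z by lia.
  by rewrite F1m F2m add0r uv.
Qed.

End SymbolConstruction.

Section Sufficiency.
Variables (R : realType) (p : R) (m : nat).
Hypothesis p1 : 1 < p.
Implicit Types (x : nat -> R[i]) (a : int -> 'M[R[i]]_m) (u : R[i]).

Let p0 : 0 <= p := ltW (lt_trans ltr01 p1).

Lemma monomial_taylor (j : nat) u :
  taylor_coefs (fun z => z ^+ j * u) (fun n => (n == j)%:R * u).
Proof.
move=> z _; apply/ccvgP => e e0; exists j.+1 => // n /= jn.
rewrite /series /= big_mkord (bigD1 (Ordinal jn)) //= eqxx mul1r mulrC.
rewrite big1 ?addr0 ?subrr ?Normc.normc0 ?ltW // => i ij.
by move: ij; rewrite -val_eqE /= => /negPf ->; rewrite !mul0r.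
Qed.

Lemma monomial_in_Hp (j : nat) u : in_Hp p (fun z => z ^+ j * u).
Proof.
apply: (@bounded_in_Hp _ _ (normc u)) => //.
  by exists (fun n => (n == j)%:R * u); exact: monomial_taylor.
move=> z z1; rewrite Normc.normcM normcX ler_piMl ?normc_ge0 //.
by rewrite exprn_ile1 ?normc_ge0 // ltW.
Qed.

Definition decays x := exists C q : R,
  [/\ 0 <= C, 0 < q, q < 1 & forall n, normc (x n) <= C * q ^+ n].

Lemma decays_cons x : decays (fun n => x n.+1) -> decays x.
Proof.
move=> [C [q [C0 q0 q1 h]]]; exists (normc (x 0) + C / q), q.
have Cq : 0 <= C / q by rewrite divr_ge0 // ltW.
split=> //; first by rewrite addr_ge0 ?normc_ge0.
move=> [|n]; first by rewrite expr0 mulr1 lerDl.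
rewrite mulrDl ler_wpDl ?mulr_ge0 ?normc_ge0 ?exprn_ge0 ?(ltW q0) //.
by rewrite exprS mulrA divfK ?lt0r_neq0.
Qed.

(** Column j of the Toeplitz matrix starts with j terms of negative index, which only change the
    constant. *)
Lemma decays_shift (c : int -> R[i]) (j : nat) :
  decays (fun n : nat => c n%:Z) -> decays (fun n : nat => c (n%:Z - j%:Z)).
Proof.
move=> h; elim: j => [|j IH].
  by under eq_fun do rewrite subr0.
apply: decays_cons.
have -> : (fun n : nat => c (n.+1%:Z - j.+1%:Z)) = (fun n : nat => c (n%:Z - j%:Z)).
  by apply/funext => n; congr c; lia.
exact: IH.
Qed.

Lemma binomial_le_polynomial (n N : nat) : ('C(n, N) <= n ^ N)%N.
Proof.
have h : ('C(n, N) * N`! <= n ^ N)%N.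
  rewrite bin_ffact; elim: N => [|N IH]; first by rewrite ffactn0.
  by rewrite ffactnSr expnSr leq_mul // leq_subr.
by apply: leq_trans h; rewrite leq_pmulr // fact_gt0.
Qed.

(** The ranks provide annihilators of the entry; (i) and (ii), stated for norms, bound the entry and
    so place the roots of its minimal annihilators in the closed disc, after which (i) also excludes
    the circle for the indices n >= 0. *)
Lemma entry_symbol a k l :
    (exists F, in_Hp p F /\ taylor_coefs F (fun j => (opnorm (a j%:Z))%:C)) ->
    (exists (M : nat) (K : R),
        [/\ (1 <= M)%N, 0 < K
          & forall j : nat, (1 <= j)%N -> (M - 1 <= j)%N ->
              opnorm (a (- j%:Z)) <= K * 'C(j, M - 1)%:R]) ->
    (exists n, is_max_ge1 (fun k => \rank (hankel_plus a k)) n) ->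
    (exists n, is_max_ge1 (fun k => \rank (hankel_minus a k)) n) ->
  decays (fun n : nat => a n%:Z k l) /\
  exists w : ratfun R, forall j : nat, exists hr : (R -> R[i]) * ratfun R,
    [/\ cint hr.1 /\ exists C, forall t, normc (hr.1 t) <= C, in_Rat0 hr.2,
        circle_ae (fun t =>
          rat_eval w (cis t) * cis t ^+ j = hr.1 t + rat_eval hr.2 (cis t)) &
        forall n : nat, fourier_coef hr.1 n%:Z = a (n%:Z - j%:Z) k l].
Proof.
move=> [F [hF tF]] [M [K [_ K0 hK]]] [np [_ hp]] [nm [_ hm]].
pose b (n : nat) := opnorm (a n%:Z).
have b0 n : 0 <= b n by exact: opnorm_ge0.
have [B B0 hB] := in_Hp_coef_bounded (ltW p1) hF tF.
have {}hB n : b n <= B by have := hB n; rewrite normc_real ger0_norm ?opnorm_ge0.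
have [P P0 hP] := hankel_rank_annihilator (c := fun n => a n.+1%:Z) hp k l.
(* [hankel_plus] starts at a_1; the factor X adds a_0 to the sequence at the cost of a root 0. *)
have PX : act (P * 'X) (fun n : nat => a n%:Z k l) =1 (fun=> 0).
  move=> n; rewrite actXM -[RHS](hP n) -addn1 -act_shift; apply: eq_act => i.
  by rewrite addn1.
have PX0 : P * 'X != 0 by rewrite mulf_neq0 ?polyX_eq0 //.
have [Qp [Qp1 Qpx minQp]] := min_annihilator PX0 PX.
have hQp z : root Qp z -> normc z < 1.
  move=> Qz; rewrite lt_neqAle; apply/andP; split; last first.
    apply: (annihilator_roots_le1 (C := B) (N := 0) Qp1 Qpx minQp) Qz => n.
    by rewrite expr0 mulr1; apply: le_trans (hB n); exact: entry_le_opnorm.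
  apply/eqP => z1; have [C C0 hC] := root_growth Qp1 Qpx minQp Qz.
  (* With |z| = 1, [root_growth] says that C times each window sum of the entry is at least 1. Norms
     dominate entries, so window sums of b stay above (C + 1)^-1. *)
  have C1 : 0 < C + 1 by rewrite ltr_wpDl.
  have c0 : 0 < (C + 1)^-1 by rewrite invr_gt0.
  apply: (in_Hp_nonneg_coefs_vanish p1 hF tF b0 c0 (D := size Qp)) => n.
  have s0 : 0 <= \sum_(i < size Qp) b (n + i)%N by apply: sumr_ge0.
  rewrite -[leLHS]mulr1 ler_pdivrMl //.
  have := hC n; rewrite z1 expr1n => /le_trans; apply.
  apply: (@le_trans _ _ (C * \sum_(i < size Qp) b (n + i)%N)).
    rewrite ler_wpM2l //; apply: ler_sum => i _; exact: entry_le_opnorm.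
  by rewrite ler_wpM2r // lerDl.
have [Q Q0 hQ] := hankel_rank_annihilator (c := fun n => a (- n.+1%:Z)) hm k l.
have [Qm [Qm1 Qmx minQm]] := min_annihilator Q0 hQ.
have hQm z : root Qm z -> normc z <= 1.
  (* S covers the first M coefficients, among them all those with index below M - 1, for which (ii)
     gives no bound. *)
  pose S := \sum_(i < M) normc (a (- i.+1%:Z) k l).
  have S0 : 0 <= S by apply: sumr_ge0 => i _; exact: normc_ge0.
  apply: (annihilator_roots_le1 (C := S + K) (N := M - 1) Qm1 Qmx minQm) => n.
  have n1 : 1 <= n.+1%:R ^+ (M - 1) :> R by rewrite exprn_ege1 // ler1n.
  have n0 := le_trans ler01 n1.
  rewrite mulrDl; have [nM|Mn] := ltnP n M.
    apply: (@le_trans _ _ S).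
      by rewrite /S (bigD1 (Ordinal nM)) //= lerDl sumr_ge0 // => i _; exact: normc_ge0.
    by apply: ler_wpDr; rewrite ?ler_peMr // mulr_ge0 // ltW.
  apply: le_trans (entry_le_opnorm _ k l) _; apply: ler_wpDl; first by rewrite mulr_ge0.
  have Mn' : (M - 1 <= n.+1)%N.
    by rewrite leq_subLR; exact: leq_trans Mn (leqW (leqnSn n)).
  apply: le_trans (hK n.+1 isT Mn') _; rewrite ler_pM2l // -natrX ler_nat.
  exact: binomial_le_polynomial.
split; first exact: annihilated_decay Qp1 Qpx hQp.
have [w hw] := scalar_symbol (c := fun n => a n k l) Qp1 Qpx hQp Qm1 Qmx hQm.
by exists w => j; have [h [r hr]] := hw j; exists (h, r).
Qed.

Lemma sufficiency a :
    (exists F, in_Hp p F /\ taylor_coefs F (fun j => (opnorm (a j%:Z))%:C)) ->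
    (exists (M : nat) (K : R),
        [/\ (1 <= M)%N, 0 < K
          & forall j : nat, (1 <= j)%N -> (M - 1 <= j)%N ->
              opnorm (a (- j%:Z)) <= K * 'C(j, M - 1)%:R]) ->
    (exists n, is_max_ge1 (fun k => \rank (hankel_plus a k)) n) ->
    (exists n, is_max_ge1 (fun k => \rank (hankel_minus a k)) n) ->
  exists Omega : 'M[ratfun R]_m,
    block_toeplitz_representation p Omega (fun i j => a (i%:Z - j%:Z)).
Proof.
move=> c1 c2 c3 c4; have hs k l := entry_symbol k l c1 c2 c3 c4.
have dec k l := (hs k l).1.
have /choice[w hw] : forall kl : 'I_m * 'I_m, exists w : ratfun R, forall j : nat,
    exists hr : (R -> R[i]) * ratfun R,
    [/\ cint hr.1 /\ exists C, forall t, normc (hr.1 t) <= C, in_Rat0 hr.2,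
        circle_ae (fun t =>
          rat_eval w (cis t) * cis t ^+ j = hr.1 t + rat_eval hr.2 (cis t)) &
        forall n : nat, fourier_coef hr.1 n%:Z = a (n%:Z - j%:Z) kl.1 kl.2].
  by move=> [k l]; exact: (hs k l).2.
exists (\matrix_(k, l) w (k, l)) => v j.
have /choice[f hf] := fun kl => hw kl j.
(* The image of z^j v is built from the prescribed column, whose decay puts it in H^p; that it is
   the Riesz projection of h is then an equality of Fourier coefficients. *)
have /choice[G hG] : forall k : 'I_m, exists F : R[i] -> R[i],
    in_Hp p F /\ taylor_coefs F (fun n => (a (n%:Z - j%:Z) *m v) k 0).
  move=> k; have [|C [q [C0 q0 q1 hC]]] := geometric_bound_sum (enum 'I_m)
      (f := fun l (n : nat) => normc (a (n%:Z - j%:Z) k l * v l 0)).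
    move=> l; have [C [q [C0 q0 q1 hC]]] := decays_shift (c := fun n => a n k l) j (dec k l).
    exists (C * normc (v l 0)), q; split=> //; first by rewrite mulr_ge0 ?normc_ge0.
    by move=> n; rewrite Normc.normcM mulrAC ler_wpM2r ?normc_ge0.
  have {}hC n : normc ((a (n%:Z - j%:Z) *m v) k 0) <= C * q ^+ n.
    rewrite mxE; apply: le_trans (normc_sum _ _ _) _.
    by have := hC n; rewrite big_enum.
  have [F [tF FC]] := taylor_of_decay C0 (ltW q0) (ltW q1) hC.
  exists F; split=> //; apply: (bounded_in_Hp p0 _ (FC q1)).
  by exists (fun n : nat => (a (n%:Z - j%:Z) *m v) k 0).
pose h t : 'cV[R[i]]_m := \col_k \sum_l v l 0 * (f (k, l)).1 t.
pose r : 'cV[ratfun R]_m := \col_k \sum_l tofrac (v l 0)%:P * (f (k, l)).2.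
have hE k : (fun t => h t k 0) = (fun t => \sum_l v l 0 * (f (k, l)).1 t).
  by apply/funext => t; rewrite mxE.
have ih k l : cint (fun t => v l 0 * (f (k, l)).1 t).
  by apply: cintZ; have [[]] := hf (k, l).
pose g z : 'cV[R[i]]_m := \col_k G k z.
have gE k : (fun z => g z k 0) = G k by apply/funext => z; rewrite mxE.
exists g; split; last by move=> k; rewrite gE; exact: (hG k).2.
split.
  move=> k; have -> : (fun z : R[i] => (z ^+ j *: v) k 0) = (fun z => z ^+ j * v k 0).
    by apply/funext => z; rewrite mxE.
  exact: monomial_in_Hp.
exists (fun t => cis t ^+ j *: v), h, r; split.
- move=> k; apply: circle_aeT => t _; rewrite mxE.
  have -> : (fun s : R => ((s%:C * cis t) ^+ j *: v) k 0) =
      (fun s : R => (s%:C * cis t) ^+ j * v k 0).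
    by apply/funext => s; rewrite mxE.
  exact: cvg_radial_monomial.
- move=> k; rewrite hE.
  have /choice[B hB] : forall l : 'I_m, exists C, forall t, normc ((f (k, l)).1 t) <= C.
    by move=> l; have [[]] := hf (k, l).
  apply: (@bounded_in_Lp _ _ (\sum_l normc (v l 0) * B l)) => //.
    by apply: cint_meas; exact: cint_sum.
  move=> t _; apply: le_trans (normc_sum _ _ _) _; apply: ler_sum => l _.
  by rewrite Normc.normcM ler_wpM2l ?normc_ge0.
- move=> k; rewrite mxE; apply: in_Rat0_sum => l; apply: in_Rat0Z.
  by have [] := hf (k, l).
- pose P t k := \sum_l rat_eval (w (k, l)) (cis t) * (cis t ^+ j * v l 0) =
    \sum_l v l 0 * (f (k, l)).1 t +
    rat_eval (\sum_l tofrac (v l 0)%:P * (f (k, l)).2) (cis t).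
  have : circle_ae (fun t => forall k, k \in enum 'I_m -> P t k).
    apply: circle_ae_all => k.
    have e1 : circle_ae (fun t => forall l, l \in enum 'I_m ->
        rat_eval (w (k, l)) (cis t) * cis t ^+ j =
        (f (k, l)).1 t + rat_eval (f (k, l)).2 (cis t)).
      by apply: circle_ae_all => l; have [] := hf (k, l).
    have e2 : circle_ae (fun t => forall l, l \in enum 'I_m ->
        rat_eval (tofrac (v l 0)%:P * (f (k, l)).2) (cis t) =
        v l 0 * rat_eval (f (k, l)).2 (cis t)).
      by apply: circle_ae_all => l; exact: rat_evalZ_ae.
    have e3 := rat_eval_sum_ae (fun l => tofrac (v l 0)%:P * (f (k, l)).2).
    apply: circle_ae1 (circle_ae_and e1 (circle_ae_and e2 e3)) => t _.
    move=> [{}e1 [{}e2 {}e3]]; rewrite /P e3 -big_split; apply: eq_bigr => l _ /=.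
    by rewrite e2 ?mem_enum // mulrA e1 ?mem_enum //; ring.
  apply: circle_ae1 => t _ hP; apply/matrixP => k i; rewrite ord1 !mxE.
  rewrite -(hP k) ?mem_enum //; apply: eq_bigr => l _; by rewrite !mxE.
- split=> k; rewrite gE; first exact: (hG k).1.
  have -> : (fun n : nat => (\col_k0 fourier_coef (fun t => h t k0 0) n%:Z) k 0) =
      (fun n : nat => (a (n%:Z - j%:Z) *m v) k 0).
    apply/funext => n; rewrite !mxE hE fourier_sum //; apply: eq_bigr => l _.
    have [[hc _] _ _ hF] := hf (k, l); rewrite fourierZ // hF mulrC //.
  exact: (hG k).2.
Qed.

End Sufficiency.

Theorem theorem2p1 (R : realType) (p : R) (hp : 1 < p) (m : nat)
    (hm : (1 <= m)%N) (a : int -> 'M[R[i]]_m) :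
  (exists Omega : 'M[ratfun R]_m,
      block_toeplitz_representation p Omega (fun i j => a (i%:Z - j%:Z)))
  <->
  [/\ (exists F : R[i] -> R[i],
          in_Hp p F /\ taylor_coefs F (fun j => (opnorm (a j%:Z))%:C)),
      (* The bound is required where the binomial coefficient is nonzero:
         for 1 <= j < M - 1 it would force a_(-j) = 0, which fails for
         Omega = z^2 / (z - 1)^3. *)
      (exists (M : nat) (K : R),
          [/\ (1 <= M)%N, 0 < K
            & forall j : nat, (1 <= j)%N -> (M - 1 <= j)%N ->
                opnorm (a (- j%:Z)) <= K * 'C(j, M - 1)%:R])
    & (exists n_plus : nat,
          is_max_ge1 (fun k => \rank (hankel_plus a k)) n_plus) /\
      (exists n_minus : nat,
          is_max_ge1 (fun k => \rank (hankel_minus a k)) n_minus)].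
Proof.
split; first by case=> Omega; exact: (necessity hp).
by move=> [c1 c2 [c3 c4]]; exact: sufficiency.
Qed.
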